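(* Let $\phi:\mathbb C\to\mathbb C$ be a nonconstant entire function of exponential type which is not a multiple of an exponential function (i.e. $\phi$ is not of the form $z\mapsto c\,e^{az}$ with $a,c\in\mathbb C$). Assume that $|\phi(0)|>1$ and that there exists some $w\in\mathbb C$ such that $|\phi(tw)|\to 0$ as $t\to+\infty$. Then the operator $\phi(D)$, acting on $H(\mathbb C)$ endowed with the pointwise product, supports a hypercyclic algebra.
   Context: $H(\mathbb C)$ is the Fréchet algebra of entire functions with the topology of uniform convergence on compact sets and pointwise multiplication. $D:f\mapsto f'$. An entire function $\phi(z)=\sum_{n\ge0}a_nz^n$ is of exponential type if there are $A,B>0$ with $|\phi(z)|\le Ae^{B|z|}$ for all $z\in\mathbb C$; then $\phi(D)f=\sum_{n\geq 0}a_nf^{(n)}$ is a continuous linear operator on $H(\mathbb C)$. For a continuous linear operator $T$ on a topological vector space $X$, $HC(T)$ is the set of $x\in X$ whose orbit $\{x,Tx,T^2x,\dots\}$ is dense in $X$. If $X$ is a topological algebra, a hypercyclic algebra for $T$ is a subalgebra of $X$, different from $\{0\}$ and not required to be unital, contained in $HC(T)\cup\{0\}$; $T$ supports (or admits) a hypercyclic algebra if such a subalgebra exists. *)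

(* Defs.v *)
From mathcomp Require Import all_boot all_order all_algebra.
From mathcomp Require Import all_classical all_reals all_analysis.
From mathcomp Require Export complex.

Set Implicit Arguments.
Unset Strict Implicit.
Unset Printing Implicit Defensive.

Import Order.TTheory GRing.Theory Num.Theory.
Import numFieldNormedType.Exports.

Local Open Scope classical_set_scope.
Local Open Scope ring_scope.
Local Open Scope complex_scope.

(* The complex field R[i], seen as a numFieldType, so that its topology is the
   one given by the modulus and derivatives of functions Cplx R -> Cplx R are
   complex derivatives. *)
Definition Cplx (R : realType) : numFieldType := R[i].

(* The real-valued modulus; the MathComp norm `|z| of z : R[i] lies in R[i]. *)
Definition cabs (R : realType) (z : Cplx R) : R := complex.Re `|z|.

Definition cexp (R : realType) (z : Cplx R) : Cplx R :=
  (expR (complex.Re z))%:C * (cos (complex.Im z) +i* sin (complex.Im z)).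

Definition entire (R : realType) : set (Cplx R -> Cplx R) :=
  [set f : Cplx R -> Cplx R |
    forall z : Cplx R, derivable f z (1 : Cplx R)].

Definition exponential_type (R : realType) (phi : Cplx R -> Cplx R) : Prop :=
  exists A B : R, [/\ 0 < A, 0 < B &
    forall z, cabs (phi z) <= A * expR (B * cabs z)].

(* The coefficient a_n in phi(z) = \sum_n a_n z^n. *)
Definition taylor_coef (R : realType) (phi : Cplx R -> Cplx R) (n : nat) :
  Cplx R := derive1n n phi 0 / (n`!)%:R.

(* phi(D); the value is meaningful when phi is entire of exponential type and
   f is entire. *)
Definition diffop (R : realType) (phi f : Cplx R -> Cplx R) : Cplx R -> Cplx R :=
  fun z => limn (series (fun n => taylor_coef phi n * derive1n n f z)).

Definition orbit (X : Type) (T : X -> X) (x : X) : set X :=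
  range (fun n => iter n T x).

(* HC(T) for an operator T on the space of entire functions: the orbit is dense
   in the set of entire functions for uniform convergence on compact sets. *)
Definition hypercyclic (R : realType)
    (T : (Cplx R -> Cplx R) -> (Cplx R -> Cplx R)) : set (Cplx R -> Cplx R) :=
  [set f | entire f /\
    @entire R `<=`
      closure (orbit T f : set {family compact, Cplx R -> Cplx R})].

(* Not necessarily unital subalgebras, for the pointwise operations. *)
Record subalgebra (R : realType) (A : set (Cplx R -> Cplx R)) : Prop :=
  Subalgebra {
    subalgebra_entire : A `<=` @entire R;
    subalgebra0 : A (fun _ => 0);
    subalgebraD : forall f g, A f -> A g -> A (fun z => f z + g z);
    subalgebraZ : forall (c : Cplx R) f, A f -> A (fun z => c * f z);
    subalgebraM : forall f g, A f -> A g -> A (fun z => f z * g z)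
  }.

Definition hypercyclic_algebra (R : realType)
    (T : (Cplx R -> Cplx R) -> (Cplx R -> Cplx R))
    (A : set (Cplx R -> Cplx R)) : Prop :=
  [/\ subalgebra A,
      A <> [set (fun _ => 0)] &
      A `<=` hypercyclic T `|` [set (fun _ => 0)]].

Definition supports_hypercyclic_algebra (R : realType)
    (T : (Cplx R -> Cplx R) -> (Cplx R -> Cplx R)) : Prop :=
  exists A, hypercyclic_algebra T A.

(* Main.v *)
(** Put T = phi(D), so that T^N e^(l z) = phi(l)^N e^(l z).  By a Baire category
    construction it is enough to find, for 1 <= m <= M and entire f and g, an
    entire u close to f and an N such that T^N(u^m) is close to g while T^N(u^n)
    is small for m < n <= M: a generic F then has the property that, for every
    polynomial P with lowest term p_m X^m, m > 0, some T^N(P(F)) is close to p_m g.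

    Take u = sum_l a_l e^(alpha_l z) + sum_j c_j e^(mu_j z / m).  The first sum
    approximates f, with alpha_l near a far point of the ray on which phi tends
    to 0; sum_j b_j e^(mu_j z) approximates g, with mu_j near 0; and
    c_j^m phi(mu_j)^N = b_j.  When u^n is expanded, the terms c_j^m yield g.  The
    terms containing some alpha_l vanish in the limit because |phi| < 1 at their
    frequencies; the terms with n > m vanish because |phi| is close to
    |phi(0)| > 1 near 0; and the mixed terms of u^m vanish because |phi| at a mean
    of the mu_j is smaller than the geometric mean of the |phi(mu_j)|.  The last
    point uses that phi is not c e^(a z): then log|phi| is, up to an affine term,
    Re (k z^p + ...) with p >= 2, hence strictly convex along a direction where
    k z^p > 0.  *)
Require Import Defs.
From mathcomp Require Import all_boot all_order all_algebra.
From mathcomp Require Import all_classical all_reals all_analysis.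
From mathcomp Require Import ring lra.
Import Order.TTheory GRing.Theory Num.Theory.
Import numFieldNormedType.Exports.
Local Open Scope classical_set_scope.
Local Open Scope ring_scope.
Local Open Scope complex_scope.
Set Implicit Arguments.
Unset Strict Implicit.
Unset Printing Implicit Defensive.

(** All unwanted terms obey one test. As [c_j^m = b_j / phi(mu_j)^N], the [m]-th power of the
    modulus of the coefficient of a term of [T^N(u^n)] is a constant times the [N]-th power of [th],
    where [th] is [|phi|^m] at the frequency of the term, divided by the product of the
    [|phi(mu_j)|] over its factors of the second kind. The term vanishes once [th < 1], and no
    coherent choice of [m]-th roots is involved. The obstacle is the mixed terms of [u^m]. The
    [mu_j] must accumulate at 0 for their exponentials to span a dense space, and there [th] tends
    to 1, so a strict inequality has to hold for tuples of all scales at once. Taking the [mu_j]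
    geometric with a tiny ratio on one ray does this: if [k] of the [m] entries equal the largest
    one, [1 <= k < m], the mean is about [k / m] times that entry, and the comparison at order [p]
    reduces to [(k / m)^p < k / m]. A product may contain several [alpha_l], so these lie near a
    point [p0] with [|phi(k p0)| < 1] for every [k >= 1], which the ray provides. *)

(** * The modulus and the exponential on the complex field *)

Section Basics.
Variable R : realType.
Notation C := (Cplx R).
Implicit Types (x y : R) (z w : C).

Definition rc (x : R) : C := x%:C.
Definition ci : C := 'i.

Lemma cabsE z : `|z| = rc (cabs z).
Proof. by rewrite /cabs normc_def. Qed.

Lemma rc_inj : injective rc.
Proof. by move=> x y [] ->. Qed.

Lemma rcD x y : rc (x + y) = rc x + rc y.
Proof. exact: rmorphD. Qed.
Lemma rcB x y : rc (x - y) = rc x - rc y.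
Proof. exact: rmorphB. Qed.
Lemma rcM x y : rc (x * y) = rc x * rc y.
Proof. exact: rmorphM. Qed.
Lemma rcX x n : rc (x ^+ n) = rc x ^+ n.
Proof. exact: rmorphXn. Qed.
Lemma rcV x : rc x^-1 = (rc x)^-1.
Proof. exact: fmorphV. Qed.
Lemma rc0 : rc 0 = 0. Proof. by []. Qed.
Lemma rc1 : rc 1 = 1. Proof. by []. Qed.
Lemma rc_nat n : rc n%:R = n%:R.
Proof. exact: rmorph_nat. Qed.
Lemma rc_eq0 x : (rc x == 0) = (x == 0).
Proof. exact: fmorph_eq0. Qed.

Lemma cabs_ge0 z : 0 <= cabs z.
Proof. by have := normr_ge0 z; rewrite cabsE lecR. Qed.
Lemma cabsM z w : cabs (z * w) = cabs z * cabs w.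
Proof. by apply: rc_inj; rewrite rcM -!cabsE normrM. Qed.
Lemma cabsD z w : cabs (z + w) <= cabs z + cabs w.
Proof. by have := ler_normD z w; rewrite !cabsE -rcD lecR. Qed.
Lemma cabsN z : cabs (- z) = cabs z.
Proof. by apply: rc_inj; rewrite -!cabsE normrN. Qed.
Lemma cabsB z w : cabs (z - w) <= cabs z + cabs w.
Proof. by rewrite -(cabsN w); exact: cabsD. Qed.
Lemma cabs_subC z w : cabs (z - w) = cabs (w - z).
Proof. by rewrite -cabsN opprB. Qed.
Lemma cabs0 : cabs (0 : C) = 0.
Proof. by apply: rc_inj; rewrite -cabsE normr0. Qed.
Lemma cabs1 : cabs (1 : C) = 1.
Proof. by apply: rc_inj; rewrite -cabsE normr1. Qed.
Lemma cabs_eq0 z : (cabs z == 0) = (z == 0).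
Proof. by rewrite -(normr_eq0 z) cabsE rc_eq0. Qed.
Lemma cabs_gt0 z : (0 < cabs z) = (z != 0).
Proof. by rewrite lt_neqAle cabs_ge0 andbT eq_sym cabs_eq0. Qed.
Lemma cabs_rc x : cabs (rc x) = `|x|.
Proof. by apply: rc_inj; rewrite -cabsE /rc normc_def /= expr0n /= addr0 sqrtr_sqr. Qed.
Lemma cabsX z n : cabs (z ^+ n) = cabs z ^+ n.
Proof. by apply: rc_inj; rewrite rcX -!cabsE normrX. Qed.
Lemma cabsV z : cabs z^-1 = (cabs z)^-1.
Proof. by apply: rc_inj; rewrite rcV -!cabsE normfV. Qed.
Lemma cabs_nat n : cabs (n%:R : C) = n%:R.
Proof. by rewrite -rc_nat cabs_rc normr_nat. Qed.
Lemma cabs_sum (I : Type) (s : seq I) (P : pred I) (F : I -> C) :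
  cabs (\sum_(i <- s | P i) F i) <= \sum_(i <- s | P i) cabs (F i).
Proof.
elim/big_ind2 : _ => [|z x w y zx wy|//]; first by rewrite cabs0.
by apply: (le_trans (cabsD _ _)); exact: lerD.
Qed.
Lemma cabs_prod (I : Type) (s : seq I) (P : pred I) (F : I -> C) :
  cabs (\prod_(i <- s | P i) F i) = \prod_(i <- s | P i) cabs (F i).
Proof. by elim/big_rec2 : _ => [|i x z _ <-]; rewrite ?cabs1// cabsM. Qed.
Lemma cabs_triangle w z1 z2 : cabs (z1 - z2) <= cabs (z1 - w) + cabs (w - z2).
Proof. by rewrite -(subrKA w); exact: cabsD. Qed.
Lemma cabs_le_dist z w : cabs z <= cabs w + cabs (z - w).
Proof. by rewrite -{1}(subrKC w z); exact: cabsD. Qed.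

Lemma cabs_sqr z : cabs z ^+ 2 = complex.Re z ^+ 2 + complex.Im z ^+ 2.
Proof. by rewrite /cabs normc_def /= sqr_sqrtr// addr_ge0// sqr_ge0. Qed.
Lemma Re_le_cabs z : `|complex.Re z| <= cabs z.
Proof.
rewrite -(ler_pXn2r (_ : 0 < 2)%N) ?nnegrE ?cabs_ge0//.
by rewrite cabs_sqr real_normK ?num_real// lerDl sqr_ge0.
Qed.
Lemma Im_le_cabs z : `|complex.Im z| <= cabs z.
Proof.
rewrite -(ler_pXn2r (_ : 0 < 2)%N) ?nnegrE ?cabs_ge0//.
by rewrite cabs_sqr real_normK ?num_real// lerDr sqr_ge0.
Qed.

Lemma Re_add z w : complex.Re (z + w) = complex.Re z + complex.Re w.
Proof. by case: z w => [a b] [c d]. Qed.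
Lemma Im_add z w : complex.Im (z + w) = complex.Im z + complex.Im w.
Proof. by case: z w => [a b] [c d]. Qed.
Lemma Re_opp z : complex.Re (- z) = - complex.Re z.
Proof. by case: z. Qed.
Lemma Im_opp z : complex.Im (- z) = - complex.Im z.
Proof. by case: z. Qed.
Lemma Re_mul z w : complex.Re (z * w) =
  complex.Re z * complex.Re w - complex.Im z * complex.Im w.
Proof. by case: z w => [a b] [c d]. Qed.
Lemma Im_mul z w : complex.Im (z * w) =
  complex.Re z * complex.Im w + complex.Im z * complex.Re w.
Proof. by case: z w => [a b] [c d]. Qed.
Lemma Re_rcM x z : complex.Re (rc x * z) = x * complex.Re z.
Proof. by rewrite Re_mul /= mul0r subr0. Qed.
Lemma Im_rcM x z : complex.Im (rc x * z) = x * complex.Im z.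
Proof. by rewrite Im_mul /= mul0r addr0. Qed.
Lemma C_eqP z w : complex.Re z = complex.Re w -> complex.Im z = complex.Im w -> z = w.
Proof. by case: z w => [a b] [c d] /= -> ->. Qed.
Lemma C_decomp z : z = rc (complex.Re z) + ci * rc (complex.Im z).
Proof.
by apply: C_eqP; rewrite ?Re_add ?Im_add ?Re_mul ?Im_mul /=; ring.
Qed.
Lemma cabs_ci : cabs ci = 1.
Proof.
apply/eqP; rewrite -(eqrXn2 (_ : 0 < 2)%N) ?cabs_ge0// cabs_sqr /=.
by rewrite expr0n/= add0r.
Qed.
Lemma cabs_le_ReIm z : cabs z <= `|complex.Re z| + `|complex.Im z|.
Proof.
rewrite {1}(C_decomp z); apply: (le_trans (cabsD _ _)).
by rewrite cabsM !cabs_rc cabs_ci mul1r.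
Qed.


Lemma cexp_ReIm z :
  complex.Re (cexp z) = expR (complex.Re z) * cos (complex.Im z) /\
  complex.Im (cexp z) = expR (complex.Re z) * sin (complex.Im z).
Proof. by rewrite /cexp Re_mul Im_mul /= !mul0r subr0 addr0. Qed.
Lemma cexpD z w : cexp (z + w) = cexp z * cexp w.
Proof.
have [r1 i1] := cexp_ReIm z; have [r2 i2] := cexp_ReIm w.
have [r3 i3] := cexp_ReIm (z + w).
by apply: C_eqP; [rewrite Re_mul r3|rewrite Im_mul i3]; rewrite r1 i1 r2 i2 Re_add Im_add expRD ?cosD ?sinD; ring.
Qed.
Lemma cexp0 : cexp (0 : C) = 1.
Proof.
by have [r1 i1] := cexp_ReIm 0; apply: C_eqP; rewrite ?r1 ?i1 /= expR0 ?cos0 ?sin0 mul1r.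
Qed.
Lemma cabs_cexp z : cabs (cexp z) = expR (complex.Re z).
Proof.
apply/eqP; rewrite -(eqrXn2 (_ : 0 < 2)%N) ?cabs_ge0 ?expR_ge0// cabs_sqr.
have [-> ->] := cexp_ReIm z; rewrite !exprMn -mulrDr cos2Dsin2 mulr1//.
Qed.
Lemma cexp_neq0 z : cexp z != 0.
Proof. by rewrite -cabs_eq0 cabs_cexp gt_eqF// expR_gt0. Qed.
Lemma cexpN z : cexp (- z) = (cexp z)^-1.
Proof.
by apply: (mulfI (cexp_neq0 z)); rewrite -cexpD subrr cexp0 divff// cexp_neq0.
Qed.
Lemma cexp_natM n z : cexp (n%:R * z) = cexp z ^+ n.
Proof.
elim: n => [|n ih]; first by rewrite mul0r cexp0.
by rewrite exprS -ih -cexpD; congr cexp; rewrite -natr1; ring.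
Qed.
Lemma cexp_sum (I : Type) (s : seq I) (P : pred I) (F : I -> C) :
  cexp (\sum_(i <- s | P i) F i) = \prod_(i <- s | P i) cexp (F i).
Proof. by elim/big_rec2 : _ => [|i x z _ <-]; rewrite ?cexp0// cexpD. Qed.
Lemma cabs_cexp_le z : cabs (cexp z) <= expR (cabs z).
Proof. by rewrite cabs_cexp ler_expR (le_trans _ (Re_le_cabs z))// ler_norm. Qed.
Lemma cexp_2pi : cexp (ci * rc (2 * pi)) = 1.
Proof.
have [r1 i1] := cexp_ReIm (ci * rc (2 * pi)).
have re0 : complex.Re (ci * rc (2 * pi)) = 0 by rewrite Re_mul /=; ring.
have im2 : complex.Im (ci * rc (2 * pi)) = pi *+ 2 by rewrite Im_mul /=; ring.
by apply: C_eqP; rewrite ?r1 ?i1 re0 im2 expR0 mul1r ?cos2pi ?sin2pi.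
Qed.

Lemma C_ReIm z : exists x y : R, z = rc x + ci * rc y.
Proof. by exists (complex.Re z), (complex.Im z); exact: C_decomp. Qed.

Lemma C_root (z : C) n : (0 < n)%N -> exists w : C, w ^+ n = z.
Proof. by move=> n0; exists (n.-root (z : R[i])); exact: rootCK. Qed.

End Basics.
Opaque cabs cexp.

(** * Derivatives of functions and of paths; the mean value inequality *)

Section Derivative.

(** Multiplying by [|h|] clears the quotient and makes the excluded point [h = 0] harmless. The
    field is arbitrary because the criterion serves both over [R] and over [C]. *)
Lemma cvg_slopeP (K : numFieldType) (f : K -> K) (z l : K) :
  (h^-1 *: (f (h + z) - f z) @[h --> 0^'] --> l) <->
  forall e, 0 < e -> exists2 d, 0 < d &
    forall h, `|h| < d -> `|f (z + h) - f z - h * l| <= e * `|h|.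
Proof.
split=> [/cvgrPdist_le fl e e0|fl].
  have /nbhs_ballP[d /= d0 dP] := fl e e0.
  exists d => // h hd; have [->|h0] := eqVneq h 0.
    by rewrite addr0 subrr mul0r subrr normr0 mulr0.
  have := dP h; rewrite /ball /= sub0r normrN => /(_ hd h0).
  rewrite distrC (addrC h) => /(ler_wpM2r (normr_ge0 h)); rewrite -normrM.
  suff -> : (h^-1 *: (f (z + h) - f z) - l) * h = f (z + h) - f z - h * l by [].
  by rewrite /GRing.scale /=; field.
apply/cvgrPdist_le => e e0; have [d d0 dP] := fl e e0.
apply/nbhs_ballP; exists d => //= h; rewrite /ball /= sub0r normrN => hd h0.
have hn0 : 0 < `|h| by rewrite normr_gt0.
rewrite distrC (addrC h) -(ler_pM2r hn0) -normrM.
suff -> : (h^-1 *: (f (z + h) - f z) - l) * h = f (z + h) - f z - h * l by exact: dP.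
by rewrite /GRing.scale /=; field.
Qed.

Variable R : realType.
Notation C := (Cplx R).

(** Complex differentiability with real [e] and [d], where the norm of [Cplx R] would produce
    positive complex numbers. *)
Definition cderiv (f : C -> C) (z l : C) := forall e : R, 0 < e ->
  exists2 d : R, 0 < d & forall h, cabs h < d ->
    cabs (f (z + h) - f z - h * l) <= e * cabs h.

(** A path mixes two base fields, so its derivative is spelled out; [rderiv_ReIm] ties it to
    [is_derive] of the two components, through which real analysis is imported. *)
Definition rderiv (u : R -> C) (x : R) (l : C) := forall e : R, 0 < e ->
  exists2 d : R, 0 < d & forall h : R, `|h| < d ->
    cabs (u (x + h) - u x - rc h * l) <= e * `|h|.

Definition ccont (f : C -> C) (z : C) := forall e : R, 0 < e ->
  exists2 d : R, 0 < d & forall h, cabs h < d -> cabs (f (z + h) - f z) <= e.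

Definition rcont (u : R -> C) (x : R) := forall e : R, 0 < e ->
  exists2 d : R, 0 < d & forall h : R, `|h| < d -> cabs (u (x + h) - u x) <= e.

Lemma C_gt0_rc (e : C) : 0 < e -> exists2 x : R, 0 < x & e = rc x.
Proof.
by move=> e0; exists (cabs e); [rewrite cabs_gt0 gt_eqF|rewrite -cabsE gtr0_norm].
Qed.

Lemma lt_rc (x y : R) : (rc x < rc y) = (x < y).
Proof. exact: ltcR. Qed.
Lemma le_rc (x y : R) : (rc x <= rc y) = (x <= y).
Proof. exact: lecR. Qed.

Lemma cderivP (f : C -> C) (z l : C) : cderiv f z l <->
  (h^-1 *: (f (h + z) - f z) @[h --> 0^'] --> l).
Proof.
split=> [fl|/cvg_slopeP fl e e0].
  apply/cvg_slopeP => _ /C_gt0_rc[e e0 ->]; have [d d0 dP] := fl e e0.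
  exists (rc d); first by rewrite -(rc0 R) lt_rc.
  by move=> h; rewrite !cabsE -rcM lt_rc le_rc; exact: dP.
have /fl[_ /C_gt0_rc[d d0 ->] dP] : 0 < rc e by rewrite -(rc0 R) lt_rc.
by exists d => // h; have := dP h; rewrite !cabsE -rcM lt_rc le_rc.
Qed.

Lemma derivable_cderiv (f : C -> C) (z : C) :
  derivable f z (1 : C) <-> exists l, cderiv f z l.
Proof.
have E : (fun h : C => h^-1 *: ((f \o shift z) (h *: (1 : C)) - f z)) =
         (fun h : C => h^-1 *: (f (h + z) - f z)).
  by apply/funext => h /=; rewrite /GRing.scale /= mulr1.
split=> [|[l /cderivP fl]]; rewrite /derivable E.
  by move=> /cvg_ex[l fl]; exists l; apply/cderivP.
by apply/cvg_ex; exists l.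
Qed.

Lemma cderiv_derive1 (f : C -> C) (z l : C) : cderiv f z l -> derive1 f z = l.
Proof. by move=> /cderivP fl; rewrite /derive1; apply: cvg_lim => //; exact: norm_hausdorff. Qed.

Lemma entireP (f : C -> C) : entire f <-> forall z, exists l, cderiv f z l.
Proof. by split=> fe z; apply/derivable_cderiv/fe. Qed.

Lemma entire_derive1 (f : C -> C) : entire f -> forall z, cderiv f z (derive1 f z).
Proof.
by move=> /entireP fe z; have [l fl] := fe z; rewrite (cderiv_derive1 fl).
Qed.

Lemma rderiv_ReIm (u : R -> C) (x : R) (l : C) : rderiv u x l <->
  is_derive x 1 (@complex.Re R \o u) (complex.Re l) /\
  is_derive x 1 (@complex.Im R \o u) (complex.Im l).
Proof.
have E (f : R -> R) k : is_derive x 1 f k <->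
    (h^-1 *: (f (h + x) - f x) @[h --> 0^'] --> k).
  split=> [[+ <-]|fk].
    have E0 : forall h : R, h^-1 *: ((f \o shift x) (h *: (1 : R^o)) - f x) =
        h^-1 *: (f (h + x) - f x) by move=> h; rewrite /GRing.scale /= mulr1.
    rewrite /derivable /derive; under eq_fun do rewrite E0.
    exact.
  have fk' : (fun h : R => h^-1 *: ((f \o shift x) (h *: (1 : R^o)) - f x)) @ 0^' --> k.
    rewrite [X in X @ _](_ : _ = fun h : R => h^-1 *: (f (h + x) - f x))//.
    by apply/funext => h /=; rewrite /GRing.scale /= mulr1.
  by split; [apply/cvg_ex; exists k|apply: cvg_lim; [exact: norm_hausdorff|]].
split.
  move=> ul; split; apply/E/cvg_slopeP => e e0; have [d d0 dP] := ul e e0;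
    exists d => // h hd; apply: le_trans (dP h hd) => /=.
    apply: le_trans (Re_le_cabs _).
    by rewrite !Re_add !Re_opp Re_rcM.
  apply: le_trans (Im_le_cabs _).
  by rewrite !Im_add !Im_opp Im_rcM.
move=> [/E/cvg_slopeP ru /E/cvg_slopeP iu] e e0.
have e20 : 0 < e / 2 by rewrite divr_gt0.
have [d1 d10 dP1] := ru _ e20; have [d2 d20 dP2] := iu _ e20.
exists (Num.min d1 d2); first by rewrite lt_min d10.
move=> h; rewrite lt_min => /andP[/dP1 h1 /dP2 h2].
apply: (le_trans (cabs_le_ReIm _)); rewrite !Re_add !Im_add !Re_opp !Im_opp Re_rcM Im_rcM.
by apply: (le_trans (lerD h1 h2)); rewrite -mulrDl -splitr.
Qed.

Lemma rcont_ReIm (u : R -> C) (x : R) : rcont u x ->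
  {for x, continuous (@complex.Re R \o u)} /\ {for x, continuous (@complex.Im R \o u)}.
Proof.
move=> cu; split; apply/cvgrPdist_le => e e0; have [d d0 dP] := cu e e0;
  apply/nbhs_ballP; exists d => //= y; rewrite /ball /= distrC => xy;
  have := dP _ xy; rewrite subrKC distrC => /(fun h => le_trans _ h); apply.
  by apply: le_trans (Re_le_cabs _); rewrite Re_add Re_opp.
by apply: le_trans (Im_le_cabs _); rewrite Im_add Im_opp.
Qed.

Lemma antiderivative (u : R -> C) (a b : R) : (forall x, rcont u x) ->
  exists U : R -> C, forall x, a <= x <= b -> rderiv U x (u x).
Proof.
move=> cu.
suff H (f : R -> R) : (forall x, {for x, continuous f}) ->
    exists F : R -> R, forall x, a <= x <= b -> is_derive x 1 F (f x).
  have [F1 F1P] := H _ (fun x => (rcont_ReIm (cu x)).1).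
  have [F2 F2P] := H _ (fun x => (rcont_ReIm (cu x)).2).
  exists (fun x => rc (F1 x) + ci R * rc (F2 x)) => x xab; apply/rderiv_ReIm.
  have -> : @complex.Re R \o (fun x => rc (F1 x) + ci R * rc (F2 x)) = F1.
    by apply/funext => y /=; rewrite /= !mul0r mul1r subr0 addr0.
  have -> : @complex.Im R \o (fun x => rc (F1 x) + ci R * rc (F2 x)) = F2.
    by apply/funext => y /=; rewrite /= !mul0r mul1r !add0r.
  by split; [exact: F1P|exact: F2P].
move=> cf.
(* Starting at [a - 1] and, below, ending at [b + 1] makes every point of [[a, b]] interior, where
   the fundamental theorem applies. *)
pose F x := (\int[lebesgue_measure]_(t in [set` `[a - 1, x]]) f t)%R.
exists F => x /andP[ax xb].
have [] := @continuous_FTC1_closed R f (a - 1) x (b + 1) _ _ _ _.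
- by rewrite (le_lt_trans xb)// ltrDl.
- apply: continuous_compact_integrable; first exact: segment_compact.
  by apply: continuous_subspaceT => y; exact: cf.
- by rewrite (lt_le_trans _ ax)// ltrBlDr ltrDl.
- exact: cf.
by move=> dF <-; rewrite derive1E; exact: derivableP.
Qed.

(* The real mean value theorem is applied to the component of [U] along [U b - U a]. *)
Lemma mean_value_ineq (U u : R -> C) (a b M : R) : a <= b ->
  (forall x, a <= x <= b -> rderiv U x (u x)) ->
  (forall x, a <= x <= b -> cabs (u x) <= M) ->
  cabs (U b - U a) <= M * (b - a).
Proof.
rewrite le_eqVlt => /predU1P[->|ab] dU uM; first by rewrite !subrr cabs0 mulr0.
set w := U b - U a; pose p := complex.Re w; pose q := complex.Im w.
pose g x := p * complex.Re (U x) + q * complex.Im (U x).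
pose dg x := p * complex.Re (u x) + q * complex.Im (u x).
have gd x : a <= x <= b -> is_derive x 1 g (dg x).
  move=> /dU/rderiv_ReIm[d1 d2].
  have -> : g = (p *: (@complex.Re R \o U)) + (q *: (@complex.Im R \o U)) by [].
  by apply: is_deriveD.
have [c cab gE] : exists2 c, c \in `]a, b[ & g b - g a = dg c * (b - a).
  apply: MVT => // [x|].
    by rewrite in_itv/= => /andP[ax xb]; apply: gd; rewrite !ltW.
  apply: derivable_within_continuous => x; rewrite in_itv/= => xab.
  by have [] := gd x xab.
have w2 : cabs w ^+ 2 = g b - g a.
  by rewrite cabs_sqr /g /p /q /w !Re_add !Im_add !Re_opp !Im_opp; ring.
have cab' : a <= c <= b by move: cab; rewrite in_itv/= => /andP[? ?]; rewrite !ltW.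
have dgM : dg c <= cabs w * M.
  have -> : dg c = complex.Re ((p -i* q) * u c).
    by rewrite /dg Re_mul /= mulNr opprK.
  apply: (le_trans (ler_norm _)); apply: (le_trans (Re_le_cabs _)).
  rewrite cabsM; have -> : cabs (p -i* q : C) = cabs w.
    by apply/eqP; rewrite -(eqrXn2 (_ : 0 < 2)%N) ?cabs_ge0// !cabs_sqr/= sqrrN.
  by rewrite ler_wpM2l ?cabs_ge0// uM.
have [w0|w0] := eqVneq (cabs w) 0.
  rewrite w0 mulr_ge0 ?subr_ge0 ?(ltW ab)//.
  exact: le_trans (cabs_ge0 _) (uM c cab').
have wp : 0 < cabs w by rewrite lt_neqAle eq_sym w0 cabs_ge0.
rewrite -(ler_pM2l wp) -expr2 w2 gE mulrA ler_wpM2r// subr_ge0 ltW//.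
Qed.

End Derivative.

(** * Rules for complex derivatives *)

Section DerivativeRules.
Variable R : realType.
Notation C := (Cplx R).
Implicit Types (f g : C -> C) (z w l : C).

Lemma cderiv_is_derive f z l : cderiv f z l <-> is_derive z (1 : C) f l.
Proof.
split=> [fl|[fd <-]]; last first.
  have /derivable_cderiv[k fk] : derivable f z (1 : C) by [].
  by rewrite -derive1E (cderiv_derive1 fk).
have df : derivable f z (1 : C) by apply/derivable_cderiv; exists l.
by split=> //; rewrite -derive1E (cderiv_derive1 fl).
Qed.


Lemma cderiv_cst (c z : C) : cderiv (fun _ => c) z 0.
Proof. by apply/cderiv_is_derive; exact: is_derive_cst. Qed.
Lemma cderiv_id z : cderiv (fun w => w) z 1.
Proof. by apply/cderiv_is_derive; exact: is_derive_id. Qed.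
Lemma cderivD f g z l l' : cderiv f z l -> cderiv g z l' ->
  cderiv (fun w => f w + g w) z (l + l').
Proof.
by move=> /cderiv_is_derive fl /cderiv_is_derive gl; apply/cderiv_is_derive; exact: is_deriveD.
Qed.
Lemma cderivB f g z l l' : cderiv f z l -> cderiv g z l' ->
  cderiv (fun w => f w - g w) z (l - l').
Proof.
by move=> /cderiv_is_derive fl /cderiv_is_derive gl; apply/cderiv_is_derive; exact: is_deriveB.
Qed.
Lemma cderivM f g z l l' : cderiv f z l -> cderiv g z l' ->
  cderiv (fun w => f w * g w) z (f z * l' + g z * l).
Proof.
by move=> /cderiv_is_derive fl /cderiv_is_derive gl; apply/cderiv_is_derive; exact: is_deriveM.
Qed.
Lemma cderivZ c f z l : cderiv f z l -> cderiv (fun w => c * f w) z (c * l).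
Proof.
by move=> fl; have := cderivM (cderiv_cst c z) fl; rewrite mulr0 addr0.
Qed.

Lemma cderiv_lip f z l : cderiv f z l ->
  exists2 d : R, 0 < d & forall h, cabs h < d ->
    cabs (f (z + h) - f z) <= (cabs l + 1) * cabs h.
Proof.
move=> /(_ 1 ltr01)[d d0 dP]; exists d => // h /dP; rewrite mul1r => hP.
rewrite -(subrK (h * l) (f (z + h) - f z)); apply: (le_trans (cabsD _ _)).
by rewrite mulrDl mul1r addrC cabsM [cabs l * _]mulrC lerD2l.
Qed.

Lemma cderiv_ccont f z l : cderiv f z l -> ccont f z.
Proof.
move=> /cderiv_lip[d d0 dP] e e0.
have l0 : 0 < cabs l + 1 by rewrite ltr_wpDl ?cabs_ge0.
exists (Num.min d (e / (cabs l + 1))); first by rewrite lt_min d0 divr_gt0.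
move=> h; rewrite lt_min => /andP[/dP hP he]; apply: (le_trans hP).
by rewrite mulrC -ler_pdivlMr// ltW.
Qed.

Lemma cderiv_comp f g z l l' : cderiv g z l -> cderiv f (g z) l' ->
  cderiv (fun w => f (g w)) z (l * l').
Proof.
move=> gl fl e e0.
have [d1 d10 d1P] := cderiv_lip gl.
set K := cabs l + 1 in d1P; have K0 : 0 < K by rewrite ltr_wpDl ?cabs_ge0.
set K' := cabs l' + 1; have K'0 : 0 < K' by rewrite ltr_wpDl ?cabs_ge0.
have e1 : 0 < e / 2 / K by rewrite !divr_gt0.
have e2 : 0 < e / 2 / K' by rewrite !divr_gt0.
have [d2 d20 d2P] := fl _ e1; have [d3 d30 d3P] := gl _ e2.
exists (Num.min d1 (Num.min (d2 / K) d3)); first by rewrite !lt_min d10 d30 divr_gt0.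
move=> h; rewrite !lt_min => /and3P[/d1P h1 h2 /d3P h3].
have h2' : cabs (g (z + h) - g z) < d2.
  by apply: (le_lt_trans h1); rewrite mulrC -ltr_pdivlMr.
have := d2P _ h2'; rewrite subrKC => h4.
have -> : f (g (z + h)) - f (g z) - h * (l * l') =
  (f (g (z + h)) - f (g z) - (g (z + h) - g z) * l') + (g (z + h) - g z - h * l) * l'.
  by ring.
apply: (le_trans (cabsD _ _)); rewrite cabsM.
have a1 : e / 2 / K * cabs (g (z + h) - g z) <= e / 2 * cabs h.
  apply: (le_trans (ler_wpM2l (ltW e1) h1)).
  by rewrite mulrA divfK// gt_eqF.
have a2 : cabs (g (z + h) - g z - h * l) * cabs l' <= e / 2 * cabs h.
  apply: (@le_trans _ _ (e / 2 / K' * cabs h * K')).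
    by apply: ler_pM; rewrite ?cabs_ge0// lerDl.
  by rewrite mulrAC divfK// gt_eqF.
apply: (le_trans (lerD (le_trans h4 a1) a2)).
by rewrite -mulrDl -splitr.
Qed.

Lemma cderiv_inv z : z != 0 -> cderiv (fun w => w^-1) z (- (z ^+ 2)^-1).
Proof.
move=> z0 e e0; have az : 0 < cabs z by rewrite cabs_gt0.
exists (Num.min (cabs z / 2) (e * cabs z ^+ 3 / 2)).
  by rewrite lt_min !divr_gt0// mulr_gt0// exprn_gt0.
move=> h; rewrite lt_min => /andP[h1 h2].
have zh : cabs z / 2 <= cabs (z + h).
  have : cabs z <= cabs (z + h) + cabs h by rewrite -{1}(addrK h z); exact: cabsB.
  by move: h1; lra.
have zh0 : z + h != 0 by rewrite -cabs_gt0; apply: lt_le_trans zh; rewrite divr_gt0.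
have -> : (z + h)^-1 - z^-1 - h * - (z ^+ 2)^-1 = h ^+ 2 / (z ^+ 2 * (z + h)).
  by field; rewrite z0 zh0.
rewrite cabsM cabsV cabsM !cabsX ler_pdivrMr; last by rewrite mulr_gt0 ?exprn_gt0// cabs_gt0.
rewrite expr2 mulrAC ler_wpM2r ?cabs_ge0// (le_trans (ltW h2))//.
have -> : e * cabs z ^+ 3 / 2 = e * (cabs z ^+ 2 * (cabs z / 2)) by field.
by rewrite ler_wpM2l ?(ltW e0)// ler_wpM2l ?exprn_ge0 ?cabs_ge0.
Qed.

Lemma cderivX f z l n : cderiv f z l ->
  exists k, cderiv (fun w => f w ^+ n) z k.
Proof.
move=> fl; elim: n => [|n [k ih]]; first by exists 0; exact: cderiv_cst.
exists (f z * k + f z ^+ n * l); have := cderivM fl ih.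
by under [in X in _ -> X]eq_fun do rewrite exprS.
Qed.

Lemma cderiv_near f g z l (d : R) : 0 < d ->
  (forall w, cabs (w - z) < d -> f w = g w) -> cderiv f z l -> cderiv g z l.
Proof.
move=> d0 fg fl e e0; have [d' d'0 dP] := fl _ e0.
exists (Num.min d d'); first by rewrite lt_min d0.
move=> h; rewrite lt_min => /andP[h1 h2].
rewrite -(fg (z + h)); last by rewrite (addrC z) addrK.
by rewrite -(fg z) ?subrr ?cabs0//; exact: dP.
Qed.

Lemma ccont_rcont f z w x : ccont f (z + rc x * w) -> rcont (fun t => f (z + rc t * w)) x.
Proof.
move=> cf e e0; have [d d0 dP] := cf e e0.
have w0 : 0 < cabs w + 1 by rewrite ltr_wpDl ?cabs_ge0.
exists (d / (cabs w + 1)); first by rewrite divr_gt0.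
move=> h; rewrite ltr_pdivlMr// => hd; rewrite rcD mulrDl addrA; apply: dP.
by rewrite cabsM cabs_rc; apply: le_lt_trans hd; rewrite ler_wpM2l// lerDl.
Qed.

Lemma rderiv_path f z w x l : cderiv f (z + rc x * w) l ->
  rderiv (fun t => f (z + rc t * w)) x (l * w).
Proof.
move=> fl e e0.
have w0 : 0 < cabs w + 1 by rewrite ltr_wpDl ?cabs_ge0.
have e1 : 0 < e / (cabs w + 1) by rewrite divr_gt0.
have [d d0 dP] := fl _ e1.
exists (d / (cabs w + 1)); first by rewrite divr_gt0.
move=> h; rewrite ltr_pdivlMr// => hd; rewrite rcD mulrDl addrA.
have /dP : cabs (rc h * w) < d.
  by rewrite cabsM cabs_rc; apply: le_lt_trans hd; rewrite ler_wpM2l// lerDl.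
rewrite -mulrA (mulrC w) => /le_trans; apply.
rewrite cabsM cabs_rc mulrCA [leRHS]mulrC ler_wpM2l// -mulrA ler_piMr ?(ltW e0)//.
by rewrite mulrC ler_pdivrMr// mul1r lerDl.
Qed.
End DerivativeRules.

(** * Integrals of complex-valued functions on an interval *)

Section PathIntegral.
Variable R : realType.
Notation C := (Cplx R).
Implicit Types (u v U : R -> C) (a b : R) (f g : C -> C).

Lemma rderivD u v x l l' : rderiv u x l -> rderiv v x l' ->
  rderiv (fun t => u t + v t) x (l + l').
Proof.
move=> ul vl e e0; have e2 : 0 < e / 2 by rewrite divr_gt0.
have [d1 d10 dP1] := ul _ e2; have [d2 d20 dP2] := vl _ e2.
exists (Num.min d1 d2); first by rewrite lt_min d10.
move=> h; rewrite lt_min => /andP[/dP1 h1 /dP2 h2].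
have -> : u (x + h) + v (x + h) - (u x + v x) - rc h * (l + l') =
  (u (x + h) - u x - rc h * l) + (v (x + h) - v x - rc h * l') by ring.
by apply: (le_trans (cabsD _ _)); apply: (le_trans (lerD h1 h2)); rewrite -mulrDl -splitr.
Qed.

Lemma rderivZ c u x l : rderiv u x l -> rderiv (fun t => c * u t) x (c * l).
Proof.
move=> ul e e0; have c0 : 0 < cabs c + 1 by rewrite ltr_wpDl ?cabs_ge0.
have e1 : 0 < e / (cabs c + 1) by rewrite divr_gt0.
have [d d0 dP] := ul _ e1; exists d => // h /dP hP.
have -> : c * u (x + h) - c * u x - rc h * (c * l) = c * (u (x + h) - u x - rc h * l) by ring.
rewrite cabsM; apply: (@le_trans _ _ ((cabs c + 1) * (e / (cabs c + 1) * `|h|))).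
  by apply: ler_pM; rewrite ?cabs_ge0// lerDl.
by rewrite mulrA mulrCA divff ?gt_eqF// mulr1.
Qed.

Lemma rderivB u v x l l' : rderiv u x l -> rderiv v x l' ->
  rderiv (fun t => u t - v t) x (l - l').
Proof.
move=> ul /(rderivZ (-1)) vl; have := rderivD ul vl; rewrite mulN1r.
by under [in X in X -> _]eq_fun do rewrite mulN1r.
Qed.

Lemma rcontD u v x : rcont u x -> rcont v x -> rcont (fun t => u t + v t) x.
Proof.
move=> ul vl e e0; have e2 : 0 < e / 2 by rewrite divr_gt0.
have [d1 d10 dP1] := ul _ e2; have [d2 d20 dP2] := vl _ e2.
exists (Num.min d1 d2); first by rewrite lt_min d10.
move=> h; rewrite lt_min => /andP[/dP1 h1 /dP2 h2].
have -> : u (x + h) + v (x + h) - (u x + v x) = (u (x + h) - u x) + (v (x + h) - v x) by ring.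
by apply: (le_trans (cabsD _ _)); apply: (le_trans (lerD h1 h2)); rewrite -splitr.
Qed.

Lemma rcontZ c u x : rcont u x -> rcont (fun t => c * u t) x.
Proof.
move=> ul e e0; have c0 : 0 < cabs c + 1 by rewrite ltr_wpDl ?cabs_ge0.
have e1 : 0 < e / (cabs c + 1) by rewrite divr_gt0.
have [d d0 dP] := ul _ e1; exists d => // h /dP hP.
rewrite -mulrBr cabsM; apply: (@le_trans _ _ ((cabs c + 1) * (e / (cabs c + 1)))).
  by apply: ler_pM; rewrite ?cabs_ge0// lerDl.
by rewrite mulrCA divff ?gt_eqF// mulr1.
Qed.

Lemma rcontB u v x : rcont u x -> rcont v x -> rcont (fun t => u t - v t) x.
Proof.
move=> cu /(rcontZ (-1)) cv; have := rcontD cu cv.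
by under [in X in X -> _]eq_fun do rewrite mulN1r.
Qed.

(** The integral as the increment of a primitive on [[a, b]], with default 0 when there is none.
    [IntE] makes it independent of the primitive, and linearity is then inherited from [rderiv]. *)
Definition Int u a b : C := xget 0
  [set c | exists U : R -> C, (forall x, a <= x <= b -> rderiv U x (u x)) /\ c = U b - U a].

(** Two primitives differ by a function of zero derivative, which is constant by the mean value
    inequality. *)
Lemma IntE u U a b : a <= b -> (forall x, a <= x <= b -> rderiv U x (u x)) ->
  Int u a b = U b - U a.
Proof.
move=> ab dU; rewrite /Int; case: xgetP => [c _ [V [dV ->]]|/(_ (U b - U a))]; last first.
  by case; exists U.
have d0 x : a <= x <= b -> rderiv (fun t => V t - U t) x ((fun _ => 0) x).
  by move=> xab; have := rderivB (dV x xab) (dU x xab); rewrite subrr.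
have /(mean_value_ineq ab d0) : forall x, a <= x <= b -> cabs (0 : C) <= 0.
  by move=> *; rewrite cabs0.
rewrite mul0r.
rewrite le_eqVlt ltNge cabs_ge0 orbF cabs_eq0 subr_eq0 => /eqP E.
by rewrite -[LHS](subrKA (U b)) -[V b](subrK (U b)) E; ring.
Qed.

Lemma IntB u v a b : a <= b -> (forall x, rcont u x) -> (forall x, rcont v x) ->
  Int (fun t => u t - v t) a b = Int u a b - Int v a b.
Proof.
move=> ab /(antiderivative a b)[U dU] /(antiderivative a b)[V dV].
rewrite (IntE ab dU) (IntE ab dV) (@IntE _ (fun t => U t - V t))//; first by ring.
by move=> x xab; apply: rderivB; [exact: dU|exact: dV].
Qed.

Lemma IntD u v a b : a <= b -> (forall x, rcont u x) -> (forall x, rcont v x) ->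
  Int (fun t => u t + v t) a b = Int u a b + Int v a b.
Proof.
move=> ab /(antiderivative a b)[U dU] /(antiderivative a b)[V dV].
rewrite (IntE ab dU) (IntE ab dV) (@IntE _ (fun t => U t + V t))//; first by ring.
by move=> x xab; apply: rderivD; [exact: dU|exact: dV].
Qed.

Lemma IntZ c u a b : a <= b -> (forall x, rcont u x) ->
  Int (fun t => c * u t) a b = c * Int u a b.
Proof.
move=> ab /(antiderivative a b)[U dU].
rewrite (IntE ab dU) (@IntE _ (fun t => c * U t))//; first by ring.
by move=> x xab; apply: rderivZ; exact: dU.
Qed.

Lemma rcont_cst (c : C) x : rcont (fun _ => c) x.
Proof. by move=> e e0; exists 1 => // h _; rewrite subrr cabs0 ltW. Qed.

Lemma rcont_sum n (u : nat -> R -> C) : (forall k x, rcont (u k) x) ->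
  forall x, rcont (fun t => \sum_(k < n) u k t) x.
Proof.
move=> cu; elim: n => [|n ih] x.
  by under eq_fun do rewrite big_ord0; exact: rcont_cst.
by under eq_fun do rewrite big_ord_recr /=; exact: (rcontD (ih x) (cu n x)).
Qed.

Lemma Int0 a b : a <= b -> Int (fun _ => 0) a b = 0.
Proof.
move=> ab; rewrite (@IntE _ (fun _ => 0)) ?subrr// => x _ e e0.
by exists 1 => // h _; rewrite mulr0 !subrr cabs0 mulr_ge0// ltW.
Qed.

Lemma Int_sum n (u : nat -> R -> C) a b : a <= b -> (forall k x, rcont (u k) x) ->
  Int (fun t => \sum_(k < n) u k t) a b = \sum_(k < n) Int (u k) a b.
Proof.
move=> ab cu; elim: n => [|n ih].
  by under eq_fun do rewrite big_ord0; rewrite big_ord0 Int0.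
under eq_fun do rewrite big_ord_recr /=.
by rewrite big_ord_recr /= IntD//; [rewrite ih|exact: rcont_sum].
Qed.

Lemma Int_split u a b c : a <= b -> b <= c -> (forall x, rcont u x) ->
  Int u a c = Int u a b + Int u b c.
Proof.
move=> ab bc /(antiderivative a c)[U dU].
rewrite (IntE (le_trans ab bc) dU) (IntE (U := U) ab) ?(IntE (U := U) bc); first by ring.
  by move=> x /andP[bx xc]; apply: dU; rewrite (le_trans ab).
by move=> x /andP[ax xb]; apply: dU; rewrite ax (le_trans xb).
Qed.

Lemma Int_le u a b (M : R) : a <= b -> (forall x, rcont u x) ->
  (forall x, a <= x <= b -> cabs (u x) <= M) -> cabs (Int u a b) <= M * (b - a).
Proof.
move=> ab /(antiderivative a b)[U dU] uM.
by rewrite (IntE ab dU); exact: mean_value_ineq dU uM.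
Qed.

(** The factor [w] is the [dz] of the segment: by the chain rule, [F] along it has derivative [f]
    times [w]. *)
Lemma Int_path f F z w a b : a <= b ->
  (forall x, a <= x <= b -> cderiv F (z + rc x * w) (f (z + rc x * w))) ->
  (forall x, rcont (fun t => f (z + rc t * w)) x) ->
  Int (fun t => f (z + rc t * w)) a b * w = F (z + rc b * w) - F (z + rc a * w).
Proof.
move=> ab dF cf; rewrite mulrC -IntZ//.
rewrite (@IntE _ (fun t => F (z + rc t * w)))// => x /dF /rderiv_path.
by rewrite mulrC.
Qed.

End PathIntegral.
Opaque Int.

(** * Goursat's theorem on rectangles *)

Section Goursat.
Variable R : realType.
Notation C := (Cplx R).
Notation ci := (ci R).
Implicit Types (f g : C -> C) (a b h p q : R).

(** Bisection: if [P] failed on the unit square, it would fail on one of its quarters, and so on;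
    the nested squares shrink to a point, around which [P] holds. *)
Lemma nested_squares (P : R -> R -> R -> Prop) :
  (forall a b h, P a b (h / 2) -> P (a + h / 2) b (h / 2) ->
     P a (b + h / 2) (h / 2) -> P (a + h / 2) (b + h / 2) (h / 2) -> P a b h) ->
  (forall p q, 0 <= p <= 1 -> 0 <= q <= 1 -> exists2 d : R, 0 < d &
     forall a b h, 0 < h < d -> a <= p <= a + h -> b <= q <= b + h -> P a b h) ->
  P 0 0 1.
Proof.
move=> merge loc; apply: contrapT => nP.
pose h n : R := 2^-1 ^+ n.
have hS n : h n.+1 = h n / 2 by rewrite /h exprSr.
have h0 n : 0 < h n by rewrite exprn_gt0// invr_gt0.
(* Failure of [P] is a premise inside the existential, so that [choice] gives a total function; the
   state carries the level [n]. *)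
have step (s : nat * (R * R)) : exists t : R * R, ~ P s.2.1 s.2.2 (h s.1) ->
    [/\ ~ P t.1 t.2 (h s.1.+1), s.2.1 <= t.1, t.1 + h s.1.+1 <= s.2.1 + h s.1,
        s.2.2 <= t.2 & t.2 + h s.1.+1 <= s.2.2 + h s.1].
  case: s => n [a b] /=; have hn := h0 n.+1; have hh : h n = h n.+1 + h n.+1.
    by rewrite hS -splitr.
  have [Pab|nPab] := pselect (P a b (h n)); first by exists (a, b).
  have [P1|nP1] := pselect (P a b (h n.+1)); last first.
    by exists (a, b) => _; split=> //=; lra.
  have [P2|nP2] := pselect (P (a + h n.+1) b (h n.+1)); last first.
    by exists (a + h n.+1, b) => _; split=> //=; lra.
  have [P3|nP3] := pselect (P a (b + h n.+1) (h n.+1)); last first.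
    by exists (a, b + h n.+1) => _; split=> //=; lra.
  have [P4|nP4] := pselect (P (a + h n.+1) (b + h n.+1) (h n.+1)); last first.
    by exists (a + h n.+1, b + h n.+1) => _; split=> //=; lra.
  by exfalso; apply: nPab; apply: merge; rewrite -hS.
have [F FP] := choice step.
pose s := fix s n := if n is m.+1 then F (m, s m) else (0, 0) : R * R.
have sP n : ~ P (s n).1 (s n).2 (h n).
  elim: n => [|n ih]; first by rewrite /h expr0.
  by have [] := FP (n, s n) ih.
have sS n : [/\ (s n).1 <= (s n.+1).1, (s n.+1).1 + h n.+1 <= (s n).1 + h n,
        (s n).2 <= (s n.+1).2 & (s n.+1).2 + h n.+1 <= (s n).2 + h n].
  by have [] := FP (n, s n) (sP n).
have lim (u : nat -> R) : u 0%N = 0 -> (forall n, u n <= u n.+1) ->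
    (forall n, u n.+1 + h n.+1 <= u n + h n) -> exists p, forall n, u n <= p <= u n + h n.
  move=> u0 u1 u2.
  have mono i j : (i <= j)%N -> u i <= u j /\ u j + h j <= u i + h i.
    elim: j => [|j ih]; first by rewrite leqn0 => /eqP ->.
    rewrite leq_eqVlt => /predU1P[->//|]; rewrite ltnS => /ih[k1 k2].
    by split; [exact: le_trans k1 (u1 j)|exact: le_trans (u2 j) k2].
  have ubn n : ubound (range u) (u n + h n).
    move=> _ [k _ <-]; have [kn|nk] := leqP k n.
      by have [k1 _] := mono _ _ kn; apply: (le_trans k1); rewrite lerDl ltW.
    have [_ k2] := mono _ _ (ltnW nk); apply: le_trans k2; rewrite lerDl ltW//.
  exists (sup (range u)) => n; apply/andP; split.
    by apply: ub_le_sup; [exists (u 0%N + h 0%N); exact: ubn|exists n].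
  by apply: ge_sup; [exists (u 0%N); exists 0%N|exact: ubn].
have [p pP] : exists p, forall n, (s n).1 <= p <= (s n).1 + h n.
  by apply: lim => // n; have [] := sS n.
have [q qP] : exists q, forall n, (s n).2 <= q <= (s n).2 + h n.
  by apply: lim => // n; have [] := sS n.
have [||d d0 dP] := loc p q.
- by have := pP 0%N; rewrite /h expr0 /= add0r.
- by have := qP 0%N; rewrite /h expr0 /= add0r.
have [n hn] : exists n, h n < d.
  have := @cvg_expr R 2^-1; rewrite ger0_norm ?invr_ge0// invf_lt1// ltr1n => /(_ isT).
  move=> /cvgrPdist_lt/(_ d d0)[n _ /(_ n)]; rewrite /= sub0r normrN leqnn => /(_ isT) hn.
  by exists n; apply: le_lt_trans hn; rewrite ler_norm.
by apply: (sP n); apply: dP; rewrite ?h0//.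
Qed.

(** Contour integral over the boundary, counterclockwise: bottom minus top, plus [i] times right
    minus left. The factor [* 1] gives horizontal sides the shape [z + rc t * w] of [Int_path]. *)
Definition rect_int g (x0 x1 y0 y1 : R) : C :=
  Int (fun x => g (ci * rc y0 + rc x * 1)) x0 x1 - Int (fun x => g (ci * rc y1 + rc x * 1)) x0 x1
  + ci * (Int (fun y => g (rc x1 + rc y * ci)) y0 y1 - Int (fun y => g (rc x0 + rc y * ci)) y0 y1).

Lemma rect_int_splitx g x0 x1 x2 y0 y1 : (forall z, ccont g z) -> x0 <= x1 -> x1 <= x2 ->
  rect_int g x0 x2 y0 y1 = rect_int g x0 x1 y0 y1 + rect_int g x1 x2 y0 y1.
Proof.
move=> cg h1 h2; have cg' z w x : rcont (fun t => g (z + rc t * w)) x by exact: ccont_rcont.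
by rewrite /rect_int !(Int_split h1 h2)//; ring.
Qed.

Lemma rect_int_splity g x0 x1 y0 y1 y2 : (forall z, ccont g z) -> y0 <= y1 -> y1 <= y2 ->
  rect_int g x0 x1 y0 y2 = rect_int g x0 x1 y0 y1 + rect_int g x0 x1 y1 y2.
Proof.
move=> cg h1 h2; have cg' z w x : rcont (fun t => g (z + rc t * w)) x by exact: ccont_rcont.
by rewrite /rect_int !(Int_split h1 h2)//; ring.
Qed.

Lemma rect_int_primitive g G x0 x1 y0 y1 : x0 <= x1 -> y0 <= y1 ->
  (forall z, ccont g z) -> (forall z, cderiv G z (g z)) -> rect_int g x0 x1 y0 y1 = 0.
Proof.
move=> h1 h2 cg dG; have cg' z w x : rcont (fun t => g (z + rc t * w)) x by exact: ccont_rcont.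
rewrite /rect_int mulrBr ![ci * Int _ _ _]mulrC !(Int_path (F := G))//.
have := @Int_path _ g G (ci * rc y0) 1 x0 x1 h1 (fun x _ => dG _) (cg' _ _).
have := @Int_path _ g G (ci * rc y1) 1 x0 x1 h1 (fun x _ => dG _) (cg' _ _).
rewrite !mulr1 => -> ->.
by rewrite ![ci * _]mulrC ![rc x0 + _]addrC ![rc x1 + _]addrC; ring.
Qed.

Lemma rect_intB f g x0 x1 y0 y1 : x0 <= x1 -> y0 <= y1 ->
  (forall z, ccont f z) -> (forall z, ccont g z) ->
  rect_int (fun z => f z - g z) x0 x1 y0 y1 = rect_int f x0 x1 y0 y1 - rect_int g x0 x1 y0 y1.
Proof.
move=> h1 h2 cf cg.
have cf' z w x : rcont (fun t => f (z + rc t * w)) x by exact: ccont_rcont.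
have cg' z w x : rcont (fun t => g (z + rc t * w)) x by exact: ccont_rcont.
by rewrite /rect_int !IntB//; ring.
Qed.

Lemma ccontB f g z : ccont f z -> ccont g z -> ccont (fun w => f w - g w) z.
Proof.
move=> ul vl e e0; have e2 : 0 < e / 2 by rewrite divr_gt0.
have [d1 d10 dP1] := ul _ e2; have [d2 d20 dP2] := vl _ e2.
exists (Num.min d1 d2); first by rewrite lt_min d10.
move=> h; rewrite lt_min => /andP[/dP1 h1 /dP2 h2].
have -> : f (z + h) - g (z + h) - (f z - g z) = (f (z + h) - f z) - (g (z + h) - g z) by ring.
by apply: (le_trans (cabsB _ _)); apply: (le_trans (lerD h1 h2)); rewrite -splitr.
Qed.

(* The affine part has a primitive, so only the remainder contributes. *)
Lemma rect_int_affine g (A B : C) (e x0 x1 y0 y1 : R) : x0 <= x1 -> y0 <= y1 ->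
  (forall z, ccont g z) ->
  (forall x y, x0 <= x <= x1 -> y0 <= y <= y1 ->
     cabs (g (rc x + ci * rc y) - (A + B * (rc x + ci * rc y))) <= e) ->
  cabs (rect_int g x0 x1 y0 y1) <= 2 * e * ((x1 - x0) + (y1 - y0)).
Proof.
move=> h1 h2 cg ge.
pose l (z : C) := A + B * z; pose L (z : C) := A * z + B * (z * z) / 2.
have dl z : cderiv l z B.
  by have := cderivD (cderiv_cst A z) (cderivZ B (cderiv_id z)); rewrite add0r mulr1.
have dL z : cderiv L z (l z).
  have := cderivD (cderivZ A (cderiv_id z))
     (cderivZ (B / 2) (cderivM (cderiv_id z) (cderiv_id z))).
  rewrite !mulr1; have -> : A + B / 2 * (z + z) = l z by rewrite /l; field.
  by congr cderiv; apply/funext => w; rewrite /L; field.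
have cl z : ccont l z by exact: cderiv_ccont (dl z).
have -> : rect_int g x0 x1 y0 y1 = rect_int (fun z => g z - l z) x0 x1 y0 y1.
  by rewrite rect_intB// (rect_int_primitive h1 h2 cl dL) subr0.
have cgl z : ccont (fun z => g z - l z) z by exact: ccontB.
have cgl' z w x : rcont (fun t => g (z + rc t * w) - l (z + rc t * w)) x.
  exact: (ccont_rcont (f := fun z => g z - l z)).
have y00 : y0 <= y0 <= y1 by rewrite lexx.
have y11 : y0 <= y1 <= y1 by rewrite lexx h2.
have x00 : x0 <= x0 <= x1 by rewrite lexx.
have x11 : x0 <= x1 <= x1 by rewrite lexx h1.
have i1 y : y0 <= y <= y1 -> cabs (Int (fun x => g (ci * rc y + rc x * 1) - l (ci * rc y + rc x * 1)) x0 x1)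
    <= e * (x1 - x0).
  by move=> yy; apply: Int_le => // x xx; rewrite mulr1 (addrC (ci * _)); exact: ge.
have i2 x : x0 <= x <= x1 -> cabs (Int (fun y => g (rc x + rc y * ci) - l (rc x + rc y * ci)) y0 y1)
    <= e * (y1 - y0).
  by move=> xx; apply: Int_le => // y yy; rewrite (mulrC (rc y)); exact: ge.
rewrite /rect_int; apply: (le_trans (cabsD _ _)).
have -> : 2 * e * (x1 - x0 + (y1 - y0)) = (e * (x1 - x0) + e * (x1 - x0)) +
  (e * (y1 - y0) + e * (y1 - y0)) by ring.
apply: lerD.
  by apply: (le_trans (cabsB _ _)); apply: lerD; exact: i1.
rewrite cabsM cabs_ci mul1r.
by apply: (le_trans (cabsB _ _)); apply: lerD; exact: i2.
Qed.

(** On a small square around a point of differentiability, [g] is affine up to [e] times the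
    diameter, and the perimeter is of the order of [h]. This gives a bound [e * K * h ^+ 2],
    proportional to the area, hence preserved when four quarters are merged. [Q a b h] is the
    integral over the image of the square under the affine map from the unit square onto the
    rectangle. *)
Lemma goursat g x0 x1 y0 y1 : x0 <= x1 -> y0 <= y1 -> (forall z, ccont g z) ->
  (forall x y, x0 <= x <= x1 -> y0 <= y <= y1 -> exists l, cderiv g (rc x + ci * rc y) l) ->
  rect_int g x0 x1 y0 y1 = 0.
Proof.
move=> h1 h2 cg dg; set W := x1 - x0; set H := y1 - y0.
have W0 : 0 <= W by rewrite subr_ge0.
have H0 : 0 <= H by rewrite subr_ge0.
pose K := 2 * (W + H) * (W + H).
have K0 : 0 <= K by rewrite /K !mulr_ge0// addr_ge0.
pose Q a b h := rect_int g (x0 + a * W) (x0 + (a + h) * W) (y0 + b * H) (y0 + (b + h) * H).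
have E e : 0 < e -> cabs (Q 0 0 1) <= e * K * 1 ^+ 2.
  move=> e0; apply: (@nested_squares (fun a b h => 0 < h -> cabs (Q a b h) <= e * K * h ^+ 2)) => //.
    move=> a b h P1 P2 P3 P4 hp; have hh : 0 < h / 2 by rewrite divr_gt0.
    move: (P1 hh) (P2 hh) (P3 hh) (P4 hh) => {}P1 {}P2 {}P3 {}P4.
    have -> : Q a b h = Q a b (h / 2) + Q (a + h / 2) b (h / 2) +
        (Q a (b + h / 2) (h / 2) + Q (a + h / 2) (b + h / 2) (h / 2)).
      have hS c : c + h / 2 + h / 2 = c + h by rewrite -addrA -splitr.
      rewrite /Q !hS.
      have le1 c w V : 0 <= V -> w + c * V <= w + (c + h / 2) * V.
        by move=> V0; rewrite lerD2l ler_wpM2r// lerDl ltW.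
      have le2 c w V : 0 <= V -> w + (c + h / 2) * V <= w + (c + h) * V.
        by move=> V0; rewrite lerD2l ler_wpM2r// lerD2l; move: hp; lra.
      rewrite (@rect_int_splity _ _ _ _ (y0 + (b + h / 2) * H)) ?le1 ?le2//.
      by congr (_ + _); apply: rect_int_splitx => //; rewrite ?le1 ?le2.
    have -> : e * K * h ^+ 2 = e * K * (h / 2) ^+ 2 + e * K * (h / 2) ^+ 2 +
       (e * K * (h / 2) ^+ 2 + e * K * (h / 2) ^+ 2) by field.
    by apply: (le_trans (cabsD _ _)); apply: lerD; apply: (le_trans (cabsD _ _)); exact: lerD.
  move=> p q /andP[p0 p1] /andP[q0 q1].
  have px : x0 <= x0 + p * W <= x1.
    rewrite lerDl mulr_ge0//= -lerBrDl -/W; rewrite ler_piMl//.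
  have qy : y0 <= y0 + q * H <= y1.
    rewrite lerDl mulr_ge0//= -lerBrDl -/H; rewrite ler_piMl//.
  have [l dl] := dg _ _ px qy; have [d d0 dP] := dl _ e0.
  set z0 := (rc _ + _ : C) in dl dP.
  have WH1 : 0 < W + H + 1 by move: W0 H0; lra.
  exists (d / (W + H + 1)); first by rewrite divr_gt0.
  move=> a b h /andP[_ hd] /andP[ap pa] /andP[bq qb] hp.
  have := @rect_int_affine g (g z0 - l * z0) l (e * (h * (W + H))) (x0 + a * W)
    (x0 + (a + h) * W) (y0 + b * H) (y0 + (b + h) * H).
  have eW c w V : w + (c + h) * V - (w + c * V) = h * V by ring.
  have -> : e * K * h ^+ 2 = 2 * (e * (h * (W + H))) * (h * W + h * H) by rewrite /K; ring.
  rewrite !eW; apply => //.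
  - by rewrite lerD2l ler_wpM2r// lerDl ltW.
  - by rewrite lerD2l ler_wpM2r// lerDl ltW.
  move=> x y /andP[xa xb] /andP[ya yb].
  set z := (rc x + _ : C).
  have zd : cabs (z - z0) <= h * (W + H).
    have -> : z - z0 = rc (x - (x0 + p * W)) + ci * rc (y - (y0 + q * H)).
      by rewrite /z /z0 !rcB; ring.
    apply: (le_trans (cabsD _ _)); rewrite cabsM cabs_ci mul1r !cabs_rc [h * (W + H)]mulrDr.
    apply: lerD; rewrite ler_norml; apply/andP; split.
    + have : p * W <= (a + h) * W by rewrite ler_wpM2r.
      by move: xa; rewrite mulrDl; lra.
    + have : a * W <= p * W by rewrite ler_wpM2r.
      by move: xb; rewrite mulrDl; lra.
    + have : q * H <= (b + h) * H by rewrite ler_wpM2r.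
      by move: ya; rewrite mulrDl; lra.
    + have : b * H <= q * H by rewrite ler_wpM2r.
      by move: yb; rewrite mulrDl; lra.
  have := dP (z - z0); rewrite subrKC.
  have -> : g z - g z0 - (z - z0) * l = g z - (g z0 - l * z0 + l * z) by ring.
  move=> /(_ _)/le_trans; apply.
    apply: (le_lt_trans zd); move: hd; rewrite ltr_pdivlMr//; apply: le_lt_trans.
    by rewrite ler_wpM2l ?ltW// ltrDl.
  by rewrite ler_wpM2l// ltW.
have Q0 : Q 0 0 1 = rect_int g x0 x1 y0 y1.
  by rewrite /Q !mul0r !addr0 add0r !mul1r /W /H !subrKC.
apply/eqP; rewrite -cabs_eq0 -Q0 eq_le cabs_ge0 andbT.
apply/ler_addgt0Pr => e e0; rewrite add0r.
have K1 : 0 < K + 1 by rewrite ltr_wpDl.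
have e1 : 0 < e / (K + 1) by rewrite divr_gt0.
apply: (le_trans (E _ e1)); rewrite expr1n mulr1 mulrAC ler_pdivrMr//.
by rewrite ler_wpM2l ?lerDl// ltW.
Qed.

(* When [g w = f (exp w)], this is the integral of [f] over the circle of radius
   [exp s] with respect to the angle. *)
Definition vint g s := Int (fun t => g (rc s + rc t * ci)) 0 (2 * pi).

(** Goursat on [[s0, s1]] times [[0, 2 pi]]: the horizontal sides cancel by periodicity, and the
    vertical ones are the two integrals. *)
Lemma vint_const g s0 s1 : s0 <= s1 -> (forall z, ccont g z) ->
  (forall x y, s0 <= x <= s1 -> exists l, cderiv g (rc x + ci * rc y) l) ->
  (forall z, g (z + ci * rc (2 * pi)) = g z) -> vint g s0 = vint g s1.
Proof.
move=> s01 cg dg per.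
have pi0 : 0 <= 2 * pi :> R by rewrite mulr_ge0// pi_ge0.
have := @goursat g s0 s1 0 (2 * pi) s01 pi0 cg (fun x y xx _ => dg x y xx).
rewrite /rect_int rc0 mulr0.
have -> : (fun x => g (ci * rc (2 * pi) + rc x * 1)) = (fun x => g (0 + rc x * 1)).
  by apply/funext => x; rewrite addrC per add0r.
rewrite subrr add0r => /eqP; rewrite mulf_eq0 -cabs_eq0 cabs_ci oner_eq0 /= subr_eq0.
by move=> /eqP.
Qed.

End Goursat.

(** * The complex exponential and integrals over circles centred at 0 *)

Section CauchyFormula.
Variable R : realType.
Notation C := (Cplx R).
Notation ci := (ci R).
Implicit Types (f g F G : C -> C) (s r : R) (z w a : C).

Lemma Re_ciM (y : R) : complex.Re (ci * rc y) = 0.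
Proof. by rewrite Re_mul /=; ring. Qed.
Lemma Im_ciM (y : R) : complex.Im (ci * rc y) = y.
Proof. by rewrite Im_mul /=; ring. Qed.

Lemma rderiv_expi0 : rderiv (fun y : R => cexp (ci * rc y)) 0 ci.
Proof.
apply/rderiv_ReIm; split.
  have -> : @complex.Re R \o (fun y : R => cexp (ci * rc y)) = cos.
    by apply/funext => y; rewrite [LHS](cexp_ReIm _).1 Re_ciM Im_ciM expR0 mul1r.
  by have := is_derive_cos (0 : R); rewrite sin0 oppr0.
have -> : @complex.Im R \o (fun y : R => cexp (ci * rc y)) = sin.
  by apply/funext => y; rewrite [LHS](cexp_ReIm _).2 Re_ciM Im_ciM expR0 mul1r.
by have := is_derive_sin (0 : R); rewrite cos0.
Qed.

Lemma rderiv_exp0 : rderiv (fun x : R => rc (expR x)) 0 1.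
Proof.
apply/rderiv_ReIm; split => /=.
  have -> : @complex.Re R \o (fun x : R => rc (expR x)) = expR by [].
  by have := is_derive_expR (0 : R); rewrite expR0.
have -> : @complex.Im R \o (fun x : R => rc (expR x)) = cst 0 by [].
exact: is_derive_cst.
Qed.

(** The addition formula reduces everything to the point 0, where the real derivatives of [expR],
    [cos] and [sin] are combined. *)
Lemma cderiv_cexp z : cderiv (@cexp R) z (cexp z).
Proof.
suff d0 : cderiv (@cexp R) 0 1.
  have := cderivZ (cexp z) d0; rewrite mulr1 => H e e0; have [d d'0 dP] := H e e0.
  exists d => // h /dP; rewrite add0r.
  by rewrite cexpD cexp0 !mulr1.
move=> e e0; have e3 : 0 < e / 3 by rewrite divr_gt0.
have e1 : 0 < Num.min (e / 3) 1 by rewrite lt_min e3 ltr01.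
have [d1 d10 dP1] := rderiv_exp0 e1.
have [d2 d20 dP2] := rderiv_expi0 e1.
exists (Num.min (Num.min d1 d2) (e / 6)); first by rewrite !lt_min d10 d20 divr_gt0.
move=> h; rewrite !lt_min => /andP[/andP[h1 h2] h3]; rewrite add0r cexp0.
set x := complex.Re h; set y := complex.Im h.
have hx : `|x| <= cabs h by exact: Re_le_cabs.
have hy : `|y| <= cabs h by exact: Im_le_cabs.
have := dP1 x (le_lt_trans hx h1); have := dP2 y (le_lt_trans hy h2).
rewrite !add0r expR0 rc0 mulr0 cexp0 mulr1 => Ey Ex.
have hE : cexp h = rc (expR x) * cexp (ci * rc y).
  rewrite {1}(C_decomp h) cexpD; congr (_ * _).
  have [r1 i1] := cexp_ReIm (rc x : C).
  by apply: C_eqP; rewrite ?r1 ?i1 /= ?cos0 ?sin0 ?mulr1 ?mulr0.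
have cy : cabs (cexp (ci * rc y)) = 1.
  by rewrite cabs_cexp Re_ciM expR0.
have cy1 : cabs (cexp (ci * rc y) - 1) <= 2 * cabs h.
  rewrite -(subrK (rc y * ci) (_ - 1)); apply: (le_trans (cabsD _ _)).
  rewrite cabsM cabs_ci cabs_rc mulr1 mulr_natl mulr2n; apply: lerD => //.
  apply: (le_trans Ey); apply: le_trans hy.
  by rewrite ler_piMl// ge_min lexx orbT.
have -> : cexp h - 1 - h * 1 = (rc (expR x) - 1 - rc x) * cexp (ci * rc y) +
   rc x * (cexp (ci * rc y) - 1) + (cexp (ci * rc y) - 1 - rc y * ci).
  by rewrite hE {1}(C_decomp h) -/x -/y; ring.
rewrite rc1 in Ex.
have -> : e * cabs h = e / 3 * cabs h + e / 3 * cabs h + e / 3 * cabs h by field.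
apply: (le_trans (cabsD _ _)); apply: lerD; last first.
  apply: (le_trans Ey); apply: ler_pM => //; first exact: ltW.
  by rewrite ge_min lexx.
apply: (le_trans (cabsD _ _)); apply: lerD; rewrite cabsM.
  rewrite cy mulr1; apply: (le_trans Ex); apply: ler_pM => //; first exact: ltW.
  by rewrite ge_min lexx.
rewrite cabs_rc mulrC; apply: ler_pM; rewrite ?cabs_ge0//.
by apply: (le_trans cy1); move: h3; lra.
Qed.

Lemma ccont_comp F G z : ccont G z -> ccont F (G z) -> ccont (fun w => F (G w)) z.
Proof.
move=> cG cF e e0; have [d d0 dP] := cF e e0.
have d20 : 0 < d / 2 by rewrite divr_gt0.
have [d1 d10 d1P] := cG _ d20; exists d1 => // h /d1P h1.
rewrite -{1}(subrKC (G z) (G (z + h))); apply: dP; apply: (le_lt_trans h1).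
by move: d0; lra.
Qed.

Lemma ccont_cexp z : ccont (@cexp R) z.
Proof. exact: cderiv_ccont (cderiv_cexp z). Qed.

(** The measure is the angle, that is [dz / (i z)]; hence the Cauchy kernel below carries an extra
    factor [z] and reads [z / (z - a)]. *)
Definition cint F s := vint (fun w => F (cexp w)) s.
Definition ccirc F s := forall z, cabs z = expR s -> ccont F z.

Lemma cabs_circ s t : cabs (cexp (rc s + rc t * ci)) = expR s.
Proof.
by rewrite cabs_cexp Re_add Re_mul /=; congr expR; ring.
Qed.

Lemma ccirc_rcont F s : ccirc F s -> forall t, rcont (fun t => F (cexp (rc s + rc t * ci))) t.
Proof.
move=> cF t; apply: (@ccont_rcont _ (fun w => F (cexp w))).
by apply: ccont_comp; [exact: ccont_cexp|apply: cF; exact: cabs_circ].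
Qed.

Lemma pi2_ge0 : 0 <= 2 * pi :> R. Proof. by rewrite mulr_ge0// pi_ge0. Qed.
Lemma pi2_gt0 : 0 < 2 * pi :> R. Proof. by rewrite mulr_gt0// pi_gt0. Qed.

Lemma eq_cint F G s : (forall z, cabs z = expR s -> F z = G z) -> cint F s = cint G s.
Proof.
move=> FG; congr Int; apply/funext => t; apply: FG; exact: cabs_circ.
Qed.
Lemma cintB F G s : ccirc F s -> ccirc G s ->
  cint (fun z => F z - G z) s = cint F s - cint G s.
Proof.
by move=> /ccirc_rcont cF /ccirc_rcont cG; rewrite /cint /vint IntB// pi2_ge0.
Qed.
Lemma cintD F G s : ccirc F s -> ccirc G s ->
  cint (fun z => F z + G z) s = cint F s + cint G s.
Proof.
by move=> /ccirc_rcont cF /ccirc_rcont cG; rewrite /cint /vint IntD// pi2_ge0.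
Qed.
Lemma cintZ (c : C) F s : ccirc F s -> cint (fun z => c * F z) s = c * cint F s.
Proof. by move=> /ccirc_rcont cF; rewrite /cint /vint IntZ// pi2_ge0. Qed.
Lemma cint_sum n (F : nat -> C -> C) s : (forall k, ccirc (F k) s) ->
  cint (fun z => \sum_(k < n) F k z) s = \sum_(k < n) cint (F k) s.
Proof.
move=> cF; rewrite /cint /vint.
by apply: (@Int_sum _ n (fun k t => F k (cexp (rc s + rc t * ci)))) => [|k x];
  [exact: pi2_ge0|exact: ccirc_rcont].
Qed.
Lemma cint_le F s (M : R) : ccirc F s -> (forall z, cabs z = expR s -> cabs (F z) <= M) ->
  cabs (cint F s) <= M * (2 * pi).
Proof.
move=> /ccirc_rcont cF FM; rewrite -[2 * pi]subr0; apply: Int_le => //; first exact: pi2_ge0.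
by move=> t _; apply: FM; exact: cabs_circ.
Qed.

Lemma cexp_per z : cexp (z + ci * rc (2 * pi)) = cexp z.
Proof. by rewrite cexpD cexp_2pi mulr1. Qed.

Lemma cint_const F s0 s1 : s0 <= s1 -> (forall z, z != 0 -> ccont F z) ->
  (forall z, expR s0 <= cabs z <= expR s1 -> exists l, cderiv F z l) ->
  cint F s0 = cint F s1.
Proof.
move=> s01 cF dF; apply: vint_const => //.
- by move=> z; apply: ccont_comp; [exact: ccont_cexp|apply: cF; exact: cexp_neq0].
- move=> x y xs; have [] := dF (cexp (rc x + ci * rc y)).
    by rewrite mulrC cabs_circ !ler_expR.
  by move=> l dl; eexists; exact: cderiv_comp (cderiv_cexp _) dl.
- by move=> z; rewrite cexp_per.
Qed.

(** Compactness of [[0, 2 pi]] makes the continuity of [g] uniform along the circle. This is the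
    tool for crossing a circle on which differentiability is unknown. *)
Lemma vint_continuous g s0 : (forall z, ccont g z) -> forall e : R, 0 < e ->
  exists2 d : R, 0 < d & forall s, `|s - s0| < d -> cabs (vint g s - vint g s0) <= e * (2 * pi).
Proof.
move=> cg e e0; have cg' z w x : rcont (fun t => g (z + rc t * w)) x by exact: ccont_rcont.
have cpt : near_covering `[0 : R, 2 * pi].
  by apply/compact_near_coveringP; exact: segment_compact.
have : \forall s \near s0, `[0, 2 * pi] `<=`
    (fun t => cabs (g (rc s + rc t * ci) - g (rc s0 + rc t * ci)) <= e).
  apply: (cpt R (nbhs s0)
    (fun s t => cabs (g (rc s + rc t * ci) - g (rc s0 + rc t * ci)) <= e)) => t _.
  have e2 : 0 < e / 2 by rewrite divr_gt0.
  have [d d0 dP] := cg (rc s0 + rc t * ci) _ e2.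
  have d20 : 0 < d / 2 by rewrite divr_gt0.
  exists (ball t (d / 2), ball s0 (d / 2)); first by split; exact: nbhsx_ballx.
  move=> [t' s'] /= [tt ss]; move: tt ss; rewrite /ball /= => tt ss.
  have E1 := dP (rc (s' - s0) + rc (t' - t) * ci).
  have E2 := dP (rc (t' - t) * ci).
  have {E2} : cabs (g (rc s0 + rc t' * ci) - g (rc s0 + rc t * ci)) <= e / 2.
    have <- : rc s0 + rc t * ci + rc (t' - t) * ci = rc s0 + rc t' * ci by rewrite !rcB; ring.
    by apply: E2; rewrite cabsM cabs_ci mulr1 cabs_rc distrC; move: tt; lra.
  have {E1} : cabs (g (rc s' + rc t' * ci) - g (rc s0 + rc t * ci)) <= e / 2.
    have <- : rc s0 + rc t * ci + (rc (s' - s0) + rc (t' - t) * ci) = rc s' + rc t' * ci.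
      by rewrite !rcB; ring.
    apply: E1; apply: (le_lt_trans (cabsD _ _)).
    by rewrite cabsM cabs_ci mulr1 !cabs_rc distrC (distrC t'); move: tt ss; lra.
  move=> E1 E2; apply: (le_trans (cabs_triangle (g (rc s0 + rc t * ci)) _ _)).
  by rewrite (cabs_subC _ (g (rc s0 + rc t' * ci))); move: E1 E2; lra.
move=> /nbhs_ballP[d /= d0 dP]; exists d => // s sd.
rewrite /vint -IntB ?pi2_ge0// -{2}[2 * pi]subr0.
apply: Int_le => [|x|t tt]; first exact: pi2_ge0.
  by apply: (@rcontB _ (fun t => g (rc s + rc t * ci))).
apply: (dP s) => /=; first by rewrite /ball /= distrC.
by rewrite in_itv.
Qed.
End CauchyFormula.

(** * Cauchy's formula and Taylor expansion with an explicit remainder *)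

Section Taylor.
Variable R : realType.
Notation C := (Cplx R).
Notation ci := (ci R).
Implicit Types (f g F G : C -> C) (s r : R) (z w a : C).

Definition cdiff f z := exists l, cderiv f z l.

Lemma cdiff_cst (c : C) z : cdiff (fun _ => c) z.
Proof. by exists 0; exact: cderiv_cst. Qed.
Lemma cdiff_id z : cdiff (fun w => w) z.
Proof. by exists 1; exact: cderiv_id. Qed.
Lemma cdiffD f g z : cdiff f z -> cdiff g z -> cdiff (fun w => f w + g w) z.
Proof. by move=> [l fl] [k gk]; exists (l + k); exact: cderivD. Qed.
Lemma cdiffB f g z : cdiff f z -> cdiff g z -> cdiff (fun w => f w - g w) z.
Proof. by move=> [l fl] [k gk]; exists (l - k); exact: cderivB. Qed.
Lemma cdiffM f g z : cdiff f z -> cdiff g z -> cdiff (fun w => f w * g w) z.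
Proof. by move=> [l fl] [k gk]; eexists; exact: cderivM fl gk. Qed.
Lemma cdiffX f n z : cdiff f z -> cdiff (fun w => f w ^+ n) z.
Proof. by move=> [l fl]; exact: cderivX fl. Qed.
Lemma cdiff_comp f g z : cdiff g z -> cdiff f (g z) -> cdiff (fun w => f (g w)) z.
Proof. by move=> [l fl] [k gk]; eexists; exact: cderiv_comp fl gk. Qed.
Lemma cdiffV f z : cdiff f z -> f z != 0 -> cdiff (fun w => (f w)^-1) z.
Proof.
move=> fd fz; apply: (cdiff_comp (f := fun w => w^-1)) => //.
by eexists; exact: cderiv_inv.
Qed.
Lemma cdiff_ccont f z : cdiff f z -> ccont f z.
Proof. by move=> [l /cderiv_ccont]. Qed.
Lemma cdiff_ccirc F s : (forall z, cabs z = expR s -> cdiff F z) -> ccirc F s.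
Proof. by move=> dF z /dF/cdiff_ccont. Qed.
Lemma entire_cdiff f : entire f <-> forall z, cdiff f z.
Proof. exact: entireP. Qed.

Lemma entire_at f z : entire f -> cdiff f z.
Proof. by move=> /entire_cdiff. Qed.

Lemma circ_neq0 z s : cabs z = expR s -> z != 0.
Proof. by move=> zs; rewrite -cabs_gt0 zs expR_gt0. Qed.

Lemma cabs_small_eq0 (x : C) (K : R) : 0 < K -> (forall e, 0 < e -> cabs x <= e * K) -> x = 0.
Proof.
move=> K0 xe; apply/eqP; rewrite -cabs_eq0 eq_le cabs_ge0 andbT.
apply/ler_addgt0Pr => e e0; rewrite add0r.
by have := xe (e / K) (divr_gt0 e0 K0); rewrite divfK// gt_eqF.
Qed.

(** The integral does not depend on the radius, and it tends to 0 with the radius since [F] is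
    continuous with [F 0 = 0]. *)
Lemma cint_null F s : (forall z, ccont F z) -> F 0 = 0 ->
  (forall z, 0 < cabs z <= expR s -> cdiff F z) -> cint F s = 0.
Proof.
move=> cF F0 dF; apply: (@cabs_small_eq0 _ (2 * pi)); first exact: pi2_gt0.
move=> e e0; have [d d0 dP] := cF 0 _ e0.
have d20 : 0 < d / 2 by rewrite divr_gt0.
pose s' := Num.min s (ln (d / 2)).
have -> : cint F s = cint F s'.
  symmetry; apply: cint_const => [|z _|z /andP[z1 z2]]; first by rewrite ge_min lexx.
    exact: cF.
  by apply: dF; rewrite z2 andbT (lt_le_trans _ z1)// expR_gt0.
apply: cint_le; first by move=> z _; exact: cF.
move=> z zs; have := dP z; rewrite add0r F0 subr0; apply; rewrite zs.
apply: (@le_lt_trans _ _ (d / 2)); last by move: d0; lra.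
by rewrite -[leRHS]lnK ?posrE// ler_expR ge_min lexx orbT.
Qed.

(** The difference quotient of [f] at [a] with its removable singularity filled in, times the factor
    [z] due to the angular measure; this factor also makes it vanish at 0, as [cint_null]
    requires. *)
Definition kernel f a z : C :=
  if z == a then derive1 f a * a else (f z - f a) / (z - a) * z.

Lemma kernel_cdiff f a z : entire f -> z != a -> cdiff (kernel f a) z.
Proof.
move=> fe za; have [l dl] : cdiff (fun z => (f z - f a) / (z - a) * z) z.
  apply: cdiffM; last exact: cdiff_id.
  apply: cdiffM; first by apply: cdiffB; [exact: entire_at|exact: cdiff_cst].
  by apply: cdiffV; [apply: cdiffB; [exact: cdiff_id|exact: cdiff_cst]|rewrite subr_eq0].
exists l; apply: (cderiv_near (d := cabs (z - a))) dl; first by rewrite cabs_gt0 subr_eq0.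
move=> w; rewrite /kernel; case: eqP => // ->.
by rewrite cabs_subC ltxx.
Qed.

Lemma kernel_ccont f a z : entire f -> ccont (kernel f a) z.
Proof.
move=> fe; have [->|za] := eqVneq z a; last by apply/cdiff_ccont/kernel_cdiff.
have da := entire_derive1 fe a; set l := derive1 f a in da.
move=> e e0; pose A := cabs a + 1; have A0 : 0 < A by rewrite ltr_wpDl ?cabs_ge0.
pose L := cabs l + 1; have L0 : 0 < L by rewrite ltr_wpDl ?cabs_ge0.
have e1 : 0 < e / 2 / A by rewrite !divr_gt0.
have [d d0 dP] := da _ e1.
exists (Num.min d (Num.min 1 (e / 2 / L))); first by rewrite !lt_min d0 ltr01 !divr_gt0.
move=> h; rewrite !lt_min => /and3P[/dP h1 h2 h3].
have ah : a + h - a = h by ring.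
rewrite /kernel eqxx -(subr_eq0 (a + h)) ah.
have [_|h0] := eqVneq h 0; first by rewrite subrr cabs0 ltW.
have hp : 0 < cabs h by rewrite cabs_gt0.
have -> : (f (a + h) - f a) / h * (a + h) - l * a =
  (f (a + h) - f a - h * l) / h * (a + h) + l * h by field.
have hA : cabs (a + h) <= A by apply: (le_trans (cabsD _ _)); rewrite lerD2l ltW.
rewrite [e]splitr; apply: (le_trans (cabsD _ _)); apply: lerD; rewrite !cabsM.
  apply: (@le_trans _ _ (e / 2 / A * A)); last by rewrite divfK// gt_eqF.
  apply: ler_pM => //; rewrite ?mulr_ge0 ?cabs_ge0// cabsV ler_pdivrMr//.
apply: (@le_trans _ _ (L * (e / 2 / L))); last by rewrite mulrC divfK// gt_eqF.
by apply: ler_pM; rewrite ?cabs_ge0 ?lerDl// ltW.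
Qed.

(* The kernel is continuous at [a], but its differentiability there is not known
   yet: the integral is constant on either side of the circle through [a], and
   the two values agree by continuity in the radius. *)
Lemma kernel_int f a s : entire f -> cabs a < expR s -> cint (kernel f a) s = 0.
Proof.
move=> fe as_; have ck z : ccont (kernel f a) z by exact: kernel_ccont.
have k0 : kernel f a 0 = 0.
  by rewrite /kernel; case: eqP => [<-|_]; rewrite mulr0.
have [a0|a0] := eqVneq a 0.
  apply: cint_null => // z /andP[z0 _]; apply: kernel_cdiff => //.
  by rewrite a0 -cabs_gt0.
have ap : 0 < cabs a by rewrite cabs_gt0.
pose sg := ln (cabs a); have sgE : expR sg = cabs a by rewrite lnK ?posrE.
have sgs : sg < s by rewrite -ltr_expR sgE.
apply: (@cabs_small_eq0 _ (2 * (2 * pi))); first by rewrite mulr_gt0// pi2_gt0.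
move=> e e0.
have cg w : ccont (fun w => kernel f a (cexp w)) w.
  by apply: ccont_comp; [exact: ccont_cexp|exact: ck].
have [d d0 dP] := vint_continuous sg cg e0.
pose s1 := Num.min s (sg + d / 2); pose s2 := sg - d / 2.
have -> : cint (kernel f a) s = cint (kernel f a) s1.
  symmetry; apply: cint_const => [|//|z /andP[z1 _]]; first by rewrite ge_min lexx.
  apply: kernel_cdiff => //; apply: contraTneq z1 => ->.
  by rewrite -ltNge -sgE ltr_expR lt_min sgs ltrDl divr_gt0.
have c2 : cint (kernel f a) s2 = 0.
  apply: cint_null => // z /andP[_ z1]; apply: kernel_cdiff => //.
  apply: contraTneq z1 => ->; rewrite -ltNge -sgE ltr_expR.
  by rewrite ltrBlDr ltrDl divr_gt0.
have E1 : cabs (cint (kernel f a) s1 - cint (kernel f a) sg) <= e * (2 * pi).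
  apply: dP; rewrite /s1 ger0_norm.
    by rewrite ltrBlDl gt_min; apply/orP; right; move: d0; lra.
  by rewrite subr_ge0 le_min ltW//= lerDl divr_ge0// ltW.
have E2 : cabs (cint (kernel f a) s2 - cint (kernel f a) sg) <= e * (2 * pi).
  by apply: dP; rewrite /s2 addrAC subrr add0r normrN gtr0_norm; move: d0; lra.
rewrite -[cint _ s1]subr0 -c2.
apply: (le_trans (cabs_triangle (cint (kernel f a) sg) _ _)).
have -> : e * (2 * (2 * pi)) = e * (2 * pi) + e * (2 * pi) by ring.
by apply: lerD; [exact: E1|rewrite cabs_subC; exact: E2].
Qed.

(** In the logarithmic variable the integrand is [exp (- k w)]; for [k > 0] it has the periodic
    primitive [- exp (- k w) / k], so its integral over a period is 0. *)
Lemma cint_powV k s : cint (fun z => z^-1 ^+ k) s = if k == 0%N then rc (2 * pi) else 0.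
Proof.
rewrite /cint /vint.
pose f0 w : C := cexp (- k%:R * w).
have E : (fun t => (cexp (rc s + rc t * ci))^-1 ^+ k) = (fun t => f0 (rc s + rc t * ci)).
  by apply/funext => t /=; rewrite /f0 mulNr cexpN cexp_natM exprVn.
rewrite E; have ci0 : ci != 0 by rewrite -cabs_eq0 cabs_ci oner_eq0.
apply: (mulIf ci0).
have cc (z w : C) x : rcont (fun t => f0 (z + rc t * w)) x.
  apply: ccont_rcont; apply: cdiff_ccont.
  apply: (@cdiff_comp (@cexp R) (fun w => - k%:R * w)).
    by apply: cdiffM; [exact: cdiff_cst|exact: cdiff_id].
  by eexists; exact: cderiv_cexp.
case: eqP => [k0|/eqP k0].
  rewrite (@Int_path _ f0 (fun w => w)) //; first by rewrite rc0 mul0r; ring.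
    exact: pi2_ge0.
  by move=> x _; rewrite /f0 k0 oppr0 mul0r cexp0; exact: cderiv_id.
have kn : (k%:R : C) != 0 by rewrite pnatr_eq0.
rewrite (@Int_path _ f0 (fun w => - (k%:R)^-1 * cexp (- k%:R * w))) //; last 2 first.
- exact: pi2_ge0.
- move=> x _; have d1 : cderiv (fun w => - k%:R * w) (rc s + rc x * ci) (- k%:R * 1).
    exact: cderivZ (cderiv_id _).
  have := cderivZ (- (k%:R)^-1) (cderiv_comp d1 (cderiv_cexp _)).
  by rewrite mulr1 mulrA mulrNN mulVf// mul1r.
rewrite rc0 !mul0r addr0 (mulrC (rc _) ci) !mulNr !cexpN !cexp_natM cexp_per.
by rewrite subrr.
Qed.

Lemma geometric_kernel n z a : z != 0 -> z != a ->
  z / (z - a) = \sum_(j < n) a ^+ j * z^-1 ^+ j + (a / z) ^+ n * (z / (z - a)).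
Proof.
move=> z0 za; have za' : z - a != 0 by rewrite subr_eq0.
elim: n => [|n ih]; first by rewrite big_ord0 add0r expr0 mul1r.
have h : z / (z - a) = 1 + a / z * (z / (z - a)) by field; rewrite za' z0.
have key : (a / z) ^+ n * (z / (z - a)) = (a / z) ^+ n + (a / z) ^+ n.+1 * (z / (z - a)).
  by rewrite {1}h exprSr; ring.
have an : a ^+ n * z^-1 ^+ n = (a / z) ^+ n by rewrite exprMn.
by rewrite big_ord_recr /= {1}ih key an addrA.
Qed.

Lemma circ_neq a z s : cabs a < expR s -> cabs z = expR s -> z != a.
Proof. by move=> h zs; apply: contraTneq h => <-; rewrite zs ltxx. Qed.

Lemma cdiff_powV j z : z != 0 -> cdiff (fun z => z^-1 ^+ j) z.
Proof. by move=> z0; apply: cdiffX; apply: cdiffV => //; exact: cdiff_id. Qed.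

Lemma cdiff_geom n a z : z != 0 -> z != a -> cdiff (fun z => (a / z) ^+ n * (z / (z - a))) z.
Proof.
move=> z0 za; apply: cdiffM.
  apply: cdiffX; apply: cdiffM; first exact: cdiff_cst.
  by apply: cdiffV => //; exact: cdiff_id.
apply: cdiffM; first exact: cdiff_id.
by apply: cdiffV; [apply: cdiffB; [exact: cdiff_id|exact: cdiff_cst]|rewrite subr_eq0].
Qed.

Lemma cint_geom f a s n : entire f -> cabs a < expR s ->
  cint (fun z => f z * (z / (z - a))) s =
  \sum_(j < n) a ^+ j * cint (fun z => f z * z^-1 ^+ j) s +
  cint (fun z => f z * ((a / z) ^+ n * (z / (z - a)))) s.
Proof.
move=> fe as_.
have d1 j : ccirc (fun z => f z * z^-1 ^+ j) s.
  apply: cdiff_ccirc => z /circ_neq0 z0; apply: cdiffM; first exact: entire_at.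
  exact: cdiff_powV.
have d1' j : ccirc (fun z => a ^+ j * (f z * z^-1 ^+ j)) s.
  apply: cdiff_ccirc => z /circ_neq0 z0; apply: cdiffM; first exact: cdiff_cst.
  by apply: cdiffM; [exact: entire_at|exact: cdiff_powV].
have d2 : ccirc (fun z => f z * ((a / z) ^+ n * (z / (z - a)))) s.
  apply: cdiff_ccirc => z zs; apply: cdiffM; first exact: entire_at.
  by apply: cdiff_geom; [exact: circ_neq0 zs|exact: circ_neq zs].
under eq_bigr do rewrite -cintZ//.
rewrite -(@cint_sum _ n (fun k z => a ^+ k * (f z * z^-1 ^+ k)))// -cintD//; last first.
  move=> z zs; apply/cdiff_ccont; elim: n {d2} => [|n ih].
    by under eq_fun do rewrite big_ord0; exact: cdiff_cst.
  under eq_fun do rewrite big_ord_recr /=; apply: cdiffD => //.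
  have z0 := circ_neq0 zs; apply: cdiffM; first exact: cdiff_cst.
  by apply: cdiffM; [exact: entire_at|exact: cdiff_powV].
apply: eq_cint => z zs.
rewrite {1}(geometric_kernel n (circ_neq0 zs) (circ_neq as_ zs)) mulrDr mulr_sumr.
by congr (_ + _); apply: eq_bigr => j _; ring.
Qed.

Lemma cabs_geom_le a z s n : cabs a <= expR s / 2 -> cabs z = expR s ->
  cabs ((a / z) ^+ n * (z / (z - a))) <= 2 * (cabs a / expR s) ^+ n.
Proof.
move=> as_ zs; have r0 : 0 < expR s by exact: expR_gt0.
have za : expR s / 2 <= cabs (z - a).
  have : cabs z <= cabs (z - a) + cabs a by rewrite -{1}(subrK a z); exact: cabsD.
  by rewrite zs; move: as_; lra.
have h1 : cabs (z / (z - a)) <= 2.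
  rewrite cabsM cabsV zs ler_pdivrMr; last by apply: lt_le_trans za; rewrite divr_gt0.
  by move: za; lra.
have h2 : cabs ((a / z) ^+ n) = (cabs a / expR s) ^+ n by rewrite cabsX cabsM cabsV zs.
by rewrite cabsM h2 mulrC ler_wpM2r// exprn_ge0// mulr_ge0 ?cabs_ge0// invr_ge0 ltW.
Qed.

Lemma cabs_half_lt a s : cabs a <= expR s / 2 -> cabs a < expR s.
Proof. by have := expR_gt0 s; lra. Qed.

Lemma cint_geom_le f a s n (M : R) : entire f -> cabs a <= expR s / 2 ->
  (forall z, cabs z = expR s -> cabs (f z) <= M) ->
  cabs (cint (fun z => f z * ((a / z) ^+ n * (z / (z - a)))) s) <=
  2 * M * (cabs a / expR s) ^+ n * (2 * pi).
Proof.
move=> fe as_ fM; have as' := cabs_half_lt as_.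
apply: cint_le => [|z zs].
  apply: cdiff_ccirc => z zs; apply: cdiffM; first exact: entire_at.
  by apply: cdiff_geom; [exact: circ_neq0 zs|exact: circ_neq zs].
have -> : 2 * M * (cabs a / expR s) ^+ n = M * (2 * (cabs a / expR s) ^+ n) by ring.
by rewrite cabsM ler_pM ?cabs_ge0// ?fM// cabs_geom_le.
Qed.

Lemma half_pow_small (e : R) : 0 < e -> exists n, 2^-1 ^+ n < e.
Proof.
move=> e0; have := @cvg_expr R 2^-1.
rewrite ger0_norm ?invr_ge0// invf_lt1// ltr1n => /(_ isT).
move=> /cvgrPdist_lt/(_ e e0)[n _ /(_ n)]; rewrite /= sub0r normrN leqnn => /(_ isT) hn.
by exists n; apply: le_lt_trans hn; rewrite ler_norm.
Qed.

(** Expanding the kernel as a geometric sum leaves only the term [j = 0]. Keeping [a] in the disc of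
    half the radius makes the ratio at most [1 / 2] and the remainder explicit. *)
Lemma cint_kernel1 a s : cabs a <= expR s / 2 ->
  cint (fun z => z / (z - a)) s = rc (2 * pi).
Proof.
move=> as_; have as' := cabs_half_lt as_.
have e1 : entire (fun _ : C => 1 : C) by apply/entire_cdiff => z; exact: cdiff_cst.
apply/eqP; rewrite -subr_eq0; apply/eqP; apply: (@cabs_small_eq0 _ (2 * (2 * pi))).
  by rewrite mulr_gt0// pi2_gt0.
move=> e e0; have [n ne] := half_pow_small e0.
have := cint_geom n.+1 e1 as'; rewrite big_ord_recl.
have -> : cint (fun z => 1 * (z / (z - a))) s = cint (fun z => z / (z - a)) s.
  by apply: eq_cint => z _; rewrite mul1r.
have E j : cint (fun z => 1 * z^-1 ^+ j) s = if j == 0%N then rc (2 * pi) else 0.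
  by rewrite -(cint_powV j s); apply: eq_cint => z _; rewrite mul1r.
rewrite E eqxx expr0 mul1r big1 ?addr0; last by move=> i _; rewrite E /= mulr0.
move=> ->; rewrite addrAC subrr add0r.
apply: (le_trans (cint_geom_le (M := 1) _ e1 as_ _)) => [z _|]; first by rewrite cabs1.
rewrite mulr1 -mulrA mulrCA ler_wpM2r//; first by rewrite mulr_ge0// pi2_ge0.
have r0 : 0 < expR s by exact: expR_gt0.
have q : cabs a / expR s <= 2^-1 by rewrite ler_pdivrMr// mulrC.
have q0 : 0 <= cabs a / expR s by rewrite mulr_ge0 ?cabs_ge0// invr_ge0 ltW.
apply: (@le_trans _ _ (2^-1 ^+ n.+1)); first by rewrite lerXn2r ?nnegrE// invr_ge0.
apply: le_trans (ltW ne); rewrite exprS ler_piMl ?exprn_ge0 ?invr_ge0//.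
by rewrite invf_le1// ler1n.
Qed.

(** Subtracting [f a] times the integral of the bare kernel leaves the integral of [kernel f a],
    which vanishes. *)
Lemma cauchy_formula f a s : entire f -> cabs a <= expR s / 2 ->
  cint (fun z => f z * (z / (z - a))) s = rc (2 * pi) * f a.
Proof.
move=> fe as_; have as' := cabs_half_lt as_.
have d1 : ccirc (fun z => z / (z - a)) s.
  apply: cdiff_ccirc => z zs; have := cdiff_geom 0 (circ_neq0 zs) (circ_neq as' zs).
  by under eq_fun do rewrite expr0 mul1r.
have d2 : ccirc (fun z => f z * (z / (z - a))) s.
  apply: cdiff_ccirc => z zs; apply: cdiffM; first exact: entire_at.
  have := cdiff_geom 0 (circ_neq0 zs) (circ_neq as' zs).
  by under eq_fun do rewrite expr0 mul1r.
have d3 : ccirc (fun z => f a * (z / (z - a))) s.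
  apply: cdiff_ccirc => z zs; apply: cdiffM; first exact: cdiff_cst.
  have := cdiff_geom 0 (circ_neq0 zs) (circ_neq as' zs).
  by under eq_fun do rewrite expr0 mul1r.
apply/eqP; rewrite mulrC -(cint_kernel1 as_) -cintZ// -subr_eq0 -cintB//.
apply/eqP; rewrite -(kernel_int fe as'); apply: eq_cint => z zs.
by rewrite /kernel (negbTE (circ_neq as' zs)); ring.
Qed.

(** Taylor coefficient at 0 as a Cauchy integral; [s = 0] is the unit circle. *)
Definition coef f n : C := rc (2 * pi)^-1 * cint (fun z => f z * z^-1 ^+ n) 0.

Lemma rc2pi : rc (2 * pi) * rc (2 * pi)^-1 = 1 :> C.
Proof. by rewrite -rcM divff ?rc1// gt_eqF// pi2_gt0. Qed.

Lemma coef_cint f n s : entire f -> cint (fun z => f z * z^-1 ^+ n) s = rc (2 * pi) * coef f n.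
Proof.
move=> fe; rewrite /coef mulrA rc2pi mul1r.
have dF z : z != 0 -> cdiff (fun z => f z * z^-1 ^+ n) z.
  by move=> z0; apply: cdiffM; [exact: entire_at|exact: cdiff_powV].
have H s1 s2 : s1 <= s2 -> cint (fun z => f z * z^-1 ^+ n) s1 = cint (fun z => f z * z^-1 ^+ n) s2.
  move=> s12; apply: cint_const => // z; first by move=> z0; exact/cdiff_ccont/dF.
  by move=> /andP[z1 _]; apply: dF; rewrite -cabs_gt0 (lt_le_trans _ z1)// expR_gt0.
by have [h|h] := leP s 0; [exact: (H _ _ h)|exact: (esym (H _ _ (ltW h)))].
Qed.

Lemma coef_le f n (r M : R) : entire f -> 0 < r -> (forall z, cabs z = r -> cabs (f z) <= M) ->
  cabs (coef f n) <= M / r ^+ n.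
Proof.
move=> fe r0 fM; have rE : expR (ln r) = r by rewrite lnK ?posrE.
have : cabs (cint (fun z => f z * z^-1 ^+ n) (ln r)) <= M / r ^+ n * (2 * pi).
  apply: cint_le.
    apply: cdiff_ccirc => z /circ_neq0 z0; apply: cdiffM; first exact: entire_at.
    exact: cdiff_powV.
  move=> z zs; rewrite cabsM exprVn cabsV cabsX zs rE.
  by apply: ler_wpM2r; [rewrite invr_ge0 exprn_ge0 ?ltW|apply: fM; rewrite zs].
rewrite coef_cint// cabsM cabs_rc ger0_norm ?pi2_ge0// mulrC ler_pM2r//.
exact: pi2_gt0.
Qed.

(** Cauchy's formula with the kernel expanded to order [n]. This finite form, with a bound depending
    on [f] only through [M], stands in for power series in all that follows. *)
Lemma taylor_remainder f a n (r M : R) : entire f -> 0 < r ->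
  (forall z, cabs z = r -> cabs (f z) <= M) -> cabs a <= r / 2 ->
  cabs (f a - \sum_(j < n) coef f j * a ^+ j) <= 2 * M * (cabs a / r) ^+ n.
Proof.
move=> fe r0 fM ar; have rE : expR (ln r) = r by rewrite lnK ?posrE.
have ar' : cabs a <= expR (ln r) / 2 by rewrite rE.
have := cint_geom n fe (cabs_half_lt ar'); rewrite cauchy_formula//.
under eq_bigr => j _ do rewrite coef_cint// mulrCA.
rewrite -mulr_sumr => E.
have := @cint_geom_le f a (ln r) n M fe ar' _; rewrite rE => /(_ fM).
have -> : cint (fun z => f z * ((a / z) ^+ n * (z / (z - a)))) (ln r) =
   rc (2 * pi) * (f a - \sum_(j < n) coef f j * a ^+ j).
  rewrite mulrBr E addrAC -mulrBr.
  have -> : \sum_(j < n) a ^+ j * coef f j = \sum_(j < n) coef f j * a ^+ j.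
    by apply: eq_bigr => j _; rewrite mulrC.
  by rewrite subrr mulr0 add0r.
rewrite cabsM cabs_rc ger0_norm ?pi2_ge0// mulrC ler_pM2r//.
exact: pi2_gt0.
Qed.
End Taylor.

(** * From estimates on discs to the compact-open topology *)

Section CompactConvergence.
Variable R : realType.
Notation C := (Cplx R).

Lemma compact_cabs_bounded (K : set C) : compact K -> exists r : R, forall z, K z -> cabs z <= r.
Proof.
move=> /compact_near_coveringP cK.
have [n _ nP] : \forall n \near \oo, K `<=` (fun z => cabs z <= n%:R).
  apply: (cK nat \oo (fun n z => cabs z <= n%:R)) => z _.
  pose n0 := (Num.truncn (cabs z + 1)).+1.
  exists (ball z (rc 1 : C), [set n | (n0 <= n)%N]).
    split => /=; last by exists n0.
    by have := @nbhsx_ballx C C z (rc 1); rewrite rc1 ltr01; exact.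
  move=> [w n] /= [zw n0n]; move: zw; rewrite /ball /= cabsE lt_rc => zw.
  apply: (le_trans (cabs_le_dist _ z)); rewrite cabs_subC.
  apply: (@le_trans _ _ n0%:R); last by rewrite ler_nat.
  by apply: ltW; apply: lt_trans (truncnS_gt _); rewrite ltrD2l.
by exists n%:R => z Kz; exact: (nP n (leqnn n)).
Qed.

(** A compact set lies in some disc, so approximating on the disc of radius [n] within [1 / (n + 1)]
    gives a sequence converging on every compact set. *)
Lemma closure_compact_open (S : set (C -> C)) (g : C -> C) :
  (forall r e : R, 0 < e -> exists2 f, S f & forall z, cabs z <= r -> cabs (f z - g z) <= e) ->
  closure (S : set {family compact, C -> C}) g.
Proof.
move=> H.
have H' n : exists f, S f /\ forall z, cabs z <= n%:R -> cabs (f z - g z) <= n.+1%:R^-1.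
  have [|f Sf fg] := H n%:R n.+1%:R^-1; first by rewrite invr_gt0.
  by exists f.
have [F FP] := choice H'.
have Fg : (F : nat -> {family compact, C -> C}) @ \oo --> (g : {family compact, C -> C}).
  apply/fam_cvgP => K cK P /uniform_nbhs[E [entE EP]].
  have [r rK] := compact_cabs_bounded cK.
  move: entE; rewrite -entourage_ballE => -[_ /C_gt0_rc[e e0 ->] eE].
  pose n0 := maxn (Num.truncn r).+1 (Num.truncn e^-1).+1.
  exists n0 => // n /= n0n; apply: EP => z Kz; apply: eE; rewrite /ball /= cabsE lt_rc cabs_subC.
  apply: (@le_lt_trans _ _ n.+1%:R^-1).
    apply: (FP n).2; apply: (le_trans (rK z Kz)); apply: ltW; apply: (lt_le_trans (truncnS_gt r)).
    by rewrite ler_nat (leq_trans _ n0n)// leq_maxl.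
  rewrite -[e]invrK ltf_pV2 ?posrE ?invr_gt0//; apply: (lt_le_trans (truncnS_gt e^-1)).
  by rewrite ler_nat (leq_trans _ (leqW n0n))// leq_maxr.
move=> U /Fg[n _ /(_ n (leqnn n))] Un; exists (F n); split=> //; exact: (FP n).1.
Qed.
End CompactConvergence.

(** * Entire functions: derivatives, Cauchy estimates, locally uniform limits *)

Section EntireFunctions.
Variable R : realType.
Notation C := (Cplx R).
Notation ci := (ci R).
Implicit Types (f g F G : C -> C) (s r e : R) (z w a h : C).

(** Completeness is taken from [R], through the real and imaginary parts; the geometric majorant
    then bounds the tail. *)
Lemma geometric_series (x : nat -> C) (K : R) : (forall n, cabs (x n) <= K * 2^-1 ^+ n) ->
  forall N, cabs (limn (series x) - \sum_(n < N) x n) <= 2 * K * 2^-1 ^+ N.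
Proof.
move=> xK.
have rcv (u : nat -> R) : (forall n, `|u n| <= K * 2^-1 ^+ n) -> cvgn (series u).
  move=> uK; apply: normed_cvg; apply: (series_le_cvg (v_ := geometric K 2^-1)) => //.
  - by move=> n /=.
  - by move=> n; exact: le_trans (normr_ge0 _) (uK n).
  by apply: is_cvg_geometric_series; rewrite ger0_norm ?invr_ge0// invf_lt1// ltr1n.
have cre : cvgn (series (fun n => complex.Re (x n))).
  by apply: rcv => n; exact: le_trans (Re_le_cabs _) (xK n).
have cim : cvgn (series (fun n => complex.Im (x n))).
  by apply: rcv => n; exact: le_trans (Im_le_cabs _) (xK n).
have ReS n : complex.Re (series x n) = series (fun n => complex.Re (x n)) n.
  by rewrite /series /= (big_morph (@complex.Re R) (@Re_add R) (erefl _)).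
have ImS n : complex.Im (series x n) = series (fun n => complex.Im (x n)) n.
  by rewrite /series /= (big_morph (@complex.Im R) (@Im_add R) (erefl _)).
set l : C := rc (limn (series (fun n => complex.Re (x n)))) +
  ci * rc (limn (series (fun n => complex.Im (x n)))).
have lP e : 0 < e -> exists N0, forall N, (N0 <= N)%N -> cabs (l - series x N) <= e.
  move=> e0; have e2 : 0 < e / 2 by rewrite divr_gt0.
  have /cvgrPdist_le/(_ _ e2)[N1 _ N1P] := cre.
  have /cvgrPdist_le/(_ _ e2)[N2 _ N2P] := cim.
  exists (maxn N1 N2) => N; rewrite geq_max => /andP[/N1P h1 /N2P h2].
  apply: (le_trans (cabs_le_ReIm _)).
  rewrite Re_add Im_add Re_opp Im_opp ReS ImS [e]splitr; apply: lerD.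
    by move: h1; rewrite Re_add Re_mul /=; congr (_ <= _); congr `| _ |; ring.
  by move: h2; rewrite Im_add Im_mul /=; congr (_ <= _); congr `| _ |; ring.
have -> : limn (series x) = l.
  apply: cvg_lim; first exact: norm_hausdorff.
  apply/cvgrPdist_le => _ /C_gt0_rc[e e0 ->]; have [N0 N0P] := lP e e0.
  by exists N0 => // N /= /N0P; rewrite cabsE le_rc.
move=> N; apply/ler_addgt0Pr => e e0; have [N0 N0P] := lP e e0.
have tail m : cabs (\sum_(n < N + m) x n - \sum_(n < N) x n) <= 2 * K * (2^-1 ^+ N - 2^-1 ^+ (N + m)).
  elim: m => [|m ih]; first by rewrite addn0 !subrr cabs0 mulr0.
  rewrite addnS big_ord_recr /= addrAC; apply: (le_trans (cabsD _ _)).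
  apply: (le_trans (lerD ih (xK _))); rewrite exprS.
  by rewrite le_eqVlt; apply/orP; left; apply/eqP; field.
have K0 : 0 <= K by have := xK 0%N; rewrite expr0 mulr1; exact: le_trans (cabs_ge0 _).
have := N0P (N + N0)%N (leq_addl _ _); rewrite /series /= big_mkord => h1.
apply: (le_trans (cabs_triangle (\sum_(n < N + N0) x n) _ _)).
rewrite addrC; apply: lerD => //; apply: (le_trans (tail N0)).
by rewrite ler_wpM2l ?mulr_ge0// gerBl exprn_ge0// invr_ge0.
Qed.

(** Compactness of a square containing the disc, the bound [M] tending to [+oo] being the parameter
    of the covering argument. *)
Lemma entire_bounded f r : entire f ->
  exists2 M : R, 0 < M & forall z, cabs z <= r -> cabs (f z) <= M.
Proof.
move=> fe; have cpt : compact (`[- r, r] `*` `[- r, r] : set (R * R)%type).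
  by apply: compact_setX; exact: segment_compact.
have {cpt} : \forall M \near +oo, (`[- r, r] `*` `[- r, r] : set (R * R)%type) `<=`
    (fun p => cabs (f (rc p.1 + ci * rc p.2)) <= M).
  move/compact_near_coveringP : cpt => cpt.
  apply: (cpt R +oo%R (fun M p => cabs (f (rc p.1 + ci * rc p.2)) <= M)) => p _.
  set z := rc p.1 + ci * rc p.2.
  have [d d0 dP] := cdiff_ccont (entire_at z fe) (ltr01 : 0 < 1 :> R).
  have d20 : 0 < d / 2 by rewrite divr_gt0.
  exists (ball p (d / 2), [set M : R | cabs (f z) + 1 <= M]).
    by split => /=; [exact: nbhsx_ballx|apply: nbhs_pinfty_ge; exact: num_real].
  move=> [q M] /= [[]]; rewrite /ball /= => q1 q2 MP; apply: le_trans MP.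
  apply: (le_trans (cabs_le_dist _ (f z))); rewrite lerD2l.
  have -> : rc q.1 + ci * rc q.2 = z + (rc (q.1 - p.1) + ci * rc (q.2 - p.2)).
    by rewrite !rcB /z; ring.
  apply: dP; apply: (le_lt_trans (cabsD _ _)); rewrite cabsM cabs_ci mul1r !cabs_rc.
  by rewrite distrC (distrC q.2); move: q1 q2; lra.
move=> [M0 [M0r M0P]]; pose M := Num.max M0 0 + 1.
have M0M : M0 < M by rewrite ltr_pwDr// le_max lexx.
exists M; first by rewrite ltr_pwDr// le_max lexx orbT.
move=> z zr; have := M0P M M0M (complex.Re z, complex.Im z).
rewrite /= -C_decomp; apply; split; rewrite /= in_itv /= -ler_norml.
  exact: le_trans (Re_le_cabs _) zr.
exact: le_trans (Im_le_cabs _) zr.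
Qed.

Opaque Cplx derive1.

Lemma ccontM f g z : ccont f z -> ccont g z -> ccont (fun w => f w * g w) z.
Proof.
move=> cf cg e e0.
pose A := cabs (f z) + 1; have A0 : 0 < A by rewrite ltr_wpDl ?cabs_ge0.
pose B := cabs (g z) + 1; have B0 : 0 < B by rewrite ltr_wpDl ?cabs_ge0.
have e1 : 0 < Num.min 1 (e / 2 / B) by rewrite lt_min ltr01 !divr_gt0.
have e2 : 0 < e / 2 / A by rewrite !divr_gt0.
have [d1 d10 dP1] := cf _ e1; have [d2 d20 dP2] := cg _ e2.
exists (Num.min d1 d2); first by rewrite lt_min d10.
move=> k; rewrite lt_min => /andP[/dP1 + /dP2]; rewrite le_min => /andP[k1 k2] k3.
have -> : f (z + k) * g (z + k) - f z * g z =
  f (z + k) * (g (z + k) - g z) + (f (z + k) - f z) * g z by ring.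
rewrite [e]splitr; apply: (le_trans (cabsD _ _)); apply: lerD; rewrite cabsM.
  apply: (@le_trans _ _ (A * (e / 2 / A))); last by rewrite mulrC divfK// gt_eqF.
  apply: ler_pM; rewrite ?cabs_ge0//.
  by apply: (le_trans (cabs_le_dist _ (f z))); rewrite lerD2l.
apply: (@le_trans _ _ (e / 2 / B * B)); last by rewrite divfK// gt_eqF.
by apply: ler_pM; rewrite ?cabs_ge0// lerDl.
Qed.

Lemma entire_cst (c : C) : entire (fun _ => c).
Proof. by apply/entire_cdiff => z; exact: cdiff_cst. Qed.
Lemma entireD f g : entire f -> entire g -> entire (fun z => f z + g z).
Proof. by move=> fe ge; apply/entire_cdiff => z; apply: cdiffD; exact: entire_at. Qed.
Lemma entireM f g : entire f -> entire g -> entire (fun z => f z * g z).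
Proof. by move=> fe ge; apply/entire_cdiff => z; apply: cdiffM; exact: entire_at. Qed.
Lemma entireZ (c : C) f : entire f -> entire (fun z => c * f z).
Proof. by move=> fe; apply: entireM; [exact: entire_cst|]. Qed.
Lemma entireX f n : entire f -> entire (fun z => f z ^+ n).
Proof. by move=> fe; apply/entire_cdiff => z; apply: cdiffX; exact: entire_at. Qed.
Lemma entire_sum (I : Type) (s : seq I) (P : pred I) (F : I -> C -> C) :
  (forall i, entire (F i)) -> entire (fun z => \sum_(i <- s | P i) F i z).
Proof.
move=> Fe; elim: s => [|i s ih].
  by under eq_fun do rewrite big_nil; exact: entire_cst.
under eq_fun do rewrite big_cons; case: (P i); last exact: ih.
by apply: entireD; [exact: Fe|exact: ih].
Qed.
Lemma entire_expM (l : C) : entire (fun z => cexp (l * z)).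
Proof.
apply/entire_cdiff => z; apply: (@cdiff_comp _ (@cexp R) (fun z => l * z)).
  by apply: cdiffM; [exact: cdiff_cst|exact: cdiff_id].
by eexists; exact: cderiv_cexp.
Qed.

Lemma cderiv_shift f z h l : cderiv f (z + h) l -> cderiv (fun w => f (z + w)) h l.
Proof.
move=> fl; have d1 : cderiv (fun w => z + w) h (0 + 1).
  exact: cderivD (cderiv_cst _ _) (cderiv_id _).
by have := cderiv_comp d1 fl; rewrite add0r mul1r.
Qed.

Lemma entire_shift f z : entire f -> entire (fun w => f (z + w)).
Proof.
by move=> fe; apply/entire_cdiff => h; have [l fl] := entire_at (z + h) fe; exists l;
  exact: cderiv_shift.
Qed.

Lemma derive1_shift f z : entire f -> derive1 (fun w => f (z + w)) = (fun w => derive1 f (z + w)).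
Proof.
move=> fe; apply/funext => h; apply: cderiv_derive1; apply: cderiv_shift.
exact: entire_derive1.
Qed.

Lemma cderiv_quadratic f z l (K d : R) : 0 < d ->
  (forall h, cabs h <= d -> cabs (f (z + h) - f z - h * l) <= K * cabs h ^+ 2) ->
  cderiv f z l.
Proof.
move=> d0 fK e e0; have K0 : 0 < `|K| + 1 by rewrite ltr_wpDl.
exists (Num.min d (e / (`|K| + 1))); first by rewrite lt_min d0 divr_gt0.
move=> h; rewrite lt_min => /andP[h1 h2]; apply: (le_trans (fK h (ltW h1))).
rewrite expr2 mulrA ler_wpM2r ?cabs_ge0//.
apply: (@le_trans _ _ ((`|K| + 1) * cabs h)).
  by rewrite ler_wpM2r ?cabs_ge0// (le_trans (ler_norm _))// lerDl.
by rewrite mulrC -ler_pdivlMr// ltW.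
Qed.

Lemma coef0E f : entire f -> coef f 0 = f 0.
Proof.
move=> fe; have [M M0 fM] := entire_bounded 1 fe.
have fM' z : cabs z = 1 -> cabs (f z) <= M by move=> z1; apply: fM; rewrite z1.
have := @taylor_remainder _ f 0 1 1 M fe ltr01 fM'.
rewrite big_ord1 /= expr0 mulr1 cabs0 mul0r expr1 mulr0 => H.
have {}H := H (divr_ge0 ler01 (ler0n _ 2)).
by apply/esym/eqP; rewrite -subr_eq0 -cabs_eq0 eq_le cabs_ge0 andbT.
Qed.

Lemma taylor2 f h (M : R) : entire f -> (forall z, cabs z <= 1 -> cabs (f z) <= M) ->
  cabs h <= 1 / 2 -> cabs (f h - f 0 - h * coef f 1) <= 2 * M * cabs h ^+ 2.
Proof.
move=> fe fM h2; have := @taylor_remainder _ f h 2 1 M fe ltr01 _ h2.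
rewrite big_ord_recl big_ord1 /= expr0 mulr1 coef0E// expr1 divr1 opprD addrA.
by rewrite (mulrC h); apply => z z1; apply: fM; rewrite z1.
Qed.

Lemma coef1E f : entire f -> coef f 1 = derive1 f 0.
Proof.
move=> fe; have [M M0 fM] := entire_bounded 1 fe.
apply/esym/cderiv_derive1; apply: (@cderiv_quadratic _ _ _ (2 * M) (1 / 2)).
  by rewrite divr_gt0.
by move=> h h2; rewrite add0r; exact: taylor2.
Qed.

Lemma derive1_coef f z : entire f -> derive1 f z = coef (fun w => f (z + w)) 1.
Proof.
by move=> fe; rewrite coef1E; [rewrite (derive1_shift _ fe) addr0|exact: entire_shift].
Qed.

(** The constant depends on [f] only through a bound on a disc. This uniformity is used for the
    continuity of [derive1 f], for differentiation under the integral and for limits of entire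
    functions. *)
Lemma second_order f z h (M : R) : entire f -> (forall w, cabs w <= cabs z + 1 -> cabs (f w) <= M) ->
  cabs h <= 1 / 2 -> cabs (f (z + h) - f z - h * derive1 f z) <= 2 * M * cabs h ^+ 2.
Proof.
move=> fe fM h2; have := @taylor2 (fun w => f (z + w)) h M (@entire_shift f z fe) _ h2.
rewrite -derive1_coef// addr0; apply => w w1; apply: fM.
by apply: (le_trans (cabsD _ _)); rewrite lerD2l.
Qed.

(** Expanding from [z] to [z + h] and back from [z + h] to [z], and adding, bounds [h] times the
    increment of the derivative by a multiple of [|h|^2]. *)
Lemma ccont_derive1 f z : entire f -> ccont (derive1 f) z.
Proof.
move=> fe e e0; have [M M0 fM] := entire_bounded (cabs z + 2) fe.
exists (Num.min (1 / 2) (e / (4 * M))); first by rewrite lt_min !divr_gt0// mulr_gt0.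
move=> h; rewrite lt_min => /andP[h1 h2].
have [->|h0] := eqVneq h 0; first by rewrite addr0 subrr cabs0 ltW.
have hp : 0 < cabs h by rewrite cabs_gt0.
have E1 : cabs (f (z + h) - f z - h * derive1 f z) <= 2 * M * cabs h ^+ 2.
  apply: second_order => //; last exact: ltW.
  by move=> w w1; apply: fM; apply: (le_trans w1); rewrite lerD2l// ler1n.
have E2 : cabs (f (z + h - h) - f (z + h) - (- h) * derive1 f (z + h)) <= 2 * M * cabs (- h) ^+ 2.
  apply: second_order => //; last by rewrite cabsN ltW.
  move=> w w1; apply: fM; apply: (le_trans w1); have := cabsD z h; move: h1; lra.
have zh : z + h - h = z by rewrite addrK.
rewrite zh in E2; rewrite -(ler_pM2l hp) -cabsM.
have -> : h * (derive1 f (z + h) - derive1 f z) =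
  (f (z + h) - f z - h * derive1 f z) + (f z - f (z + h) - (- h) * derive1 f (z + h)).
  by move: (derive1 f (z + h)) (derive1 f z) (f (z + h)) (f z) => a b c d; ring.
apply: (le_trans (cabsD _ _)); apply: (le_trans (lerD E1 E2)); rewrite cabsN.
have -> : 2 * M * cabs h ^+ 2 + 2 * M * cabs h ^+ 2 = cabs h * (4 * M * cabs h) by ring.
by rewrite ler_pM2l// mulrC -ler_pdivlMr ?mulr_gt0// ltW.
Qed.

Lemma ccont_shift f z h : ccont f (z + h) -> ccont (fun w => f (z + w)) h.
Proof.
by move=> cf e /cf[d d0 dP]; exists d => // k /dP; rewrite addrA.
Qed.

(* Differentiation under the integral sign in the Cauchy formula for [f']. *)
Lemma entire_derive1_entire f : entire f -> entire (derive1 f).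
Proof.
move=> fe; apply/entire_cdiff => z.
pose l := rc (2 * pi)^-1 * cint (fun w => derive1 f (z + w) * w^-1 ^+ 1) 0.
exists l; have [M M0 fM] := entire_bounded (cabs z + 2) fe.
apply: (@cderiv_quadratic _ _ _ (2 * M) (1 / 2)); first by rewrite divr_gt0.
move=> h h2.
have c1 k : ccirc (fun w => f (k + w) * w^-1 ^+ 1) 0.
  apply: cdiff_ccirc => w /circ_neq0 w0; apply: cdiffM; last exact: cdiff_powV.
  exact/entire_at/entire_shift.
have c2 : ccirc (fun w => derive1 f (z + w) * w^-1 ^+ 1) 0.
  move=> w /circ_neq0 w0; apply: ccontM; last exact/cdiff_ccont/cdiff_powV.
  exact: ccont_shift (ccont_derive1 (z + w) fe).
have c3 : ccirc (fun w => h * (derive1 f (z + w) * w^-1 ^+ 1)) 0.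
  by move=> w w1; apply: ccontM; [exact/cdiff_ccont/cdiff_cst|exact: c2].
have c4 : ccirc (fun w => f (z + h + w) * w^-1 ^+ 1 - f (z + w) * w^-1 ^+ 1) 0.
  by move=> w w1; apply: ccontB; exact: c1.
rewrite !derive1_coef//.
have -> : coef (fun w => f (z + h + w)) 1 - coef (fun w => f (z + w)) 1 - h * l =
    rc (2 * pi)^-1 * cint (fun w => (f (z + h + w) * w^-1 ^+ 1 - f (z + w) * w^-1 ^+ 1) -
       h * (derive1 f (z + w) * w^-1 ^+ 1)) 0.
  by rewrite cintB// cintB// cintZ// /coef /l; ring.
rewrite cabsM cabs_rc gtr0_norm ?invr_gt0 ?pi2_gt0// mulrC.
rewrite ler_pdivrMr ?pi2_gt0//; apply: cint_le => [w w1|w].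
  by apply: ccontB; [exact: c4|exact: c3].
rewrite expR0 => w1.
have -> : f (z + h + w) * w^-1 ^+ 1 - f (z + w) * w^-1 ^+ 1 - h * (derive1 f (z + w) * w^-1 ^+ 1) =
   (f (z + w + h) - f (z + w) - h * derive1 f (z + w)) * w^-1 ^+ 1.
  by rewrite (addrAC z h); ring.
rewrite cabsM expr1 cabsV w1 invr1 mulr1; apply: second_order => // v v1; apply: fM.
by apply: (le_trans v1); have := cabsD z w; rewrite w1; lra.
Qed.

Lemma entire_derive1n n f : entire f -> entire (derive1n n f).
Proof.
by move=> fe; elim: n => [//|n ih]; rewrite derive1nS; exact: entire_derive1_entire.
Qed.

Lemma derive1n_derive1 n f : derive1n n (derive1 f) = derive1n n.+1 f.
Proof. by rewrite /derive1n -iterSr. Qed.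

(* [f (exp w) exp (- (n + 1) w)] is periodic, so the integral of its derivative vanishes. *)
Lemma coef_derive1 f n : entire f -> coef (derive1 f) n = n.+1%:R * coef f n.+1.
Proof.
move=> fe; pose G w := f (cexp w) * cexp (- n.+1%:R * w).
pose g w := derive1 f (cexp w) * cexp w * cexp (- n.+1%:R * w)
   - n.+1%:R * (f (cexp w) * cexp (- n.+1%:R * w)).
have dG w : cderiv G w (g w).
  have d1 := cderiv_comp (cderiv_cexp w) (entire_derive1 fe (cexp w)).
  have d2 : cderiv (fun w => - n.+1%:R * w) w (- n.+1%:R * 1) by exact: cderivZ (cderiv_id _).
  have := cderivM d1 (cderiv_comp d2 (cderiv_cexp _)).
  by rewrite mulr1; congr cderiv; rewrite /g; ring.
have fe' := entire_derive1_entire fe.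
have c1 : ccirc (fun z => derive1 f z * z^-1 ^+ n) 0.
  apply: cdiff_ccirc => z /circ_neq0 z0; apply: cdiffM; [exact: entire_at|exact: cdiff_powV].
have c2 : ccirc (fun z => f z * z^-1 ^+ n.+1) 0.
  apply: cdiff_ccirc => z /circ_neq0 z0; apply: cdiffM; [exact: entire_at|exact: cdiff_powV].
have gE w : g w = (fun z => derive1 f z * z^-1 ^+ n - n.+1%:R * (f z * z^-1 ^+ n.+1)) (cexp w).
  rewrite /g !mulNr cexpN cexp_natM exprVn [cexp w ^+ n.+1]exprS !exprVn; congr (_ - _).
    by field; rewrite ?expf_neq0 ?cexp_neq0.
  by rewrite exprS.
have ceq : (fun t : R => g (rc 0 + rc t * ci)) = (fun t : R =>
    (fun z => derive1 f z * z^-1 ^+ n - n.+1%:R * (f z * z^-1 ^+ n.+1)) (cexp (rc 0 + rc t * ci))).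
  by apply/funext => t; rewrite gE.
have c3 : ccirc (fun z => n.+1%:R * (f z * z^-1 ^+ n.+1)) 0.
  apply: cdiff_ccirc => z /circ_neq0 z0; apply: cdiffM; first exact: cdiff_cst.
  by apply: cdiffM; [exact: entire_at|exact: cdiff_powV].
have cg (x : R) : rcont (fun t => g (rc 0 + rc t * ci)) x.
  rewrite ceq; apply: (ccirc_rcont (F := fun z => derive1 f z * z^-1 ^+ n - n.+1%:R * (f z * z^-1 ^+ n.+1))).
  by move=> z z1; apply: ccontB; [exact: c1|exact: c3].
have := Int_path (pi2_ge0 R) (fun x _ => dG _) cg.
have -> : G (rc 0 + rc (2 * pi) * ci) = G (rc 0 + rc 0 * ci).
  rewrite /G rc0 mul0r addr0 add0r (mulrC _ ci) !mulNr !cexpN !cexp_natM.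
  by rewrite cexp_2pi cexp0.
rewrite subrr => /eqP; rewrite mulf_eq0 -[_ == 0 in X in _ || X]cabs_eq0 cabs_ci oner_eq0 orbF.
have -> : Int (fun t : R => g (rc 0 + rc t * ci)) 0 (2 * pi) =
   cint (fun z => derive1 f z * z^-1 ^+ n - n.+1%:R * (f z * z^-1 ^+ n.+1)) 0.
  by rewrite ceq.
rewrite cintB// cintZ// subr_eq0 => /eqP E.
by rewrite /coef E; ring.
Qed.

Lemma coef_derive1n f n : entire f -> coef f n * n`!%:R = derive1n n f 0.
Proof.
elim: n f => [|n ih] f fe; first by rewrite fact0 mulr1 coef0E.
rewrite -derive1n_derive1 -ih; last exact: entire_derive1_entire.
by rewrite coef_derive1// factS natrM; ring.
Qed.

Lemma taylor_coefE f n : entire f -> taylor_coef f n = coef f n.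
Proof.
by move=> fe; rewrite /taylor_coef -coef_derive1n// mulfK// pnatr_eq0 -lt0n fact_gt0.
Qed.

Lemma derive1n_shift n f z : entire f ->
  derive1n n (fun w => f (z + w)) = (fun w => derive1n n f (z + w)).
Proof.
move=> fe; elim: n => [//|n ih]; rewrite derive1nS ih.
by rewrite (@derive1_shift (derive1n n f) z (@entire_derive1n n f fe)).
Qed.

Lemma cauchy_estimate f z n (r M : R) : entire f -> 0 < r ->
  (forall w, cabs w <= cabs z + r -> cabs (f w) <= M) ->
  cabs (derive1n n f z) <= n`!%:R * (M / r ^+ n).
Proof.
move=> fe r0 fM; have fz := @entire_shift f z fe.
have -> : derive1n n f z = derive1n n (fun w => f (z + w)) 0.
  by rewrite (derive1n_shift _ _ fe) addr0.
rewrite -coef_derive1n// cabsM cabs_nat mulrC ler_wpM2l//.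
apply: coef_le => // w wr; apply: fM.
by apply: (le_trans (cabsD _ _)); rewrite wr.
Qed.

(** The candidate derivative is the Cauchy integral of the limit, to which the derivatives of the
    [F k] converge; the quadratic remainder passes to the limit because one bound [M] serves all the
    approximants used. *)
Lemma entire_limit (F : nat -> C -> C) f : (forall k, entire (F k)) ->
  (forall r e, 0 < e -> exists k, forall z, cabs z <= r -> cabs (F k z - f z) <= e) ->
  entire f.
Proof.
move=> Fe Ff.
have cf z : ccont f z.
  move=> e e0; have e3 : 0 < e / 3 by rewrite divr_gt0.
  have [k kP] := Ff (cabs z + 1) _ e3.
  have [d d0 dP] := cdiff_ccont (entire_at z (Fe k)) e3.
  exists (Num.min d 1); first by rewrite lt_min d0 ltr01.
  move=> h; rewrite lt_min => /andP[/dP h1 h2].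
  have -> : f (z + h) - f z = (F k (z + h) - F k z) - (F k (z + h) - f (z + h)) + (F k z - f z) by ring.
  have E1 : cabs (F k (z + h) - f (z + h)) <= e / 3.
    by apply: kP; apply: (le_trans (cabsD _ _)); rewrite lerD2l ltW.
  have E2 : cabs (F k z - f z) <= e / 3 by apply: kP; rewrite lerDl.
  have -> : e = e / 3 + e / 3 + e / 3 by field.
  by apply: (le_trans (cabsD _ _)); apply: lerD => //; apply: (le_trans (cabsB _ _)); apply: lerD.
apply/entire_cdiff => z; set l := coef (fun w => f (z + w)) 1; exists l.
have [k0 k0P] := Ff (cabs z + 2) _ (ltr01 : 0 < 1 :> R).
(* The 2 in [M]: on this disc [F k0] and the later [F k] both lie within 1 of [f]. *)
have [M0 M00 M0P] := entire_bounded (cabs z + 2) (Fe k0); pose M := M0 + 2.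
apply: (@cderiv_quadratic _ _ _ (2 * M) (1 / 2)); first by rewrite divr_gt0.
move=> h h2; apply/ler_addgt0Pr => e e0.
pose e' := Num.min 1 (e / 4); have e'0 : 0 < e' by rewrite lt_min ltr01 divr_gt0.
have [k kP] := Ff (cabs z + 2) _ e'0.
have kM w : cabs w <= cabs z + 2 -> cabs (F k w) <= M.
  move=> wz; have := k0P w wz; have := M0P w wz; have := kP w wz.
  rewrite le_min => /andP[a1 _] a2 a3.
  apply: (le_trans (cabs_le_dist _ (F k0 w))); apply: (le_trans (lerD a2 (cabs_triangle (f w) _ _))).
  by rewrite (cabs_subC (f w)) /M; move: a1 a3; lra.
have E1 : cabs (F k (z + h) - F k z - h * derive1 (F k) z) <= 2 * M * cabs h ^+ 2.
  apply: second_order => // w w1; apply: kM; apply: (le_trans w1).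
  by rewrite lerD2l ler1n.
have E2 : cabs (F k (z + h) - f (z + h)) <= e / 4.
  have : cabs (F k (z + h) - f (z + h)) <= e'.
    by apply: kP; have := cabsD z h; move: h2; lra.
  by rewrite le_min => /andP[].
have E3 : cabs (F k z - f z) <= e / 4.
  have : cabs (F k z - f z) <= e' by apply: kP; rewrite lerDl.
  by rewrite le_min => /andP[].
have E4 : cabs (derive1 (F k) z - l) <= e / 4.
  have c1 : ccirc (fun w => F k (z + w) * w^-1 ^+ 1) 0.
    move=> w /circ_neq0 w0; apply: ccontM; last exact/cdiff_ccont/cdiff_powV.
    exact: ccont_shift (cdiff_ccont (entire_at (z + w) (Fe k))).
  have c2 : ccirc (fun w => f (z + w) * w^-1 ^+ 1) 0.
    move=> w /circ_neq0 w0; apply: ccontM; last exact/cdiff_ccont/cdiff_powV.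
    exact: ccont_shift (cf (z + w)).
  rewrite (derive1_coef _ (Fe k)) /l /coef -mulrBr -cintB//.
  rewrite cabsM cabs_rc gtr0_norm ?invr_gt0 ?pi2_gt0// mulrC.
  rewrite ler_pdivrMr ?pi2_gt0//; apply: cint_le => [w w1|w].
    by apply: ccontB; [exact: c1|exact: c2].
  rewrite expR0 => w1; rewrite -mulrBl cabsM expr1 cabsV w1 invr1 mulr1.
  have : cabs (F k (z + w) - f (z + w)) <= e'.
    by apply: kP; apply: (le_trans (cabsD _ _)); rewrite w1 lerD2l ler1n.
  by rewrite le_min => /andP[].
have -> : f (z + h) - f z - h * l = (F k (z + h) - F k z - h * derive1 (F k) z) -
  (F k (z + h) - f (z + h)) + ((F k z - f z) + h * (derive1 (F k) z - l)) by ring.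
have E5 : cabs (h * (derive1 (F k) z - l)) <= e / 4.
  rewrite cabsM; apply: le_trans E4; rewrite ler_piMl ?cabs_ge0//.
  by move: h2; lra.
have -> : 2 * M * cabs h ^+ 2 + e = 2 * M * cabs h ^+ 2 + e / 2 + (e / 4 + e / 4) by field.
apply: (le_trans (cabsD _ _)); apply: lerD.
  apply: (le_trans (cabsB _ _)); apply: lerD => //; apply: (le_trans E2).
  by move: e0; lra.
by apply: (le_trans (cabsD _ _)); exact: lerD.
Qed.
End EntireFunctions.

(** * The operator [phi(D)] on entire functions and on exponentials *)

Section DifferentialOperator.
Variable R : realType.
Notation C := (Cplx R).
Implicit Types (f g : C -> C) (r M : R) (z : C).

Lemma derive1D f g : entire f -> entire g ->
  derive1 (fun z => f z + g z) = (fun z => derive1 f z + derive1 g z).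
Proof.
move=> fe ge; apply/funext => z; apply: cderiv_derive1.
by apply: cderivD; exact: entire_derive1.
Qed.

Lemma derive1Z (c : C) f : entire f -> derive1 (fun z => c * f z) = (fun z => c * derive1 f z).
Proof.
by move=> fe; apply/funext => z; apply: cderiv_derive1; apply: cderivZ; exact: entire_derive1.
Qed.

Lemma derive1nD n f g : entire f -> entire g ->
  derive1n n (fun z => f z + g z) = (fun z => derive1n n f z + derive1n n g z).
Proof.
move=> fe ge; elim: n => [//|n ih]; rewrite !derive1nS ih.
exact: (@derive1D (derive1n n f) (derive1n n g) (entire_derive1n fe) (entire_derive1n ge)).
Qed.

Lemma derive1nZ n (c : C) f : entire f -> derive1n n (fun z => c * f z) = (fun z => c * derive1n n f z).
Proof.
move=> fe; elim: n => [//|n ih]; rewrite !derive1nS ih.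
exact: (@derive1Z c (derive1n n f) (entire_derive1n fe)).
Qed.

Lemma derive1n_exp n (l : C) : derive1n n (fun z => cexp (l * z)) = (fun z => l ^+ n * cexp (l * z)).
Proof.
elim: n => [|n ih]; first by apply/funext => z; rewrite derive1n0 expr0 mul1r.
rewrite derive1nS ih; apply/funext => z; apply: cderiv_derive1.
have d1 : cderiv (fun w => l * w) z (l * 1) by exact: cderivZ (cderiv_id _).
have := cderivZ (l ^+ n) (cderiv_comp d1 (cderiv_cexp (l * z))).
by rewrite mulr1 mulrA -exprSr.
Qed.

(** Cauchy's inequality on the circle of radius [(n + 1) / B], almost the optimal one and never 0,
    together with [n! <= (n + 1)^n]. The factorial on the left is there to absorb that of the Cauchy
    estimate of an [n]-th derivative. *)
Lemma exp_type_coef_le (phi : C -> C) : entire phi -> exponential_type phi ->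
  exists A c : R, [/\ 0 < A, 0 < c &
    forall n, cabs (taylor_coef phi n) * n`!%:R <= A * c ^+ n].
Proof.
move=> pe [A [B [A0 B0 AB]]]; exists (A * expR 1), (expR 1 * B).
split=> [||n]; rewrite ?mulr_gt0 ?expR_gt0// taylor_coefE//.
have r0 : 0 < n.+1%:R / B by rewrite divr_gt0.
have := @coef_le _ phi n (n.+1%:R / B) (A * expR n.+1%:R) pe r0 _.
have -> : expR n.+1%:R = expR 1 * expR 1 ^+ n :> R by rewrite -exprS -expRM_natl mulr1.
move=> /(_ _)/le_trans H; have F : n`!%:R <= n.+1%:R ^+ n :> R.
  rewrite -natrX ler_nat; elim: n {r0 H} => [//|n ih].
  rewrite factS expnS; apply: leq_mul => //; apply: (leq_trans ih).
  by case: n {ih} => // n; rewrite leq_exp2r.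
have n0 : 0 < n.+1%:R ^+ n :> R by rewrite exprn_gt0.
rewrite -ler_pdivlMr; last by rewrite ltr0n fact_gt0.
apply: H => [z zr|].
  apply: (le_trans (AB z)); rewrite zr mulrCA divff ?gt_eqF// mulr1.
  by rewrite -exprS -expRM_natl mulr1.
rewrite ler_pdivlMr ?ltr0n ?fact_gt0// expr_div_n exprMn invf_div.
have -> : A * (expR 1 * expR 1 ^+ n) * (B ^+ n / n.+1%:R ^+ n) * n`!%:R =
  A * expR 1 * (expR 1 ^+ n * B ^+ n) * (n`!%:R / n.+1%:R ^+ n) by ring.
rewrite ler_piMr ?ler_pdivrMr ?mul1r//.
by rewrite !mulr_ge0 ?exprn_ge0 ?expR_ge0// ltW.
Qed.

Variables (phi : C -> C) (A c : R).
Hypotheses (phi_entire : entire phi) (c0 : 0 < c).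
Hypothesis phi_le : forall n, cabs (taylor_coef phi n) * n`!%:R <= A * c ^+ n.
Notation T := (diffop phi).

(** The Cauchy estimate at radius [2 c] bounds the [n]-th derivative by [n! M / (2 c)^n]; against
    [phi_le] this leaves [A M / 2^n]. *)
Lemma diffop_approx f r M z N : entire f ->
  (forall w, cabs w <= r + 2 * c -> cabs (f w) <= M) -> cabs z <= r ->
  cabs (T f z - \sum_(n < N) taylor_coef phi n * derive1n n f z) <= 2 * (A * M) * 2^-1 ^+ N.
Proof.
move=> fe fM zr; apply: geometric_series => n; rewrite cabsM.
have c20 : 0 < 2 * c by rewrite mulr_gt0.
have := @cauchy_estimate _ f z n (2 * c) M fe c20 _ => /(_ _)H.
have {}H : cabs (derive1n n f z) <= n`!%:R * (M / (2 * c) ^+ n).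
  by apply: H => w wz; apply: fM; apply: (le_trans wz); rewrite lerD2r.
have M0 : 0 <= M.
  by apply: le_trans (fM z _); rewrite ?cabs_ge0// (le_trans zr)// lerDl ltW.
apply: (le_trans (ler_wpM2l (cabs_ge0 _) H)).
rewrite (mulrA (cabs _)); apply: (@le_trans _ _ (A * c ^+ n * (M / (2 * c) ^+ n))).
  by rewrite ler_wpM2r// divr_ge0// exprn_ge0// ltW.
rewrite le_eqVlt; apply/orP; left; apply/eqP; rewrite exprMn exprVn; field.
by rewrite !expf_neq0//= ?gt_eqF// pnatr_eq0.
Qed.

Lemma diffop_le f r M z : entire f -> (forall w, cabs w <= r + 2 * c -> cabs (f w) <= M) ->
  cabs z <= r -> cabs (T f z) <= 2 * A * M.
Proof.
move=> fe fM zr; have := @diffop_approx f r M z 0 fe fM zr.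
by rewrite big_ord0 subr0 expr0 mulr1 mulrA.
Qed.

Lemma half_pow_le (K e : R) : 0 < e -> exists N0, forall N, (N0 <= N)%N -> K * 2^-1 ^+ N <= e.
Proof.
move=> e0; have K0 : 0 < `|K| + 1 by rewrite ltr_wpDl.
have [N0 N0P] := half_pow_small (divr_gt0 e0 K0).
exists N0 => N NN; apply: (@le_trans _ _ ((`|K| + 1) * 2^-1 ^+ N0)).
  apply: (@le_trans _ _ ((`|K| + 1) * 2^-1 ^+ N)).
    by rewrite ler_wpM2r ?exprn_ge0 ?invr_ge0// (le_trans (ler_norm K))// lerDl.
  by rewrite ler_wpM2l ?(ltW K0)// ler_wiXn2l ?invr_ge0 ?invf_le1 ?ler1n.
by rewrite mulrC -ler_pdivlMr// ltW.
Qed.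

Lemma diffop_unique f z l : entire f -> (forall e : R, 0 < e -> exists N0, forall N, (N0 <= N)%N ->
    cabs (l - \sum_(n < N) taylor_coef phi n * derive1n n f z) <= e) -> T f z = l.
Proof.
move=> fe lP; have [M M0 fM] := entire_bounded (cabs z + 2 * c) fe.
apply/eqP; rewrite -subr_eq0; apply/eqP; apply: (@cabs_small_eq0 _ _ 2) => // e e0.
have [N1 N1P] := lP e e0; have [N2 N2P] := half_pow_le (2 * (A * M)) e0.
pose N := maxn N1 N2; have h1 := N1P N (leq_maxl _ _); have h2 := N2P N (leq_maxr _ _).
have h3 := @diffop_approx f (cabs z) M z N fe fM (lexx _).
apply: (le_trans (cabs_triangle (\sum_(n < N) taylor_coef phi n * derive1n n f z) _ _)).
rewrite mulrC mulr_natl mulr2n; apply: lerD; first exact: le_trans h3 h2.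
by rewrite cabs_subC.
Qed.

Lemma diffop_cvg f z (e : R) : entire f -> 0 < e -> exists N0, forall N, (N0 <= N)%N ->
  cabs (T f z - \sum_(n < N) taylor_coef phi n * derive1n n f z) <= e.
Proof.
move=> fe e0; have [M M0 fM] := entire_bounded (cabs z + 2 * c) fe.
have [N2 N2P] := half_pow_le (2 * (A * M)) e0; exists N2 => N /N2P; apply: le_trans.
exact: (@diffop_approx f (cabs z) M z N fe fM (lexx _)).
Qed.

Lemma entire_diffop f : entire f -> entire (T f).
Proof.
move=> fe; apply: (@entire_limit _ (fun N z => \sum_(n < N) taylor_coef phi n * derive1n n f z)).
  by move=> N; apply: entire_sum => n; apply: entireZ; exact: (entire_derive1n fe).
move=> r e e0; have [M M0 fM] := entire_bounded (r + 2 * c) fe.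
have [N NP] := half_pow_le (2 * (A * M)) e0; exists N => z zr; rewrite cabs_subC.
by apply: le_trans (NP N (leqnn _)); exact: (@diffop_approx f r M z N fe fM zr).
Qed.

Lemma diffopD f g : entire f -> entire g -> T (fun z => f z + g z) = (fun z => T f z + T g z).
Proof.
move=> fe ge; apply/funext => z; apply: diffop_unique; first exact: entireD.
move=> e e0; have e2 : 0 < e / 2 by rewrite divr_gt0.
have [N1 N1P] := diffop_cvg z fe e2; have [N2 N2P] := diffop_cvg z ge e2.
exists (maxn N1 N2) => N; rewrite geq_max => /andP[/N1P h1 /N2P h2].
have -> : \sum_(n < N) taylor_coef phi n * derive1n n (fun z => f z + g z) z =
  \sum_(n < N) taylor_coef phi n * derive1n n f z + \sum_(n < N) taylor_coef phi n * derive1n n g z.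
  by rewrite -big_split; apply: eq_bigr => n _; rewrite (derive1nD _ fe ge) mulrDr.
rewrite opprD addrACA [e]splitr.
by apply: (le_trans (cabsD _ _)); exact: lerD.
Qed.

Lemma diffopZ (k : C) f : entire f -> T (fun z => k * f z) = (fun z => k * T f z).
Proof.
move=> fe; apply/funext => z; apply: diffop_unique; first exact: entireZ.
move=> e e0; have k0 : 0 < cabs k + 1 by rewrite ltr_wpDl ?cabs_ge0.
have [N1 N1P] := diffop_cvg z fe (divr_gt0 e0 k0).
exists N1 => N /N1P h1.
have -> : \sum_(n < N) taylor_coef phi n * derive1n n (fun z => k * f z) z =
  k * \sum_(n < N) taylor_coef phi n * derive1n n f z.
  by rewrite mulr_sumr; apply: eq_bigr => n _; rewrite (derive1nZ _ _ fe) mulrCA.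
rewrite -mulrBr cabsM; apply: (@le_trans _ _ ((cabs k + 1) * (e / (cabs k + 1)))).
  by apply: ler_pM; rewrite ?cabs_ge0// lerDl.
by rewrite mulrC divfK// gt_eqF.
Qed.

(** Differentiating the exponential turns the partial sums of the operator into Taylor sums of [phi]
    at [l]. *)
Lemma diffop_exp (l : C) : T (fun z => cexp (l * z)) = (fun z => phi l * cexp (l * z)).
Proof.
apply/funext => z; apply: diffop_unique; first exact: entire_expM.
move=> e e0; pose r := 2 * (cabs l + 1).
have l0 : 0 < cabs l + 1 by rewrite ltr_wpDl ?cabs_ge0.
have r0 : 0 < r by rewrite mulr_gt0.
have [M M0 fM] := entire_bounded r phi_entire.
have lr : cabs l <= r / 2 by rewrite /r mulrC mulKf// lerDl.
pose K := 2 * M * cabs (cexp (l * z)).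
have [N0 N0P] := half_pow_le K e0; exists N0 => N /N0P; apply: le_trans.
have -> : \sum_(n < N) taylor_coef phi n * derive1n n (fun z => cexp (l * z)) z =
  (\sum_(n < N) coef phi n * l ^+ n) * cexp (l * z).
  by rewrite mulr_suml; apply: eq_bigr => n _; rewrite derive1n_exp taylor_coefE// mulrA.
rewrite -mulrBl cabsM /K mulrAC ler_wpM2r ?cabs_ge0//.
have fM' w : cabs w = r -> cabs (phi w) <= M by move=> wr; apply: fM; rewrite wr.
apply: (le_trans (taylor_remainder N phi_entire r0 fM' lr)).
rewrite ler_wpM2l ?mulr_ge0 ?(ltW M0)// lerXn2r ?nnegrE ?divr_ge0 ?cabs_ge0 ?invr_ge0 ?(ltW r0)//.
by rewrite ler_pdivrMr// mulrC.
Qed.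

Lemma entire_iter_diffop N f : entire f -> entire (iter N T f).
Proof. by move=> fe; elim: N => [//|N ih]; rewrite iterS; exact: entire_diffop. Qed.

Lemma iter_diffopD N f g : entire f -> entire g ->
  iter N T (fun z => f z + g z) = (fun z => iter N T f z + iter N T g z).
Proof.
move=> fe ge; elim: N => [//|N ih]; rewrite !iterS ih.
exact: (@diffopD (iter N T f) (iter N T g) (@entire_iter_diffop N f fe) (@entire_iter_diffop N g ge)).
Qed.

Lemma iter_diffopZ N (k : C) f : entire f ->
  iter N T (fun z => k * f z) = (fun z => k * iter N T f z).
Proof.
move=> fe; elim: N => [//|N ih]; rewrite !iterS ih.
exact: (@diffopZ k (iter N T f) (@entire_iter_diffop N f fe)).
Qed.

Lemma iter_diffop_sum N (I : Type) (s : seq I) (F : I -> C -> C) :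
  (forall i, entire (F i)) ->
  iter N T (fun z => \sum_(i <- s) F i z) = (fun z => \sum_(i <- s) iter N T (F i) z).
Proof.
move=> Fe; elim: s => [|i s ih].
  have -> : (fun z => \sum_(i <- [::]) F i z) = (fun z => 0 * (fun _ => 0) z).
    by apply/funext => z; rewrite big_nil mul0r.
  rewrite (@iter_diffopZ N 0 (fun _ => 0) (@entire_cst R 0)).
  by apply/funext => z; rewrite big_nil mul0r.
have -> : (fun z => \sum_(j <- i :: s) F j z) = (fun z => F i z + (fun z => \sum_(j <- s) F j z) z).
  by apply/funext => z; rewrite big_cons.
rewrite (@iter_diffopD N (F i) (fun z => \sum_(j <- s) F j z) (Fe i) (@entire_sum _ _ s xpredT F Fe)) ih.
by apply/funext => z; rewrite big_cons.
Qed.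

Lemma iter_diffop_exp N (l : C) :
  iter N T (fun z => cexp (l * z)) = (fun z => phi l ^+ N * cexp (l * z)).
Proof.
elim: N => [|N ih]; first by apply/funext => z; rewrite expr0 mul1r.
rewrite iterS ih (diffopZ _ (@entire_expM R l)) diffop_exp.
by apply/funext => z; rewrite mulrA -exprSr.
Qed.

(** Each application of [T] costs [2 c] in the radius and a factor [2 A] in the bound. *)
Lemma iter_diffop_le N f r M z : entire f ->
  (forall w, cabs w <= r + N%:R * (2 * c) -> cabs (f w) <= M) ->
  cabs z <= r -> cabs (iter N T f z) <= (2 * A) ^+ N * M.
Proof.
move=> fe; elim: N r z => [|N ih] r z fM zr.
  by rewrite expr0 mul1r; apply: fM; rewrite mul0r addr0.
rewrite iterS exprS -mulrA; apply: (@diffop_le _ r _ _ (@entire_iter_diffop N f fe) _ zr).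
move=> w wr; apply: ih wr => v vr; apply: fM; apply: (le_trans vr).
by rewrite -natr1 mulrDl mul1r; lra.
Qed.

End DifferentialOperator.

(** * Density of exponentials whose frequencies accumulate at a point *)

Section ExponentialDensity.
Variable R : realType.
Notation C := (Cplx R).
Variable mu : nat -> C.
Hypothesis mu_neq0 : forall j, mu j != 0.
Hypothesis mu_small : forall e : R, 0 < e -> exists j, cabs (mu j) <= e.

(** Membership in the closed linear span of the exponentials with frequencies [mu j]. *)
Definition approx (f : C -> C) := forall r e : R, 0 < e -> exists J (b : nat -> C),
  forall z, cabs z <= r -> cabs (f z - \sum_(j < J) b j * cexp (mu j * z)) <= e.

Lemma approx_exp k : approx (fun z => cexp (mu k * z)).
Proof.
move=> r e e0; exists k.+1, (fun j => if j == k then 1 else 0) => z _.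
rewrite big_ord_recr /= eqxx mul1r big1 ?add0r ?subrr ?cabs0 ?ltW// => i _.
by rewrite ltn_eqF// mul0r.
Qed.

Lemma approxZ c f : approx f -> approx (fun z => c * f z).
Proof.
move=> af r e e0; have c0 : 0 < cabs c + 1 by rewrite ltr_wpDl ?cabs_ge0.
have [J [b bP]] := af r _ (divr_gt0 e0 c0).
exists J, (fun j => c * b j) => z zr.
have -> : \sum_(j < J) c * b j * cexp (mu j * z) = c * \sum_(j < J) b j * cexp (mu j * z).
  by rewrite mulr_sumr; apply: eq_bigr => j _; rewrite mulrA.
rewrite -mulrBr cabsM; apply: (@le_trans _ _ ((cabs c + 1) * (e / (cabs c + 1)))).
  by apply: ler_pM; rewrite ?cabs_ge0 ?lerDl// bP.
by rewrite mulrC divfK// gt_eqF.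
Qed.

Lemma widen_sum J N (b F : nat -> C) : (J <= N)%N ->
  \sum_(j < J) b j * F j = \sum_(j < N) (if (j < J)%N then b j else 0) * F j.
Proof.
move=> JN; rewrite (big_ord_widen N (fun j => b j * F j) JN) big_mkcond /=.
by apply: eq_bigr => j _; case: ifP => //; rewrite mul0r.
Qed.

Lemma approxD f g : approx f -> approx g -> approx (fun z => f z + g z).
Proof.
move=> af ag r e e0; have e2 : 0 < e / 2 by rewrite divr_gt0.
have [J1 [b1 P1]] := af r _ e2; have [J2 [b2 P2]] := ag r _ e2.
exists (maxn J1 J2), (fun j => (if (j < J1)%N then b1 j else 0) + (if (j < J2)%N then b2 j else 0)).
move=> z zr.
have -> : \sum_(j < maxn J1 J2) ((if (j < J1)%N then b1 j else 0) +
    (if (j < J2)%N then b2 j else 0)) * cexp (mu j * z) =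
  \sum_(j < J1) b1 j * cexp (mu j * z) + \sum_(j < J2) b2 j * cexp (mu j * z).
  rewrite (widen_sum b1 (fun j => cexp (mu j * z)) (leq_maxl J1 J2)).
  rewrite (widen_sum b2 (fun j => cexp (mu j * z)) (leq_maxr J1 J2)) -big_split /=.
  by apply: eq_bigr => j _; rewrite mulrDl.
rewrite opprD addrACA [e]splitr; apply: (le_trans (cabsD _ _)).
by apply: lerD; [exact: P1|exact: P2].
Qed.

Lemma approx_limit f : (forall r e : R, 0 < e -> exists2 g, approx g &
    forall z, cabs z <= r -> cabs (f z - g z) <= e) -> approx f.
Proof.
move=> H r e e0; have e2 : 0 < e / 2 by rewrite divr_gt0.
have [g ag fg] := H r _ e2; have [J [b bP]] := ag r _ e2.
exists J, b => z zr; apply: (le_trans (cabs_triangle (g z) _ _)).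
by rewrite [e]splitr; apply: lerD; [exact: fg|exact: bP].
Qed.

Lemma approx_sum n (c : nat -> C) (F : nat -> C -> C) : (forall k, (k < n)%N -> approx (F k)) ->
  approx (fun z => \sum_(k < n) c k * F k z).
Proof.
elim: n => [|n ih] aF.
  move=> r e e0; exists 0%N, (fun _ => 0) => z _.
  by rewrite !big_ord0 subrr cabs0 ltW.
have -> : (fun z => \sum_(k < n.+1) c k * F k z) = (fun z => (\sum_(k < n) c k * F k z) + c n * F n z).
  by apply/funext => z; rewrite big_ord_recr.
apply: approxD; first by apply: ih => k kn; apply: aF; rewrite ltnW.
by apply: approxZ; exact: aF.
Qed.

Lemma entire_cexp : entire (@cexp R).
Proof. by apply/entire_cdiff => z; eexists; exact: cderiv_cexp. Qed.

Lemma coef_cexp n : coef (@cexp R) n = (n`!%:R)^-1.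
Proof.
have fn : (n`!%:R : C) != 0 by rewrite pnatr_eq0 -lt0n fact_gt0.
apply: (mulIf fn); rewrite mulVf// (coef_derive1n n entire_cexp).
have := derive1n_exp n (1 : C).
have -> : (fun z : C => cexp (1 * z)) = (@cexp R) by apply/funext => z; rewrite mul1r.
by move=> ->; rewrite expr1n !mul1r cexp0.
Qed.

(* [z ^ k] is the limit of [k! (exp (mu z) - sum_(i < k) (mu z)^i / i!) / mu ^ k] as
   [mu] tends to [0]. *)
Lemma approx_monomial k : approx (fun z => z ^+ k).
Proof.
have [n] := ubnP k; elim: n k => // n ih k; rewrite ltnS => kn.
apply: approx_limit => r e e0.
pose r' : R := `|r| + 1; have r'0 : 0 < r' by rewrite ltr_wpDl.
have rr' : r <= r' by rewrite (le_trans (ler_norm r))// lerDl.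
have [M M0 MP] := entire_bounded 2 entire_cexp.
(* Divided by [mu^k / k!], the Taylor remainder of order [k + 1] is at most [|mu| K], which explains
   [e / K]; the bound [1 / r'] keeps [|mu z| <= 1], half of the radius 2 on which [M] is taken. *)
pose K := k`!%:R * (2 * M * (r' / 2) ^+ k.+1).
have K0 : 0 < K by rewrite !mulr_gt0 ?ltr0n ?fact_gt0 ?exprn_gt0// divr_gt0.
have d0 : 0 < Num.min (e / K) r'^-1 by rewrite lt_min divr_gt0//= invr_gt0.
have [j] := mu_small d0; rewrite le_min => /andP[jK jr].
have mj := mu_neq0 j; have mjp : 0 < cabs (mu j) by rewrite cabs_gt0.
pose c := k`!%:R / mu j ^+ k.
exists (fun z => c * (cexp (mu j * z) + (-1) * \sum_(i < k) (mu j ^+ i / i`!%:R) * z ^+ i)).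
  apply: approxZ; apply: approxD; first exact: approx_exp.
  apply: approxZ; apply: (@approx_sum k (fun i => mu j ^+ i / i`!%:R) (fun i z => z ^+ i)) => i ik.
  by apply: ih; exact: leq_trans kn.
move=> z zr.
have zr' : cabs z <= r' by exact: le_trans zr rr'.
have mz : cabs (mu j * z) <= 2 / 2.
  rewrite divff ?pnatr_eq0// cabsM; apply: (@le_trans _ _ (r'^-1 * r')).
    by apply: ler_pM; rewrite ?cabs_ge0.
  by rewrite mulVf// gt_eqF.
have M2 w : cabs w = 2 -> cabs (cexp w) <= M by move=> w2; apply: MP; rewrite w2.
have E := taylor_remainder k.+1 entire_cexp (ltr0n _ 2) M2 mz; move: E.
have kf : (k`!%:R : C) != 0 by rewrite pnatr_eq0 -lt0n fact_gt0.
have -> : cexp (mu j * z) - \sum_(i < k.+1) coef (@cexp R) i * (mu j * z) ^+ i =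
   - c^-1 * (z ^+ k - c * (cexp (mu j * z) + (-1) * \sum_(i < k) (mu j ^+ i / i`!%:R) * z ^+ i)).
  rewrite big_ord_recr /= coef_cexp.
  have -> : \sum_(i < k) coef (@cexp R) i * (mu j * z) ^+ i = \sum_(i < k) (mu j ^+ i / i`!%:R) * z ^+ i.
    by apply: eq_bigr => i _; rewrite coef_cexp exprMn; ring.
  by rewrite exprMn /c; field; rewrite kf expf_neq0.
have c_gt0 : 0 < cabs c by rewrite cabs_gt0 mulf_neq0// invr_neq0// expf_neq0.
rewrite (cabsM (- c^-1)) cabsN cabsV mulrC ler_pdivrMr// => /le_trans; apply.
have cE : cabs c = k`!%:R / cabs (mu j) ^+ k by rewrite cabsM cabs_nat cabsV cabsX.
rewrite cE cabsM.
apply: (@le_trans _ _ (2 * M * (cabs (mu j) * (r' / 2)) ^+ k.+1 * (k`!%:R / cabs (mu j) ^+ k))).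
  rewrite ler_wpM2r ?divr_ge0 ?exprn_ge0 ?cabs_ge0//.
  rewrite ler_wpM2l ?mulr_ge0 ?(ltW M0)//.
  rewrite lerXn2r ?nnegrE ?divr_ge0 ?mulr_ge0 ?cabs_ge0 ?invr_ge0 ?(ltW r'0)//.
  by rewrite -mulrA ler_wpM2l ?cabs_ge0// ler_wpM2r ?invr_ge0.
have -> : 2 * M * (cabs (mu j) * (r' / 2)) ^+ k.+1 * (k`!%:R / cabs (mu j) ^+ k) = cabs (mu j) * K.
  rewrite /K [(cabs (mu j) * _) ^+ _]exprMn [cabs (mu j) ^+ k.+1]exprS; field.
  by rewrite expf_neq0// gt_eqF.
by rewrite -ler_pdivlMr.
Qed.

Lemma approx_entire f : entire f -> approx f.
Proof.
move=> fe; apply: approx_limit => r e e0.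
pose r' : R := 2 * (`|r| + 1); have r'0 : 0 < r' by rewrite mulr_gt0// ltr_wpDl.
have rr' : r <= r' / 2 by rewrite /r' mulrC mulKf// (le_trans (ler_norm r))// lerDl.
have [M M0 MP] := entire_bounded r' fe.
have [N0 N0P] := half_pow_le (2 * M) e0.
exists (fun z => \sum_(k < N0) coef f k * z ^+ k).
  by apply: (@approx_sum N0 (coef f) (fun i z => z ^+ i)) => k _; exact: approx_monomial.
move=> z zr; apply: le_trans (N0P N0 (leqnn _)).
have M2 w : cabs w = r' -> cabs (f w) <= M by move=> w2; apply: MP; rewrite w2.
apply: (le_trans (taylor_remainder N0 fe r'0 M2 (le_trans zr rr'))).
rewrite ler_wpM2l ?mulr_ge0 ?(ltW M0)// lerXn2r ?nnegrE ?divr_ge0 ?cabs_ge0 ?invr_ge0 ?(ltW r'0)//.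
by rewrite ler_pdivrMr// mulrC (le_trans zr).
Qed.

(** Multiplication by [cexp (l * z)] moves the accumulation point from 0 to [l]. It serves with [l]
    a far point of the ray for [f] and with [l = 0] for [g]. *)
Lemma exp_dense (l : C) f (r e : R) : entire f -> 0 < e -> exists J (b : nat -> C),
  forall z, cabs z <= r -> cabs (f z - \sum_(j < J) b j * cexp ((l + mu j) * z)) <= e.
Proof.
move=> fe e0; pose E := expR (cabs l * `|r|); have E0 : 0 < E by exact: expR_gt0.
have ge : entire (fun z => f z * cexp (- l * z)) by apply: entireM; [exact: fe|exact: (@entire_expM R (- l))].
have [J [b bP]] := approx_entire ge r (divr_gt0 e0 E0).
exists J, b => z zr.
have -> : f z - \sum_(j < J) b j * cexp ((l + mu j) * z) =
   cexp (l * z) * (f z * cexp (- l * z) - \sum_(j < J) b j * cexp (mu j * z)).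
  rewrite mulrBr mulr_sumr; congr (_ - _).
    by rewrite mulNr cexpN; field; exact: cexp_neq0.
  by apply: eq_bigr => j _; rewrite mulrDl cexpD; ring.
rewrite cabsM; apply: (@le_trans _ _ (E * (e / E))); last by rewrite mulrC divfK// gt_eqF.
apply: ler_pM; rewrite ?cabs_ge0 ?bP//; apply: (le_trans (cabs_cexp_le _)).
by rewrite ler_expR cabsM ler_wpM2l ?cabs_ge0// (le_trans zr)// ler_norm.
Qed.
End ExponentialDensity.

(** * A strict Jensen inequality along a sparse sequence *)

Section SparseConvexity.
Variable R : realType.
Notation C := (Cplx R).

Lemma prod_1D_ge (m : nat) (x : 'I_m -> R) : (forall i, 0 <= x i) ->
  1 + \sum_i x i <= \prod_i (1 + x i).
Proof.
move=> x0; suff [] : 1 + \sum_i x i <= \prod_i (1 + x i) /\ 0 <= \sum_i x i by [].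
elim/big_rec2 : _ => [|i P S _ [ih S0]]; first by rewrite addr0.
have xi := x0 i; split; last by rewrite addr_ge0.
apply: (@le_trans _ _ ((1 + x i) * (1 + P))); last by rewrite ler_wpM2l// addr_ge0.
have -> : (1 + x i) * (1 + P) = 1 + (x i + P) + x i * P by ring.
by rewrite lerDl mulr_ge0.
Qed.

(** The bound [(1 + y)^m <= 1 / (1 - m y)] without a division. *)
Lemma bernoulli_upper (m : nat) (y : R) : 0 <= y -> m%:R * y <= 1 -> (1 + y) ^+ m * (1 - m%:R * y) <= 1.
Proof.
move=> y0; elim: m => [|m ih] my; first by rewrite expr0 mul0r subr0 mulr1.
have my' : m%:R * y <= 1 by apply: le_trans my; rewrite ler_wpM2r// ler_nat.
apply: le_trans (ih my'); rewrite exprSr -mulrA ler_wpM2l ?exprn_ge0 ?addr_ge0//.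
have : 0 <= m%:R * y * y by rewrite !mulr_ge0.
have yy : 0 <= y * y by rewrite mulr_ge0.
by rewrite -natr1 => h; nra.
Qed.

(* The exponent [p >= 2] makes [h] strictly convex to leading order, and the nodes
   [s0 q ^ j] are so sparse that Jensen's inequality survives the error term. *)
Lemma sparse_jensen (m p : nat) (h : R -> R) (K s1 d : R) : (0 < m)%N -> (1 < p)%N ->
  0 <= K -> 0 < s1 -> 0 < d ->
  (forall s, 0 <= s <= s1 -> `|h s - 1 - s ^+ p| <= K * s ^+ p.+1) ->
  exists s0 q : R, [/\ 0 < s0 <= d, 0 < q < 1 &
    forall t : 'I_m -> nat, (exists i i', t i != t i') ->
    h ((\sum_i s0 * q ^+ t i) / m%:R) ^+ m < \prod_i h (s0 * q ^+ t i)].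
Proof.
move=> m0 p1 K0 s10 d0 hP.
have m1 : 1 <= m%:R :> R by rewrite ler1n.
have mp : 0 < m%:R :> R by rewrite ltr0n.
(* [ta] is the relative error granted to the approximation of [h s - 1] by [s ^+ p]. With
   [1 / m = 16 ta] and [q m = 4 ta], the gain [1 - k / m >= 16 ta] obtained below pays for the
   sparsity error [q] and for the factors [1 + ta] and [1 - ta]. *)
pose ta : R := (16 * m%:R)^-1; have ta0 : 0 < ta by rewrite invr_gt0 mulr_gt0.
have ta1 : ta <= 16^-1 by rewrite lef_pV2 ?posrE ?mulr_gt0// ler_peMr.
have tam : ta * (16 * m%:R) = 1 by rewrite mulVf// gt_eqF// mulr_gt0.
pose q : R := (4 * m%:R ^+ 2)^-1; have q0 : 0 < q by rewrite invr_gt0 mulr_gt0// exprn_gt0.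
have qm : q * (4 * m%:R ^+ 2) = 1 by rewrite mulVf// gt_eqF// mulr_gt0// exprn_gt0.
have q1 : q < 1 by rewrite invf_lt1 ?mulr_gt0 ?exprn_gt0//; nra.
pose s0 := Num.min (Num.min d s1) (Num.min (ta / m%:R) (ta / (K + 1))).
have K1 : 0 < K + 1 by rewrite ltr_wpDl.
have s00 : 0 < s0 by rewrite !lt_min d0 s10 !divr_gt0.
have [s0d s0s s0m s0K] : [/\ s0 <= d, s0 <= s1, s0 <= ta / m%:R & s0 <= ta / (K + 1)].
  by rewrite /s0 !ge_min !lexx ?orbT.
have s01 : s0 <= 1.
  by apply: (le_trans s0m); rewrite ler_pdivrMr// mul1r; lra.
have Ks0 : K * s0 <= ta.
  apply: (@le_trans _ _ ((K + 1) * s0)); first by rewrite ler_wpM2r ?lerDl// ltW.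
  by rewrite mulrC -ler_pdivlMr.
exists s0, q; split; [by rewrite s00|by rewrite q0|move=> t [i [i' tii']]].
have [i0 i0P] : exists i0, forall j, (t i0 <= t j)%N.
  by case: (@arg_minnP _ i xpredT t isT) => i0 _ i0P; exists i0 => j; exact: i0P.
have [i1 i1P] : exists i1, t i1 != t i0.
  by have [E|] := eqVneq (t i) (t i0); [exists i'; rewrite -E eq_sym|exists i].
(* [k] counts the entries equal to the largest node, the one of least index. The tuple is not
   constant, so [k <= m - 1]; every other entry is at most [q] times the largest. *)
pose k : R := \sum_j (t j == t i0)%:R.
have k1 : 1 <= k by rewrite /k (bigD1 i0)//= eqxx lerDl sumr_ge0.
have km : k <= m%:R - 1.
  rewrite /k (bigD1 i1)//= (negbTE i1P) add0r lerBrDr.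
  have -> : m%:R = \sum_(j : 'I_m) 1 :> R by rewrite sumr_const card_ord.
  rewrite [X in _ <= X](bigD1 i1)//= [leRHS]addrC lerD2r.
  by apply: ler_sum => j _; case: (_ == _).
pose S := s0 * q ^+ t i0.
have S0 : 0 < S by rewrite mulr_gt0// exprn_gt0.
have Ss0 : S <= s0 by rewrite ler_piMr ?(ltW s00)// exprn_ile1// ltW.
have sj j : 0 < s0 * q ^+ t j by rewrite mulr_gt0// exprn_gt0.
have sjS j : s0 * q ^+ t j <= s0 by rewrite ler_piMr ?(ltW s00)// exprn_ile1// ltW.
have up j : s0 * q ^+ t j <= S * ((t j == t i0)%:R + q).
  have [->|tj] := eqVneq (t j) (t i0); first by rewrite -/S mulrDr mulr1 lerDl mulr_ge0// ltW.
  rewrite add0r /S -mulrA -exprSr ler_wpM2l ?(ltW s00)//.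
  by rewrite ler_wiXn2l ?(ltW q0) ?(ltW q1)// ltn_neqAle eq_sym tj i0P.
have lo j : S ^+ p * (t j == t i0)%:R <= (s0 * q ^+ t j) ^+ p.
  have [->|tj] := eqVneq (t j) (t i0); first by rewrite -/S mulr1.
  by rewrite mulr0 exprn_ge0// ltW.
set A := (\sum_j s0 * q ^+ t j) / m%:R.
pose ka := k / m%:R.
have kaE : ka * m%:R = k by rewrite /ka divfK// gt_eqF.
have A0 : 0 < A.
  rewrite divr_gt0// (bigD1 i0)//= ltr_pwDl// sumr_ge0// => j _; exact: ltW.
have AS : A <= S * (ka + q).
  rewrite ler_pdivrMr// -mulrA mulrDl kaE.
  have -> : k + q * m%:R = \sum_j ((t j == t i0)%:R + q).
    by rewrite big_split /= sumr_const card_ord mulr_natr.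
  by rewrite mulr_sumr ler_sum.
have ka1 : 1 <= ka * m%:R by rewrite kaE.
have kam : (1 - ka) * m%:R >= 1 by rewrite mulrBl kaE mul1r; lra.
have ka0 : 0 < ka by rewrite divr_gt0// (lt_le_trans ltr01).
have qmm : q * m%:R * (4 * m%:R) = 1 by rewrite -[RHS]qm; ring.
have qlem : q * m%:R <= 4^-1 by nra.
have qkle : q <= ka * (m%:R * q).
  by rewrite mulrA -{1}[q]mul1r ler_wpM2r// ltW.
have ta8 : ta * 8 = q * m%:R + q * m%:R.
  have -> : q * m%:R = ta * 4.
    by apply: (@mulIf _ (4 * m%:R)); [rewrite gt_eqF// mulr_gt0|rewrite qmm -[LHS]tam; ring].
  by ring.
have kaq1 : ka + q <= 1 by nra.
(* The square suffices: [ka + q <= 1], so its power [p >= 2] is no larger. *)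
have key : (ka + q) ^+ 2 <= ka * (1 - 8 * ta).
  have inv : m%:R^-1 = 16 * ta by rewrite /ta invfM mulrA divff ?mul1r// pnatr_eq0.
  have h1 : ka <= 1 - 16 * ta.
    by rewrite -inv -(ler_pM2r mp) mulrBl mulVf ?gt_eqF// mul1r kaE.
  have h2 : q * (ka + q) <= q by rewrite ler_piMr ?(ltW q0).
  have h3 : q <= q * m%:R by rewrite ler_peMr ?(ltW q0).
  have h4 : ka * (ka + q) <= ka * (1 - 16 * ta + q) by rewrite ler_wpM2l ?(ltW ka0)// lerD2r.
  have h5 : ka * (1 - 16 * ta + q) + ka * (m%:R * q) <= ka * (1 - 8 * ta).
    rewrite -mulrDr ler_wpM2l ?(ltW ka0)//.
    by rewrite (mulrC m%:R); lra.
  have -> : (ka + q) ^+ 2 = ka * (ka + q) + q * (ka + q) by ring.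
  by lra.
have AleS : A <= S by apply: (le_trans AS); rewrite ler_piMr// ltW.
have hup s : 0 <= s <= s0 -> h s <= 1 + s ^+ p * (1 + ta).
  move=> /andP[sa sb]; have := hP s; rewrite sa (le_trans sb s0s) => /(_ isT).
  rewrite ler_norml => /andP[_ hs].
  have : K * s ^+ p.+1 <= s ^+ p * ta.
    rewrite exprSr mulrCA ler_wpM2l ?exprn_ge0// (le_trans _ Ks0)// ler_wpM2l//.
  by lra.
have hlo s : 0 <= s <= s0 -> 1 + s ^+ p * (1 - ta) <= h s.
  move=> /andP[sa sb]; have := hP s; rewrite sa (le_trans sb s0s) => /(_ isT).
  rewrite ler_norml => /andP[hs _].
  have : K * s ^+ p.+1 <= s ^+ p * ta.
    rewrite exprSr mulrCA ler_wpM2l ?exprn_ge0// (le_trans _ Ks0)// ler_wpM2l//.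
  by lra.
pose Z := S ^+ p * k.
have Sp0 : 0 < S ^+ p by rewrite exprn_gt0.
have Z0 : 0 < Z by rewrite mulr_gt0// (lt_le_trans ltr01).
have Zta : Z <= ta.
  apply: (@le_trans _ _ (s0 * m%:R)); last by rewrite -ler_pdivlMr.
  apply: ler_pM; rewrite ?(ltW Sp0)//; [by lra| |by lra].
  apply: (le_trans _ Ss0); rewrite -{2}[S]expr1 ler_wiXn2l ?(ltW S0)//.
  - by rewrite (le_trans Ss0).
  - exact: ltnW.
pose y := A ^+ p * (1 + ta).
have y0 : 0 <= y by rewrite mulr_ge0 ?exprn_ge0 ?(ltW A0)// addr_ge0// ltW.
have myZ : m%:R * y <= Z * ((1 - 8 * ta) * (1 + ta)).
  have E1 : A ^+ p <= S ^+ p * (ka * (1 - 8 * ta)).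
    apply: (@le_trans _ _ ((S * (ka + q)) ^+ p)).
      by rewrite lerXn2r ?nnegrE ?(ltW A0)// mulr_ge0 ?addr_ge0// ltW.
    rewrite exprMn ler_wpM2l ?(ltW Sp0)//; apply: le_trans key.
    by rewrite ler_wiXn2l// addr_ge0// ltW.
  have E2 : 0 <= m%:R * (1 + ta) by rewrite mulr_ge0// addr_ge0// ltW.
  have E3 : m%:R * y = A ^+ p * (m%:R * (1 + ta)) by rewrite /y; ring.
  have E4 : Z * ((1 - 8 * ta) * (1 + ta)) = S ^+ p * (ka * (1 - 8 * ta)) * (m%:R * (1 + ta)).
    by rewrite /Z -kaE; ring.
  by rewrite E3 E4 ler_wpM2r.
have rhs : 1 + (1 - ta) * Z <= \prod_j h (s0 * q ^+ t j).
  apply: (@le_trans _ _ (\prod_j (1 + (s0 * q ^+ t j) ^+ p * (1 - ta)))).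
    apply: le_trans (prod_1D_ge _); last first.
      by move=> j; rewrite mulr_ge0 ?exprn_ge0 ?(ltW (sj _))//; lra.
    have e1 : 0 <= 1 - ta by lra.
    have e2 : Z <= \sum_j (s0 * q ^+ t j) ^+ p by rewrite /Z /k mulr_sumr ler_sum.
    by rewrite lerD2l -mulr_suml mulrC ler_wpM2r.
  apply: ler_prod => j _; rewrite hlo ?(ltW (sj _)) ?sjS//= andbT.
  by rewrite addr_ge0// mulr_ge0 ?exprn_ge0 ?(ltW (sj _))//; lra.
have hA0 : 0 <= h A.
  apply: le_trans (hlo A _); last by rewrite (ltW A0) (le_trans AleS).
  by rewrite addr_ge0// mulr_ge0 ?exprn_ge0 ?(ltW A0)//; lra.
apply: lt_le_trans rhs; apply: (@le_lt_trans _ _ ((1 + y) ^+ m)).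
  rewrite lerXn2r ?nnegrE ?addr_ge0//; apply: hup.
  by rewrite (ltW A0) (le_trans AleS).
have my1 : m%:R * y < 1 by nra.
have pos : 0 < 1 - m%:R * y by lra.
(* After multiplication by [1 - m y], it remains to see that [m y (1 + (1 - ta) Z) < (1 - ta) Z]. As
   [Z <= ta], this follows from [(1 - 8 ta) (1 + ta)^2 < 1 - ta]. *)
rewrite -(ltr_pM2r pos); apply: (le_lt_trans (bernoulli_upper y0 (ltW my1))).
have f1 : m%:R * y * (1 + (1 - ta) * Z) <= Z * ((1 - 8 * ta) * (1 + ta)) * (1 + ta).
  by apply: ler_pM => //; [rewrite mulr_ge0// ltW|nra|nra].
have f2 : Z * ((1 - 8 * ta) * (1 + ta)) * (1 + ta) < Z * (1 - ta).
  rewrite -mulrA ltr_pM2l//; nra.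
by nra.
Qed.
End SparseConvexity.

(** * Nodes near 0 along which [log |phi|] is strictly convex *)

Section Nodes.
Variable R : realType.
Notation C := (Cplx R).

(** If every coefficient of index at least 2 vanished, the Taylor remainder would force
    [psi = 1]. *)
Lemma first_nonlinear_coef (psi : C -> C) : entire psi -> coef psi 0 = 1 -> coef psi 1 = 0 ->
  ~ (forall z, psi z = 1) ->
  exists p : nat, [/\ (1 < p)%N, coef psi p != 0 & forall j, (1 < j < p)%N -> coef psi j = 0].
Proof.
move=> pe p0 p1 np.
have ex : exists p, (1 < p)%N && (coef psi p != 0).
  apply: contrapT => nex; apply: np => z.
  have cz j : (1 < j)%N -> coef psi j = 0.
    by move=> j1; apply/eqP; apply: contrapT => cj; apply: nex; exists j; rewrite j1; apply/negP.
  apply/eqP; rewrite -subr_eq0; apply/eqP; apply: (@cabs_small_eq0 _ _ 1) => // e e0.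
  pose r : R := 2 * (cabs z + 1); have r0 : 0 < r by rewrite mulr_gt0// ltr_wpDl ?cabs_ge0.
  have [M M0 fM] := entire_bounded r pe.
  have [N NP] := half_pow_le (2 * M) e0.
  have zr : cabs z <= r / 2 by rewrite /r mulrC mulKf// lerDl.
  have fM' w : cabs w = r -> cabs (psi w) <= M by move=> wr; apply: fM; rewrite wr.
  have := taylor_remainder N.+2 pe r0 fM' zr.
  rewrite 2!big_ord_recl /= p0 p1 expr0 mulr1 mul0r add0r big1 ?addr0; last first.
    by move=> i _; rewrite cz ?mul0r.
  rewrite mulr1 => /le_trans; apply; apply: le_trans (NP N.+2 _); last by rewrite !leqW.
  rewrite ler_wpM2l ?mulr_ge0 ?(ltW M0)//.
  rewrite lerXn2r ?nnegrE ?divr_ge0 ?cabs_ge0 ?invr_ge0 ?(ltW r0)//.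
  by rewrite ler_pdivrMr// mulrC.
case: (ex_minnP ex) => p /andP[pp cp] pmin; exists p; split=> // j /andP[j1 jp].
apply/eqP; apply: contrapT => cj; have := pmin j; rewrite j1 /=.
by move/negP: cj => -> /(_ isT); rewrite leqNgt jp.
Qed.

(* Dividing [phi] by [phi 0 * exp (a z)] removes the linear term of its logarithm and
   changes both sides of the inequality by the same factor. *)
Lemma convexity_nodes (phi : C -> C) (m : nat) (d : R) : entire phi -> phi 0 != 0 ->
  ~ (exists a c : C, forall z, phi z = c * cexp (a * z)) -> (0 < m)%N -> 0 < d ->
  exists mu : nat -> C, [/\ forall j, mu j != 0, forall j, cabs (mu j) <= d,
    forall e : R, 0 < e -> exists j, cabs (mu j) <= e &
    forall t : 'I_m -> nat, (exists i i', t i != t i') ->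
      cabs (phi (\sum_i mu (t i) / m%:R)) ^+ m < \prod_i cabs (phi (mu (t i)))].
Proof.
move=> pe p0 np m0 d0.
pose a := derive1 phi 0 / phi 0; pose psi z := (phi 0)^-1 * (phi z * cexp (- a * z)).
have psie : entire psi.
  by apply: entireZ; apply: entireM; [exact: pe|exact: (@entire_expM R (- a))].
have phiE z : phi z = phi 0 * cexp (a * z) * psi z.
  by rewrite /psi mulNr cexpN; field; rewrite p0 cexp_neq0.
have psi0 : coef psi 0 = 1 by rewrite (coef0E psie) /psi mulr0 cexp0 mulr1 mulVf.
have psi1 : coef psi 1 = 0.
  rewrite (coef1E psie); apply: cderiv_derive1.
  have d1 : cderiv (fun z => - a * z) 0 (- a * 1) by exact: cderivZ (cderiv_id _).
  have := cderivZ (phi 0)^-1 (cderivM (entire_derive1 pe 0) (cderiv_comp d1 (cderiv_cexp _))).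
  rewrite mulr0 cexp0 !mulr1 mul1r.
  by have -> : (phi 0)^-1 * (phi 0 * - a + derive1 phi 0) = 0 by rewrite /a; field.
have npsi : ~ forall z, psi z = 1.
  by move=> psi1'; apply: np; exists a, (phi 0) => z; rewrite phiE psi1' mulr1.
have [p [p1 cp pmin]] := first_nonlinear_coef psie psi0 psi1 npsi.
have p_gt0 : (0 < p)%N by exact: ltnW.
(* This direction makes the leading term real and positive: at [s v] the term of degree [p] is
   exactly [s^p]. *)
have [v vp] := C_root (coef psi p)^-1 p_gt0.
have v0 : v != 0.
  by apply: contraTneq cp => vE; move: vp; rewrite vE expr0n gtn_eqF// => /esym/eqP; rewrite invr_eq0 => /eqP ->; rewrite eqxx.
have vp0 : 0 < cabs v by rewrite cabs_gt0.
have [M M0 psiM] := entire_bounded 1 psie.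
pose h s := cabs (psi (rc s * v)).
pose K := 2 * M * cabs v ^+ p.+1.
have K0 : 0 <= K by rewrite !mulr_ge0 ?exprn_ge0 ?cabs_ge0 ?(ltW M0).
(* Then [|s v| <= 1 / 2], the range of the remainder estimate from the unit circle. *)
pose s1 := (2 * cabs v)^-1; have s10 : 0 < s1 by rewrite invr_gt0 mulr_gt0.
have hP s : 0 <= s <= s1 -> `|h s - 1 - s ^+ p| <= K * s ^+ p.+1.
  move=> /andP[sa sb].
  have svE : cabs (rc s * v) = s * cabs v by rewrite cabsM cabs_rc ger0_norm.
  have sv : cabs (rc s * v) <= 1 / 2.
    rewrite svE mul1r; apply: (@le_trans _ _ (s1 * cabs v)); first by rewrite ler_wpM2r ?cabs_ge0.
    by rewrite /s1 invfM divfK// gt_eqF.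
  have psiM' w : cabs w = 1 -> cabs (psi w) <= M by move=> w1; apply: psiM; rewrite w1.
  have := taylor_remainder p.+1 psie ltr01 psiM' sv.
  have -> : \sum_(j < p.+1) coef psi j * (rc s * v) ^+ j = rc (1 + s ^+ p).
    rewrite big_ord_recr /= exprMn vp mulrCA divff// mulr1 rcD rc1 rcX; congr (_ + _).
    rewrite -(subnKC p1) 2!big_ord_recl /= psi0 psi1 mul0r add0r expr0 mulr1 big1 ?addr0// => i _.
    by rewrite pmin ?mul0r//= -[X in (_ < X)%N](subnKC p1) !ltnS ltn_ord.
  rewrite divr1 svE /K => E; have : `|h s - (1 + s ^+ p)| <= cabs (psi (rc s * v) - rc (1 + s ^+ p)).
    have c1 : cabs (rc (1 + s ^+ p) : C) = 1 + s ^+ p.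
      by rewrite cabs_rc ger0_norm// addr_ge0// exprn_ge0.
    rewrite ler_norml /h; apply/andP; split.
      have := cabs_le_dist (rc (1 + s ^+ p) : C) (psi (rc s * v)).
      by rewrite c1 cabs_subC; lra.
    by have := cabs_le_dist (psi (rc s * v)) (rc (1 + s ^+ p) : C); rewrite c1; lra.
  rewrite opprD addrA => /le_trans; apply; apply: (le_trans E).
  by rewrite exprMn (mulrC (s ^+ _)) mulrA.
have dv : 0 < d / cabs v by rewrite divr_gt0.
have [s0 [q [/andP[s00 s0d] /andP[q0 q1] key]]] := sparse_jensen m0 p1 K0 s10 dv hP.
have cmu j : cabs (rc (s0 * q ^+ j) * v) = s0 * q ^+ j * cabs v.
  by rewrite cabsM cabs_rc ger0_norm// mulr_ge0 ?exprn_ge0// ltW.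
exists (fun j => rc (s0 * q ^+ j) * v); split=> [j|j|e e0|t tt].
- by rewrite mulf_neq0// rc_eq0 mulf_neq0 ?expf_neq0// gt_eqF.
- rewrite cmu -ler_pdivlMr//; apply: le_trans s0d.
  by rewrite ler_piMr ?(ltW s00)// exprn_ile1// ltW.
- have qn : `|q| < 1 by rewrite ger0_norm// ltW.
  have es : 0 < e / (s0 * cabs v) by rewrite divr_gt0// mulr_gt0.
  have := cvg_expr qn => /cvgrPdist_lt/(_ _ es)[n _ /(_ n)].
  rewrite /= sub0r normrN leqnn => /(_ isT) hn; exists n; rewrite cmu.
  rewrite mulrAC mulrC -ler_pdivlMr ?mulr_gt0//; apply: ltW; apply: le_lt_trans hn.
  exact: ler_norm.
have {}key := key t tt.
set G := \sum_i _; set mean := (\sum_i s0 * q ^+ t i) / m%:R in key.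
have mR : (m%:R : C) != 0 by rewrite pnatr_eq0 -lt0n.
have GE : G = rc mean * v.
  by rewrite /G -!mulr_suml /mean rcM rcV rc_nat (big_morph _ (@rcD R) (rc0 R)) mulrAC.
have mG : m%:R * G = \sum_i rc (s0 * q ^+ t i) * v.
  by rewrite /G mulr_sumr; apply: eq_bigr => i _; rewrite mulrCA divff// mulr1.
have cphi z : cabs (phi z) = cabs (phi 0) * cabs (cexp (a * z)) * cabs (psi z).
  by rewrite {1}phiE (cabsM (phi 0 * cexp (a * z))) (cabsM (phi 0)).
rewrite cphi; under eq_bigr do rewrite cphi.
rewrite !exprMn.
rewrite !big_split /= prodr_const card_ord.
have -> : cabs (cexp (a * G)) ^+ m = \prod_i cabs (cexp (a * (rc (s0 * q ^+ t i) * v))).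
  rewrite -cabsX -cexp_natM -cabs_prod -cexp_sum -mulr_sumr -mG.
  by congr (cabs (cexp _)); ring.
rewrite GE ltr_pM2l// mulr_gt0 ?exprn_gt0 ?cabs_gt0//.
by rewrite prodr_gt0// => i _; rewrite cabs_gt0 cexp_neq0.
Qed.

End Nodes.

(** * Nonnegative sequences tending to 0 *)

Section Vanishing.
Variable R : realType.
Notation C := (Cplx R).

Definition tends0 (x : nat -> R) := forall e : R, 0 < e ->
  exists N0, forall N, (N0 <= N)%N -> x N <= e.

Lemma tends0_sum (I : finType) (P : pred I) (x : I -> nat -> R) :
  (forall i, P i -> tends0 (x i)) -> tends0 (fun N => \sum_(i | P i) x i N).
Proof.
move=> x0 e e0; pose e' := e / #|I|.+1%:R.
have e'0 : 0 < e' by rewrite divr_gt0.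
have [N0 N0P] : exists N0 : I -> nat, forall i N, P i -> (N0 i <= N)%N -> x i N <= e'.
  have H i : exists N0, forall N, P i -> (N0 <= N)%N -> x i N <= e'.
    have [Pi|nPi] := boolP (P i); last by exists 0%N.
    by have [N0 N0P] := x0 i Pi e' e'0; exists N0 => N _; exact: N0P.
  by have [F FP] := choice H; exists F => i; exact: FP.
exists (\max_i N0 i) => N NN.
apply: (@le_trans _ _ (\sum_(i | P i) e')).
  by apply: ler_sum => i Pi; apply: N0P => //; apply: leq_trans NN; exact: leq_bigmax.
rewrite sumr_const -mulr_natr /e' mulrAC ler_pdivrMr// ler_wpM2l ?(ltW e0)// ler_nat.
by rewrite (leq_trans (max_card _))// leqW.
Qed.

Lemma tends0M (K : R) (x : nat -> R) : (forall N, 0 <= x N) -> tends0 x -> tends0 (fun N => x N * K).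
Proof.
move=> xp x0 e e0; have K0 : 0 < `|K| + 1 by rewrite ltr_wpDl.
have [N0 N0P] := x0 _ (divr_gt0 e0 K0); exists N0 => N /N0P; rewrite ler_pdivlMr//.
apply: le_trans; rewrite ler_wpM2l//.
by rewrite (le_trans (ler_norm K))// lerDl.
Qed.

(** The coefficients involve [m]-th roots, so only their [m]-th powers are explicit geometric
    sequences. *)
Lemma tends0_root (x : nat -> R) (m : nat) (B th : R) : (0 < m)%N ->
  0 <= th < 1 -> (forall N, 0 <= x N) -> (forall N, x N ^+ m <= B * th ^+ N) -> tends0 x.
Proof.
move=> m0 /andP[th0 th1] xp xB e e0.
have B0 : 0 < `|B| + 1 by rewrite ltr_wpDl.
have em : 0 < e ^+ m / (`|B| + 1) by rewrite divr_gt0 ?exprn_gt0.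
have thn : `|th| < 1 by rewrite ger0_norm.
have := cvg_expr thn => /cvgrPdist_lt/(_ _ em)[N0 _ N0P].
exists N0 => N /N0P; rewrite /= sub0r normrN ger0_norm ?exprn_ge0// ltr_pdivlMr// => h.
rewrite -(ler_pXn2r m0) ?nnegrE ?(ltW e0)//; apply: (le_trans (xB N)).
apply: le_trans (ltW h); rewrite mulrC ler_wpM2l ?exprn_ge0//.
by rewrite (le_trans (ler_norm B))// lerDl.
Qed.

End Vanishing.

(** * Iterates of the operator on powers of an exponential sum *)

Section ExponentialSums.
Variable R : realType.
Notation C := (Cplx R).
Variables (phi : C -> C) (A c : R).
Hypotheses (phi_entire : entire phi) (c0 : 0 < c).
Hypothesis phi_le : forall n, cabs (taylor_coef phi n) * n`!%:R <= A * c ^+ n.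
Notation T := (diffop phi).
Variable I : finType.
Implicit Types (X kap : I -> C).

Definition expsum X kap (z : C) : C := \sum_i X i * cexp (kap i * z).

Lemma entire_expsum X kap : entire (expsum X kap).
Proof. by apply: entire_sum => i; apply: entireZ; exact: (@entire_expM R (kap i)). Qed.

(** The power is expanded over all maps from ['I_n] to the index set, without grouping equal terms;
    no multinomial coefficient appears. *)
Lemma expsumX X kap n : (fun z => expsum X kap z ^+ n) =
  (fun z => \sum_(t : {ffun 'I_n -> I}) (\prod_k X (t k)) * cexp ((\sum_k kap (t k)) * z)).
Proof.
apply/funext => z; rewrite /expsum -{1}(card_ord n) -prodr_const.
rewrite bigA_distr_bigA /=; apply: eq_bigr => t _.
by rewrite big_split /= mulr_suml cexp_sum.
Qed.

Lemma iter_diffop_expsumX N X kap n : iter N T (fun z => expsum X kap z ^+ n) =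
  (fun z => \sum_(t : {ffun 'I_n -> I}) (\prod_k X (t k)) *
     (phi (\sum_k kap (t k)) ^+ N * cexp ((\sum_k kap (t k)) * z))).
Proof.
rewrite expsumX.
rewrite (@iter_diffop_sum _ _ _ _ c0 phi_le N _ (index_enum _)
  (fun (t : {ffun 'I_n -> I}) z => (\prod_k X (t k)) * cexp ((\sum_k kap (t k)) * z))); last first.
  by move=> t; apply: entireZ; exact: (@entire_expM R (\sum_k kap (t k))).
apply/funext => z; apply: eq_bigr => t _.
rewrite (@iter_diffopZ _ _ _ _ c0 phi_le N _ _ (@entire_expM R (\sum_k kap (t k)))).
by rewrite (@iter_diffop_exp _ _ _ _ phi_entire c0 phi_le).
Qed.

End ExponentialSums.

(** * The approximation step behind the genericity argument *)

Section Approximation.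
Variable R : realType.
Notation C := (Cplx R).
Variables (phi : C -> C) (A c : R).
Hypotheses (phi_entire : entire phi) (c0 : 0 < c).
Hypothesis phi_le : forall n, cabs (taylor_coef phi n) * n`!%:R <= A * c ^+ n.
Notation T := (diffop phi).

(** A product of [k] exponentials with frequencies near [p] and of others with frequencies near 0
    has its frequency near [k p]. Continuity at finitely many multiples gives a common radius. *)
Lemma small_near_multiples (p : C) M : (forall k, (0 < k)%N -> cabs (phi (k%:R * p)) < 1) ->
  exists2 d : R, 0 < d & forall k x, (0 < k <= M)%N -> cabs x < d -> cabs (phi (k%:R * p + x)) < 1.
Proof.
move=> hp; elim: M => [|M [d d0 dP]]; first by exists 1 => // k x; case: k.
have e0 : 0 < (1 - cabs (phi (M.+1%:R * p))) / 2 by rewrite divr_gt0// subr_gt0 hp.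
have [d' d'0 d'P] := cdiff_ccont (entire_at (M.+1%:R * p) phi_entire) e0.
exists (Num.min d d'); first by rewrite lt_min d0.
move=> k x /andP[k0]; rewrite lt_min leq_eqVlt => /orP[/eqP ->|kM] /andP[h1 h2]; last first.
  by apply: dP => //; rewrite k0.
apply: (le_lt_trans (cabs_le_dist _ (phi (M.+1%:R * p)))).
by have := d'P x h2; have := hp M.+1 isT; lra.
Qed.

(** For powers [n > m] built from small frequencies only, the [m]-th power of [|phi|] must be beaten
    by a product of at least [m + 1] values of [|phi|]; this holds where [|phi|] varies little,
    because [|phi 0| > 1]. *)
Lemma bounds_near0 m : 1 < cabs (phi 0) -> exists d b : R, [/\ 0 < d, 1 < b &
  forall x, cabs x < d -> b <= cabs (phi x) /\ cabs (phi x) ^+ m < b ^+ m.+1].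
Proof.
set P := cabs (phi 0) => P1.
have P0 : 0 < P by lra.
(* With [|phi|] between [P / s] and [P s], the claim [(P s)^m < (P / s)^(m + 1)] means
   [s^(2 m + 1) < P]. The choice of [y] makes [1 - k y > 1 / P], and [bernoulli_upper] applies to
   [s = 1 + y]. *)
pose k : R := (m + m.+1)%:R; have k1 : 1 <= k by rewrite /k ler1n addnS.
pose y := (1 - P^-1) / (2 * k).
have PV : P^-1 < 1 by rewrite invf_lt1.
have y0 : 0 < y by rewrite divr_gt0 ?subr_gt0// mulr_gt0//; lra.
have ky : k * y = (1 - P^-1) / 2 by rewrite /y; field; lra.
have PV0 : 0 < P^-1 by rewrite invr_gt0.
have ky1 : k * y <= 1 by rewrite ky; lra.
pose s := 1 + y; have s1 : 1 < s by rewrite ltrDl.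
have s0 : 0 < s by lra.
have sk : s ^+ (m + m.+1) < P.
  have := bernoulli_upper (m := m + m.+1) (ltW y0) ky1; rewrite -/s -/k.
  have h1 : P^-1 < 1 - k * y by rewrite ky; lra.
  move=> h2; have h3 : s ^+ (m + m.+1) * P^-1 < 1.
    by apply: lt_le_trans h2; rewrite ltr_pM2l// exprn_gt0.
  by move: h3; rewrite ltr_pdivrMr// mul1r.
have sP : s < P.
  apply: le_lt_trans sk; rewrite -{1}[s]expr1 ler_weXn2l//; first exact: ltW.
  by rewrite addnS.
pose b := P / s; have b1 : 1 < b by rewrite ltr_pdivlMr// mul1r.
have bP : b < P by rewrite ltr_pdivrMr// ltr_pMr.
have Ps : P < P * s by rewrite ltr_pMr.
have e0 : 0 < Num.min (P - b) (P * s - P) by rewrite lt_min !subr_gt0 bP.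
have [d d0 dP] := cdiff_ccont (entire_at 0 phi_entire) e0.
exists d, b; split=> // x xd; have := dP x xd; rewrite add0r le_min => /andP[h1 h2].
have h3 := cabs_le_dist (phi 0) (phi x); have h4 := cabs_le_dist (phi x) (phi 0).
rewrite cabs_subC -/P in h3; rewrite -/P in h4.
split; first by lra.
have xP : cabs (phi x) <= P * s by lra.
apply: (@le_lt_trans _ _ ((P * s) ^+ m)).
  by rewrite lerXn2r ?nnegrE ?cabs_ge0// mulr_ge0// ltW.
rewrite /b expr_div_n ltr_pdivlMr ?exprn_gt0// exprMn -mulrA -exprD exprSr.
by rewrite ltr_pM2l// exprn_gt0.
Qed.

Lemma approximation_step (m M : nat) (f g : C -> C) (r e : R) : (0 < m)%N ->
  1 < cabs (phi 0) -> ~ (exists a k : C, forall z, phi z = k * cexp (a * z)) ->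
  (exists p, forall k, (0 < k)%N -> cabs (phi (k%:R * p)) < 1) ->
  entire f -> entire g -> 0 < e ->
  exists u N, [/\ entire u, forall z, cabs z <= r -> cabs (u z - f z) <= e,
    forall z, cabs z <= r -> cabs (iter N T (fun z => u z ^+ m) z - g z) <= e &
    forall n z, (m < n <= M)%N -> cabs z <= r -> cabs (iter N T (fun z => u z ^+ n) z) <= e].
Proof.
move=> m0 phi0 nexp [p0 p0P] fe ge e0.
(* The power [m] itself has to be covered even when [M < m]. *)
pose M' := maxn M m.
have [d1 d10 d1P] := small_near_multiples M' p0P.
have [d2 [be [d20 be1 d2P]]] := bounds_near0 m phi0.
have be0 : 0 < be by lra.
pose d := Num.min d1 d2; have d0 : 0 < d by rewrite lt_min d10.
(* Every frequency will lie within [eta] of [p0] or of 0, so a sum of at most [M'] of them stays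
   within [d] of a multiple of [p0]. *)
pose eta := d / (2 * M'.+1%:R).
have eta0 : 0 < eta by rewrite divr_gt0// mulr_gt0.
have etaM n : (n <= M'.+1)%N -> n%:R * eta < d.
  move=> nM; apply: (@le_lt_trans _ _ (M'.+1%:R * eta)).
    by rewrite ler_wpM2r ?(ltW eta0)// ler_nat.
  have -> : M'.+1%:R * eta = d / 2 by rewrite /eta invfM mulrC -mulrA -mulrA mulVf ?mulr1// pnatr_eq0.
  by rewrite ltr_pdivrMr// ltr_pMr// ltr1n.
have phi00 : phi 0 != 0 by rewrite -cabs_gt0; lra.
have [mu [mu0 mud mus muc]] := convexity_nodes phi_entire phi00 nexp m0 eta0.
pose nu j : C := rc (eta * 2^-1 ^+ j).
have nu0 j : nu j != 0 by rewrite /nu rc_eq0 mulf_neq0 ?expf_neq0 ?invr_neq0 ?pnatr_eq0// gt_eqF.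
have nuE j : cabs (nu j) = eta * 2^-1 ^+ j.
  by rewrite cabs_rc ger0_norm// mulr_ge0 ?exprn_ge0 ?invr_ge0// ltW.
have nud j : cabs (nu j) <= eta.
  by rewrite nuE ler_piMr ?(ltW eta0)// exprn_ile1 ?invr_ge0 ?invf_le1 ?ler1n.
have nus (x : R) : 0 < x -> exists j, cabs (nu j) <= x.
  by move=> x0; have [j jP] := half_pow_le eta x0; exists j; rewrite nuE jP.
have e20 : 0 < e / 2 by rewrite divr_gt0.
have [L [a aP]] := exp_dense nu0 nus p0 r fe e20.
have [J [b bP]] := exp_dense mu0 mus 0 r ge e20.
pose I : finType := ('I_L + 'I_J)%type.
pose kap (i : I) : C := match i with inl l => p0 + nu l | inr j => mu j / m%:R end.
(* Rate and constant in [|X N i|^m = B i * th i ^+ N]: coefficients near [p0] are fixed, those near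
   0 decay with [N]. *)
pose th (i : I) : R := match i with inl _ => 1 | inr j => (cabs (phi (mu j)))^-1 end.
pose B (i : I) : R := match i with inl l => cabs (a l) ^+ m | inr j => cabs (b j) end.
(* An arbitrary root, chosen anew for each [N]: only its [m]-th power enters the argument. *)
have [rt rtP] := choice (fun z : C => C_root z m0).
pose X N (i : I) : C := match i with inl l => a l | inr j => rt (b j / phi (mu j) ^+ N) end.
have XB N i : cabs (X N i) ^+ m = B i * th i ^+ N.
  case: i => [l|j] /=; first by rewrite expr1n mulr1.
  by rewrite -cabsX rtP cabsM cabsV cabsX exprVn.
have mR1 : 1 <= m%:R :> R by rewrite ler1n.
have mu_lt j : cabs (mu j) < d2.
  apply: (le_lt_trans (mud j)); have := etaM 1%N isT; rewrite mul1r => /lt_le_trans; apply.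
  by rewrite ge_min lexx orbT.
have phimu j : be <= cabs (phi (mu j)) by have [] := d2P _ (mu_lt j).
have phimu0 j : 0 < cabs (phi (mu j)) by exact: lt_le_trans (phimu j).
have th01 i : 0 <= th i <= 1.
  case: i => [l|j] /=; first by rewrite ler01 lexx.
  by rewrite invr_ge0 ltW//= invf_le1// (le_trans (ltW be1)).
(* All tuples but the constant ones of small frequency with [n = m], which rebuild the approximation
   of [g]. *)
pose bad n (t : {ffun 'I_n -> I}) := ~~ ((n == m) && [exists j, t == [ffun => inr j]]).
have kap_small (i : I) : cabs (kap i - (if i is inl _ then 1 else 0) * p0) <= eta.
  case: i => [l|j] /=; first by rewrite mul1r addrAC subrr add0r.
  rewrite mul0r subr0 cabsM cabsV cabs_nat; apply: le_trans (mud j).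
  by rewrite ler_pdivrMr ?(lt_le_trans ltr01)// ler_peMr ?cabs_ge0.
(* [s] counts the factors near [p0]. If [s > 0], the frequency is near [s p0], where [|phi| < 1]. If
   [s = 0] and [n > m], it is near 0 and [bounds_near0] applies. If [s = 0] and [n = m], the tuple
   is not constant and the convexity of the nodes applies. *)
have bad_lt n (t : {ffun 'I_n -> I}) : (m <= n <= M')%N -> bad n t ->
    cabs (phi (\sum_k kap (t k))) ^+ m * \prod_k th (t k) < 1.
  move=> /andP[mn nM] tbad.
  pose il (i : I) : nat := if i is inl _ then 1%N else 0%N.
  pose s := (\sum_k il (t k))%N.
  have dist : cabs (\sum_k kap (t k) - s%:R * p0) < d.
    have -> : \sum_k kap (t k) - s%:R * p0 =
        \sum_k (kap (t k) - (if t k is inl _ then 1 else 0) * p0).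
      rewrite sumrB; congr (_ - _); rewrite /s natr_sum mulr_suml.
      by apply: eq_bigr => k _; case: (t k).
    apply: (le_lt_trans (cabs_sum _ _ _)); apply: (@le_lt_trans _ _ (\sum_(k < n) eta)).
      by apply: ler_sum => k _; exact: kap_small.
    by rewrite sumr_const card_ord -mulr_natl; apply: etaM; rewrite (leq_trans nM).
  have thp : \prod_k th (t k) <= 1.
    by apply: prodr_ile1 => k _; exact: th01.
  have thp0 : 0 <= \prod_k th (t k) by apply: prodr_ge0 => k _; have /andP[] := th01 (t k).
  have [s_gt0|] := ltnP 0 s.
    have sn : (s <= n)%N.
      rewrite -[leqRHS](card_ord n) -sum1_card; apply: leq_sum => k _; rewrite /il.
      by case: (t k).
    have ph : cabs (phi (\sum_k kap (t k))) < 1.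
      rewrite -(subrKC (s%:R * p0) (\sum_k kap (t k))); apply: d1P; first by rewrite s_gt0 (leq_trans sn).
      by apply: (lt_le_trans dist); rewrite ge_min lexx.
    apply: (@le_lt_trans _ _ (cabs (phi (\sum_k kap (t k))) ^+ m)).
      by rewrite ler_piMr// exprn_ge0// cabs_ge0.
    by rewrite exprn_ilt1 ?cabs_ge0// -lt0n.
  rewrite leqn0 => /eqP s0; rewrite s0 mul0r subr0 in dist.
  have tinr k : exists j, t k = inr j.
    move: s0; rewrite /s (bigD1 k)//= => /eqP; rewrite addn_eq0 => /andP[+ _].
    by rewrite /il; case: (t k) => [//|j] _; exists j.
  have [j jP] := choice tinr.
  have -> : \prod_k th (t k) = (\prod_k cabs (phi (mu (j k))))^-1.
    by rewrite -prodfV; apply: eq_bigr => k _; rewrite jP.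
  have P0 : 0 < \prod_k cabs (phi (mu (j k))) by apply: prodr_gt0 => k _.
  rewrite ltr_pdivrMr// mul1r.
  have [nm|nm] := eqVneq n m; last first.
    have dd2 : d <= d2 by rewrite ge_min lexx orbT.
    have [_ h] := d2P _ (lt_le_trans dist dd2); apply: (lt_le_trans h).
    apply: (@le_trans _ _ (be ^+ n)).
      by rewrite ler_weXn2l ?(ltW be1)// ltn_neqAle eq_sym nm.
    rewrite -{1}(card_ord n) -prodr_const; apply: ler_prod => k _.
    by rewrite (ltW be0) phimu.
  move: t j jP tbad P0 {dist thp thp0 s s0 tinr mn nM}; rewrite {}nm => t j jP tbad P0.
  have -> : \sum_k kap (t k) = \sum_k mu (j k) / m%:R by apply: eq_bigr => k _; rewrite jP.
  apply: (muc (fun k => nat_of_ord (j k))).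
  apply: contrapT => nex; move/negP: tbad; apply; rewrite eqxx /=.
  apply/existsP; exists (j (Ordinal m0)); apply/eqP/ffunP => k; rewrite ffunE jP; congr inr.
  apply/val_inj; apply/eqP; apply: contrapT => /negP kk; apply: nex.
  by exists k, (Ordinal m0).
pose G N n (t : {ffun 'I_n -> I}) := (\prod_k X N (t k)) * phi (\sum_k kap (t k)) ^+ N.
have G0 n (t : {ffun 'I_n -> I}) : (m <= n <= M')%N -> bad n t -> tends0 (fun N => cabs (G N n t)).
  move=> nM tbad; apply: (tends0_root (m := m) (B := \prod_k B (t k))
     (th := cabs (phi (\sum_k kap (t k))) ^+ m * \prod_k th (t k))) => //.
  - rewrite bad_lt// andbT mulr_ge0 ?exprn_ge0 ?cabs_ge0//.
    by apply: prodr_ge0 => k _; have /andP[] := th01 (t k).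
  - by move=> N; exact: cabs_ge0.
  move=> N; rewrite le_eqVlt; apply/orP; left; apply/eqP.
  rewrite /G cabsM cabs_prod cabsX exprMn -prodrXl.
  under eq_bigr do rewrite XB.
  by rewrite big_split /= prodrXl exprMn -!exprM (mulnC N m); ring.
pose W n (t : {ffun 'I_n -> I}) := expR (cabs (\sum_k kap (t k)) * `|r|).
have Wz n (t : {ffun 'I_n -> I}) z : cabs z <= r -> cabs (cexp ((\sum_k kap (t k)) * z)) <= W n t.
  move=> zr; apply: (le_trans (cabs_cexp_le _)); rewrite ler_expR cabsM ler_wpM2l ?cabs_ge0//.
  by rewrite (le_trans zr)// ler_norm.
pose E n N := \sum_(t : {ffun 'I_n -> I} | bad n t) cabs (G N n t) * W n t.
have E0 n : (m <= n <= M')%N -> tends0 (E n).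
  move=> nM; apply: tends0_sum => t tbad; apply: tends0M; last exact: G0.
  by move=> N; exact: cabs_ge0.
have E_ge0 n N : 0 <= E n N.
  by apply: sumr_ge0 => t _; rewrite mulr_ge0 ?cabs_ge0// expR_ge0.
pose F (j : 'I_J) N := cabs (X N (inr j)) * expR (cabs (kap (inr j)) * `|r|).
have F0 j : tends0 (F j).
  apply: tends0M; first by move=> N; exact: cabs_ge0.
  apply: (tends0_root (m := m) (B := B (inr j)) (th := th (inr j))) => //.
  - by rewrite /= invr_ge0 (ltW (phimu0 _))/= invf_lt1// (lt_le_trans be1).
  - by move=> N; exact: cabs_ge0.
  - by move=> N; rewrite XB.
have [N1 N1P] := tends0_sum (P := xpredT) (fun j _ => F0 j) e20.
(* Summing over [n] as well gives a single [N] for all powers, since the summands are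
   nonnegative. *)
have [N2 N2P] := tends0_sum (P := fun n : 'I_M'.+1 => (m <= n)%N)
  (fun n mn => E0 n (introT andP (conj mn (ltn_ord n)))) e20.
pose N := maxn N1 N2.
have EN n : (m <= n <= M')%N -> E n N <= e / 2.
  move=> /andP[mn nM]; apply: le_trans (N2P N (leq_maxr _ _)).
  have nM' : (n < M'.+1)%N by [].
  rewrite (bigD1 (Ordinal nM'))//= lerDl; apply: sumr_ge0 => i _; exact: E_ge0.
have kapG n z : iter N T (fun z => expsum (X N) kap z ^+ n) z =
    \sum_(t : {ffun 'I_n -> I}) G N n t * cexp ((\sum_k kap (t k)) * z).
  rewrite (iter_diffop_expsumX phi_entire c0 phi_le).
  by apply: eq_bigr => t _; rewrite mulrA.
have badE n z : (m <= n <= M')%N -> cabs z <= r ->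
    cabs (\sum_(t : {ffun 'I_n -> I} | bad n t) G N n t * cexp ((\sum_k kap (t k)) * z)) <= e / 2.
  move=> nM zr; apply: le_trans (EN n nM); apply: (le_trans (cabs_sum _ _ _)).
  by apply: ler_sum => t _; rewrite cabsM ler_wpM2l ?cabs_ge0// Wz.
have mM : (m <= m <= M')%N by rewrite leqnn leq_maxr.
exists (expsum (X N) kap), N; split=> [|z zr|z zr|n z /andP[mn nM] zr].
- exact: entire_expsum.
- rewrite /expsum big_sumType /= [e]splitr cabs_subC opprD addrA.
  apply: (le_trans (cabsB _ _)); apply: lerD; first exact: aP.
  apply: le_trans (N1P N (leq_maxl _ _)); apply: (le_trans (cabs_sum _ _ _)).
  apply: ler_sum => j _; rewrite cabsM /F ler_wpM2l ?cabs_ge0//.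
  apply: (le_trans (cabs_cexp_le _)); rewrite ler_expR cabsM ler_wpM2l ?cabs_ge0//.
  by rewrite (le_trans zr)// ler_norm.
- rewrite kapG (bigID (bad m)) /= -addrA [e]splitr.
  apply: (le_trans (cabsD _ _)); apply: lerD; first exact: badE.
  pose cst_tuple (j : 'I_J) : {ffun 'I_m -> I} := [ffun => inr j].
  have inj : injective cst_tuple.
    by move=> j j' /ffunP/(_ (Ordinal m0)); rewrite !ffunE => -[].
  have -> : \sum_(t : {ffun 'I_m -> I} | ~~ bad m t) G N m t * cexp ((\sum_k kap (t k)) * z) =
     \sum_(j < J) b j * cexp ((0 + mu j) * z).
    transitivity (\sum_(t in imset cst_tuple (mem 'I_J)) G N m t * cexp ((\sum_k kap (t k)) * z)).
      apply: eq_bigl => t; rewrite /bad negbK eqxx /=.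
      by apply/existsP/imsetP => [[j /eqP ->]|[j _ ->]]; exists j.
    rewrite big_imset /=; last by move=> j j' _ _; exact: inj.
    apply: eq_bigr => j _; rewrite /G.
    have -> : \sum_k kap (cst_tuple j k) = mu j.
      under eq_bigr do rewrite ffunE.
      rewrite sumr_const card_ord -mulr_natr /= divfK// pnatr_eq0 -lt0n//.
    under eq_bigr do rewrite ffunE.
    rewrite prodr_const card_ord /= rtP divfK ?add0r// expf_neq0// -cabs_gt0.
    exact: phimu0.
  by rewrite cabs_subC; exact: bP.
- rewrite kapG (eq_bigl (bad n)); last by move=> t; rewrite /bad gtn_eqF.
  apply: (le_trans (badE n z _ zr)); first by rewrite ltnW//= (leq_trans nM)// leq_maxl.
  by rewrite ler_pdivrMr// ler_peMr ?(ltW e0)// ler1n.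
Qed.

End Approximation.

(** * A Baire category argument for entire functions *)

Section Baire.
Variable R : realType.
Notation C := (Cplx R).
Implicit Types (f g h u : C -> C) (r e : R).

(** Each [Q k] contains a whole neighbourhood of some function near any given one. A sequence of
    nested neighbourhoods, over growing discs and with halving tolerances, converges to a function
    in all of them. *)
Lemma entire_baire (Q : nat -> (C -> C) -> Prop) :
  (forall k f r e, entire f -> 0 < e -> exists u r' d, [/\ entire u, 0 < d,
     forall z, cabs z <= r -> cabs (u z - f z) <= e &
     forall h, entire h -> (forall z, cabs z <= r' -> cabs (h z - u z) <= d) -> Q k h]) ->
  exists2 F, entire F & forall k, Q k F.
Proof.
move=> H.
have step (x : nat * ((C -> C) * R * R)) : exists y : (C -> C) * R * R,
    entire x.2.1.1 -> 0 < x.2.2 ->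
    [/\ [/\ entire y.1.1, 0 < y.2 & y.2 <= x.2.2 / 2],
        [/\ x.2.1.2 <= y.1.2 & x.1%:R <= y.1.2],
        forall z, cabs z <= x.2.1.2 -> cabs (y.1.1 z - x.2.1.1 z) <= x.2.2 &
        forall h, entire h -> (forall z, cabs z <= y.1.2 -> cabs (h z - y.1.1 z) <= 2 * y.2) -> Q x.1 h].
  case: x => k [[f r] e] /=; have [[fe e0]|nfe] := pselect (entire f /\ 0 < e); last first.
    by exists (f, r, e) => fe e0; exfalso; apply: nfe.
  have [u [r' [d [ue d0 uf hQ]]]] := H k f r e fe e0.
  (* Later moves add up to at most twice the current tolerance, hence [d / 2]. The bound [e / 2]
     makes the tolerances geometric, and [k%:R] makes the discs exhaust the plane. *)
  exists (u, Num.max (Num.max r r') k%:R, Num.min (d / 2) (e / 2)) => _ _ /=; split.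
  - by rewrite lt_min !divr_gt0// ge_min lexx orbT.
  - by rewrite !le_max !lexx ?orbT.
  - exact: uf.
  - move=> h he hu; apply: hQ => // z zr.
    apply: (le_trans (hu z _)); first by rewrite !le_max zr !orbT.
    have : Num.min (d / 2) (e / 2) <= d / 2 by rewrite ge_min lexx.
    by lra.
have [S SP] := choice step.
pose s := fix s n := if n is k.+1 then S (k, s k) else ((fun _ => 0), 0, 1) : (C -> C) * R * R.
have s_ok n : entire (s n).1.1 /\ 0 < (s n).2.
  elim: n => [|n [fe e0]]; first by split=> //; exact: (@entire_cst R 0).
  by have [[]] := SP (n, s n) fe e0.
have sS n := SP (n, s n) (s_ok n).1 (s_ok n).2.
pose f n := (s n).1.1; pose r n := (s n).1.2; pose e n := (s n).2.
have fe n : entire (f n) := (s_ok n).1.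
have e0 n : 0 < e n := (s_ok n).2.
have eS n : e n.+1 <= e n / 2 by have [[_ _ h]] := sS n.
have rS n : r n <= r n.+1 by have [_ []] := sS n.
have rk n : n%:R <= r n.+1 by have [_ []] := sS n.
have fS n z : cabs z <= r n -> cabs (f n.+1 z - f n z) <= e n.
  by move=> zr; have [_ _ h _] := sS n; exact: h.
have rmono i j : (i <= j)%N -> r i <= r j.
  elim: j => [|j ih]; first by rewrite leqn0 => /eqP ->.
  by rewrite leq_eqVlt => /predU1P[->//|]; rewrite ltnS => /ih /le_trans; apply.
have egeo i j : e (i + j)%N <= e i * 2^-1 ^+ j.
  elim: j => [|j ih]; first by rewrite addn0 expr0 mulr1.
  by rewrite addnS exprSr mulrA; apply: (le_trans (eS _)); rewrite ler_wpM2r// invr_ge0.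
have tele k j z : cabs z <= r k -> cabs (f (k + j)%N z - f k z) <= 2 * e k - 2 * e k * 2^-1 ^+ j.
  move=> zr; elim: j => [|j ih]; first by rewrite addn0 subrr cabs0 expr0 mulr1 subrr.
  apply: (le_trans (cabs_triangle (f (k + j)%N z) _ _)).
  have h1 : cabs (f (k + j.+1)%N z - f (k + j)%N z) <= e k * 2^-1 ^+ j.
    by rewrite addnS; apply: le_trans (egeo k j); apply: fS; apply: (le_trans zr); rewrite rmono// leq_addr.
  by rewrite exprS; move: ih h1; lra.
have lim z : exists l : C, forall d, 0 < d -> exists N0, forall N, (N0 <= N)%N -> cabs (l - f N z) <= d.
  pose x n := f n.+1 z - f n z.
  have [n0 n0P] : exists n0, cabs z <= r n0.
    exists (Num.truncn (cabs z)).+2; apply: le_trans (rk _).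
    by rewrite ltW// truncnS_gt.
  (* The increments before [n0] are uncontrolled because [z] may be outside the discs; finitely
     many, they are absorbed in the constant. *)
  pose K := e 0%N + \sum_(i < n0) cabs (x i) * 2 ^+ i.
  have xK n : cabs (x n) <= K * 2^-1 ^+ n.
    have [nn|nn] := ltnP n n0.
      apply: (@le_trans _ _ (cabs (x n) * 2 ^+ n * 2^-1 ^+ n)).
        by rewrite -mulrA -exprMn divff ?pnatr_eq0// expr1n mulr1.
      rewrite ler_wpM2r ?exprn_ge0 ?invr_ge0// /K (bigD1 (Ordinal nn))//= addrCA lerDl.
      by rewrite addr_ge0 ?(ltW (e0 _))// sumr_ge0// => i _; rewrite mulr_ge0 ?cabs_ge0 ?exprn_ge0.
    apply: (@le_trans _ _ (e 0%N * 2^-1 ^+ n)).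
      by apply: le_trans (egeo 0%N n); apply: fS; apply: (le_trans n0P); exact: rmono.
    rewrite ler_wpM2r ?exprn_ge0 ?invr_ge0// lerDl sumr_ge0// => i _.
    by rewrite mulr_ge0 ?cabs_ge0 ?exprn_ge0.
  have gs := geometric_series xK; exists (f 0%N z + limn (series x)) => d d0.
  have [N0 N0P] := half_pow_le (2 * K) d0; exists N0 => N /N0P; apply: le_trans.
  apply: le_trans (gs N).
  have -> : \sum_(n < N) x n = f N z - f 0%N z.
    by rewrite -(big_mkord xpredT x) telescope_sumr.
  by rewrite le_eqVlt; apply/orP; left; apply/eqP; congr cabs; ring.
have [F FP] := choice lim.
have Ff k z : cabs z <= r k -> cabs (F z - f k z) <= 2 * e k.
  move=> zr; apply/ler_addgt0Pr => d d0; have [N0 N0P] := FP z d d0.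
  have := N0P (k + N0)%N (leq_addl _ _); have := tele k N0 z zr.
  have h : 0 <= 2 * e k * 2^-1 ^+ N0 by rewrite !mulr_ge0 ?(ltW (e0 k)) ?exprn_ge0 ?invr_ge0.
  move=> h1 h2; apply: (le_trans (cabs_triangle (f (k + N0)%N z) _ _)).
  by move: h h1 h2; lra.
have Fe : entire F.
  apply: (@entire_limit _ f) => // r1 d d0.
  have [N0 N0P] := half_pow_le (2 * e 0%N) d0.
  pose k := maxn N0 (Num.truncn `|r1|).+2.
  exists k => z zr; rewrite cabs_subC; apply: (@le_trans _ _ (2 * e k)).
    apply: Ff; apply: (le_trans zr); apply: (@le_trans _ _ (r (Num.truncn `|r1|).+2)).
      apply: le_trans (rk _); apply: (le_trans (ler_norm _)).
      by rewrite ltW// truncnS_gt.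
    by rewrite rmono// leq_maxr.
  apply: le_trans (N0P k (leq_maxl _ _)); rewrite -mulrA ler_wpM2l//.
  exact: (egeo 0%N k).
exists F => // k; have [_ _ _ hQ] := sS k; apply: hQ => // z zr.
exact: (Ff k.+1).
Qed.

End Baire.

(** * Polynomials with Gaussian rational coefficients are dense *)

Section Separability.
Variable R : realType.
Notation C := (Cplx R).
Notation ci := (ci R).

Definition gauss (q : rat * rat) : C := rc (ratr q.1) + ci * rc (ratr q.2).

(** Encoding targets as sequences of pairs of rationals makes them a countable type, as the Baire
    argument requires. *)
Definition gauss_poly (s : seq (rat * rat)) (z : C) : C :=
  \sum_(i < size s) gauss (nth (0, 0) s i) * z ^+ i.

Lemma entire_gauss_poly s : entire (gauss_poly s).
Proof.
apply: entire_sum => i; apply: entireZ; apply: (@entireX R (fun z => z)).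
by apply/entire_cdiff => z; exact: cdiff_id.
Qed.

Lemma gauss_dense (z : C) (d : R) : 0 < d -> exists q, cabs (z - gauss q) <= d.
Proof.
move=> d0; have d2 : 0 < d / 2 by rewrite divr_gt0.
have near (x : R) : exists q : rat, `|x - ratr q| <= d / 2.
  have lt : x < x + d / 2 by rewrite ltrDl.
  have [q] := rat_in_itvoo lt; rewrite in_itv/= => /andP[h1 h2]; exists q.
  by rewrite ler_norml; lra.
have [x [y ->]] := C_ReIm z; have [p hp] := near x; have [q hq] := near y.
exists (p, q); rewrite /gauss /=.
have -> : rc x + ci * rc y - (rc (ratr p) + ci * rc (ratr q)) =
  rc (x - ratr p) + ci * rc (y - ratr q) by rewrite !rcB; ring.
rewrite [d]splitr; apply: (le_trans (cabsD _ _)); rewrite cabsM cabs_ci mul1r !cabs_rc.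
exact: lerD.
Qed.

Lemma gauss_poly_dense (f : C -> C) (r e : R) : entire f -> 0 < e ->
  exists s, forall z, cabs z <= r -> cabs (gauss_poly s z - f z) <= e.
Proof.
move=> fe e0; have e2 : 0 < e / 2 by rewrite divr_gt0.
pose r0 : R := `|r| + 1; have r01 : 1 <= r0 by rewrite lerDr.
have r00 : 0 < r0 by exact: lt_le_trans r01.
have rr0 : r <= r0 by rewrite (le_trans (ler_norm r))// lerDl.
have [M M0 fM] := entire_bounded (2 * r0) fe.
have [n nP] := half_pow_le (2 * M) e2.
pose d := e / 2 / (n.+1%:R * r0 ^+ n).
have d0 : 0 < d by rewrite !divr_gt0// mulr_gt0// exprn_gt0.
have [q qP] := choice (fun i => gauss_dense (coef f i) d0).
exists (mkseq q n) => z zr; rewrite /gauss_poly size_mkseq cabs_subC.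
have zr0 : cabs z <= r0 by exact: le_trans zr rr0.
apply: (le_trans (cabs_triangle (\sum_(i < n) coef f i * z ^+ i) _ _)); rewrite [e]splitr.
apply: lerD.
  apply: le_trans (nP n (leqnn _)).
  have r20 : 0 < 2 * r0 by rewrite mulr_gt0.
  have zr2 : cabs z <= 2 * r0 / 2 by rewrite mulrC mulKf.
  have fM' w : cabs w = 2 * r0 -> cabs (f w) <= M by move=> wr; apply: fM; rewrite wr.
  apply: (le_trans (taylor_remainder n fe r20 fM' zr2)).
  rewrite ler_wpM2l ?mulr_ge0 ?(ltW M0)// lerXn2r ?nnegrE ?divr_ge0 ?cabs_ge0 ?invr_ge0 ?(ltW r20)//.
  by rewrite ler_pdivrMr// mulrA mulVf ?mul1r.
rewrite -sumrB; apply: (le_trans (cabs_sum _ _ _)).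
apply: (@le_trans _ _ (\sum_(i < n) d * r0 ^+ n)).
  apply: ler_sum => i _; rewrite nth_mkseq// -mulrBl cabsM cabsX.
  apply: ler_pM; rewrite ?cabs_ge0 ?exprn_ge0 ?cabs_ge0//.
  apply: (@le_trans _ _ (r0 ^+ i)); first by rewrite lerXn2r ?nnegrE ?cabs_ge0 ?(ltW r00).
  by rewrite ler_weXn2l// ltnW.
rewrite sumr_const card_ord -[X in X <= _]mulr_natr.
have -> : d * r0 ^+ n * n%:R = e / 2 * (n%:R / n.+1%:R).
  by rewrite /d; field; rewrite ?expf_neq0 ?pnatr_eq0 ?gt_eqF.
by rewrite ler_piMr ?(ltW e2)// ler_pdivrMr// mul1r ler_nat.
Qed.
End Separability.


(** * The generic function and the algebra it generates *)

Section HypercyclicAlgebra.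
Variable R : realType.
Notation C := (Cplx R).
Variables (phi : C -> C) (A c : R).
Hypotheses (phi_entire : entire phi) (c0 : 0 < c).
Hypothesis phi_le : forall n, cabs (taylor_coef phi n) * n`!%:R <= A * c ^+ n.
Notation T := (diffop phi).

Lemma cabs_subX_le (a b : C) (K : R) n : 1 <= K -> cabs a <= K -> cabs b <= K ->
  cabs (a ^+ n - b ^+ n) <= n%:R * K ^+ n * cabs (a - b).
Proof.
move=> K1 aK bK; have K0 : 0 <= K by lra.
elim: n => [|n ih]; first by rewrite !expr0 subrr cabs0 mul0r mul0r.
have -> : a ^+ n.+1 - b ^+ n.+1 = a * (a ^+ n - b ^+ n) + (a - b) * b ^+ n.
  by rewrite !exprS; ring.
apply: (le_trans (cabsD _ _)); rewrite !cabsM cabsX.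
have h1 : cabs a * cabs (a ^+ n - b ^+ n) <= K * (n%:R * K ^+ n * cabs (a - b)).
  by apply: ler_pM; rewrite ?cabs_ge0.
have h2 : cabs (a - b) * cabs b ^+ n <= cabs (a - b) * K ^+ n.+1.
  rewrite ler_wpM2l ?cabs_ge0//; apply: (@le_trans _ _ (K ^+ n)).
    by rewrite lerXn2r ?nnegrE ?cabs_ge0.
  by rewrite ler_weXn2l.
apply: (le_trans (lerD h1 h2)); rewrite le_eqVlt; apply/orP; left; apply/eqP.
by rewrite exprS -natr1; ring.
Qed.

(** This makes the Baire conditions open: [T^N] is continuous for convergence on discs, with the
    loss of radius of [iter_diffop_le], and powers are Lipschitz where the functions are bounded by
    [K]. *)
Lemma iter_diffop_powers_close N M (u : C -> C) (r e : R) : entire u -> 0 < e ->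
  exists r' d : R, 0 < d /\ forall h, entire h ->
    (forall z, cabs z <= r' -> cabs (h z - u z) <= d) ->
    forall n z, (n <= M)%N -> cabs z <= r ->
      cabs (iter N T (fun z => h z ^+ n) z - iter N T (fun z => u z ^+ n) z) <= e.
Proof.
move=> ue e0; pose r' := r + N%:R * (2 * c).
have [K0 K00 uK] := entire_bounded r' ue; pose K := K0 + 1.
have K1 : 1 <= K by rewrite /K; lra.
have Kp : 0 < K by lra.
pose D := `|(2 * A) ^+ N| * (M%:R * K ^+ M) + 1.
have D0 : 0 < D.
  by rewrite ltr_wpDl// !mulr_ge0 ?exprn_ge0// ltW.
exists r', (Num.min 1 (e / D)); split; first by rewrite lt_min ltr01 divr_gt0.
move=> h he hu n z nM zr.
have hn : entire (fun z => h z ^+ n) by exact: entireX.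
have un : entire (fun z => (-1) * u z ^+ n) by apply: entireZ; exact: entireX.
have -> : iter N T (fun z => h z ^+ n) z - iter N T (fun z => u z ^+ n) z =
    iter N T (fun z => h z ^+ n + (-1) * u z ^+ n) z.
  rewrite (@iter_diffopD _ _ _ _ c0 phi_le N _ _ hn un).
  by rewrite (@iter_diffopZ _ _ _ _ c0 phi_le N _ _ (@entireX R u n ue)) mulN1r.
have E0 : 0 < e / D by rewrite divr_gt0.
have bound w : cabs w <= r' -> cabs (h w ^+ n + (-1) * u w ^+ n) <= M%:R * K ^+ M * (e / D).
  move=> wr; rewrite mulN1r; have := hu w wr; rewrite le_min => /andP[h1 h2].
  have uw : cabs (u w) <= K by apply: (le_trans (uK w wr)); rewrite lerDl.
  have hw : cabs (h w) <= K.
    by apply: (le_trans (cabs_le_dist _ (u w))); apply: lerD => //; exact: uK.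
  apply: (le_trans (cabs_subX_le n K1 hw uw)); apply: ler_pM => //.
  - by rewrite mulr_ge0 ?exprn_ge0// ltW.
  - exact: cabs_ge0.
  - apply: ler_pM => //; [by rewrite exprn_ge0// ltW|by rewrite ler_nat|].
    by rewrite ler_weXn2l.
have hsum : entire (fun z => h z ^+ n + (-1) * u z ^+ n) by exact: entireD.
apply: (le_trans (@iter_diffop_le _ _ _ _ c0 phi_le N _ r _ z hsum bound zr)).
apply: (@le_trans _ _ (`|(2 * A) ^+ N| * (M%:R * K ^+ M * (e / D)))).
  rewrite ler_wpM2r ?ler_norm// !mulr_ge0 ?exprn_ge0 ?invr_ge0 ?(ltW D0) ?(ltW e0) ?(ltW Kp)//.
have -> : `|(2 * A) ^+ N| * (M%:R * K ^+ M * (e / D)) = e * ((D - 1) / D).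
  by rewrite /D; field; rewrite -/D gt_eqF.
rewrite ler_piMr ?(ltW e0)// ler_pdivrMr// mul1r; lra.
Qed.

(* In this form the quantifiers range over a countable set. *)
Definition hc_condition (F : C -> C) := forall m M p s, (0 < m)%N -> exists N,
  (forall z, cabs z <= p%:R -> cabs (iter N T (fun z => F z ^+ m) z - gauss_poly s z) <= p.+1%:R^-1) /\
  forall n z, (m < n <= M)%N -> cabs z <= p%:R -> cabs (iter N T (fun z => F z ^+ n) z) <= p.+1%:R^-1.

Lemma exists_hc_condition : 1 < cabs (phi 0) ->
  ~ (exists a k : C, forall z, phi z = k * cexp (a * z)) ->
  (exists p, forall k, (0 < k)%N -> cabs (phi (k%:R * p)) < 1) ->
  exists2 F, entire F & hc_condition F.
Proof.
move=> phi0 nexp ray.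
pose code := (nat * nat * nat * seq (rat * rat))%type.
(* The condition is empty for a [k] that is not a code, and for [m = 0]; both cases are settled
   below with [u = f]. *)
pose Q k (F : C -> C) := forall m M p s, unpickle k = Some ((m, M, p, s) : code) -> (0 < m)%N ->
  exists N,
  (forall z, cabs z <= p%:R -> cabs (iter N T (fun z => F z ^+ m) z - gauss_poly s z) <= p.+1%:R^-1) /\
  forall n z, (m < n <= M)%N -> cabs z <= p%:R -> cabs (iter N T (fun z => F z ^+ n) z) <= p.+1%:R^-1.
have [|F Fe FQ] := @entire_baire R Q; last first.
  by exists F => // m M p s; apply: (FQ (pickle ((m, M, p, s) : code))); rewrite pickleK.
move=> k f r e fe e0.
case E : (unpickle k : option code) => [[[[m M] p] s]|]; last first.
  exists f, 0, 1; split=> // [z _|h _ _ m M p s]; first by rewrite subrr cabs0 ltW.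
  by rewrite E.
have [m0|m0] := posnP m.
  exists f, 0, 1; split=> // [z _|h _ _ m' M' p' s']; first by rewrite subrr cabs0 ltW.
  by rewrite E => -[<-]; rewrite m0.
(* Half of the tolerance [1 / (p + 1)] goes to the approximation step and half to the perturbation
   from [u] to [h]. *)
pose r1 := Num.max r p%:R; pose e1 := Num.min e (p.+1%:R^-1 / 2).
have p0 : 0 < p.+1%:R^-1 :> R by rewrite invr_gt0.
have e10 : 0 < e1 by rewrite lt_min e0 divr_gt0.
have [u [N [ue uf ug un]]] := approximation_step phi_entire c0 phi_le M r1 m0 phi0 nexp ray fe
  (@entire_gauss_poly R s) e10.
have p20 : 0 < p.+1%:R^-1 / 2 :> R by rewrite divr_gt0.
have [r' [d [d0 dP]]] := iter_diffop_powers_close N (maxn m M) p%:R ue p20.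
exists u, r', d; split=> // [z zr|h he hu m' M' p' s'].
  by apply: le_trans (uf z _) _; rewrite ?le_max ?zr// ge_min lexx.
rewrite E => -[<- <- <- <-] _; exists N.
have e1p : e1 <= p.+1%:R^-1 / 2 by rewrite ge_min lexx orbT.
have zr1 z : cabs z <= p%:R -> cabs z <= r1 by move=> zp; rewrite le_max zp orbT.
split=> [z zp|n z /andP[mn nM] zp].
  have h1 := dP h he hu m z (leq_maxl _ _) zp; have h2 := ug z (zr1 z zp).
  apply: (le_trans (cabs_triangle (iter N T (fun z => u z ^+ m) z) _ _)).
  by rewrite [leRHS]splitr; apply: lerD => //; exact: le_trans h2 e1p.
have nmax : (n <= maxn m M)%N by rewrite leq_max nM orbT.
have h1 := dP h he hu n z nmax zp.
have h2 : cabs (iter N T (fun z => u z ^+ n) z) <= e1 by apply: un; rewrite ?mn ?nM//; exact: zr1.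
apply: (le_trans (cabs_le_dist _ (iter N T (fun z => u z ^+ n) z))).
by rewrite [leRHS]splitr; apply: lerD => //; exact: le_trans h2 e1p.
Qed.

Lemma iter_diffop_poly N (P : {poly C}) (F : C -> C) : entire F ->
  iter N T (fun z => P.[F z]) = (fun z => \sum_(i < size P) P`_i * iter N T (fun z => F z ^+ i) z).
Proof.
move=> Fe; have -> : (fun z => P.[F z]) = (fun z => \sum_(i < size P) P`_i * F z ^+ i).
  by apply/funext => z; rewrite horner_coef.
rewrite (@iter_diffop_sum _ _ _ _ c0 phi_le N _ (index_enum _)
   (fun (i : 'I_(size P)) z => P`_i * F z ^+ i)); last first.
  by move=> i; apply: entireZ; exact: entireX.
apply/funext => z; apply: eq_bigr => i _.
by rewrite (@iter_diffopZ _ _ _ _ c0 phi_le N _ _ (@entireX R F i Fe)).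
Qed.

Lemma entire_poly (P : {poly C}) (F : C -> C) : entire F -> entire (fun z => P.[F z]).
Proof.
move=> Fe; have -> : (fun z => P.[F z]) = (fun z => \sum_(i < size P) P`_i * F z ^+ i).
  by apply/funext => z; rewrite horner_coef.
by apply: entire_sum => i; apply: entireZ; exact: entireX.
Qed.

Lemma hc_condition_poly (F : C -> C) (P : {poly C}) : entire F -> hc_condition F ->
  P.[0] = 0 -> P != 0 -> hypercyclic T (fun z => P.[F z]).
Proof.
move=> Fe FQ P0 Pn0; split; first exact: entire_poly.
move=> g ge; apply: closure_compact_open => r e e0.
have exm : exists m, P`_m != 0.
  by exists (size P).-1; rewrite -lead_coefE lead_coef_eq0.
case: (ex_minnP exm) => m Pm mmin.
have m0 : (0 < m)%N.
  by rewrite lt0n; apply: contraNneq Pm => ->; rewrite -horner_coef0 P0.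
have Pmp : 0 < cabs P`_m by rewrite cabs_gt0.
have e2 : 0 < e / 2 / cabs P`_m by rewrite !divr_gt0.
have [s sP] := gauss_poly_dense r (@entireZ R (P`_m)^-1 g ge) e2.
pose S := \sum_(i < size P) cabs P`_i.
have S0 : 0 <= S by apply: sumr_ge0 => i _; exact: cabs_ge0.
(* One integer encodes disc and tolerance: [p] exceeds [r], and [1 / (p + 1)] times the sum of the
   moduli of the coefficients of [P] is at most [e / 2]. *)
pose p := maxn (Num.truncn r).+1 (Num.truncn (S / (e / 2))).+1.
have rp : r <= p%:R.
  by apply: ltW; apply: (lt_le_trans (truncnS_gt r)); rewrite ler_nat leq_maxl.
have Sp : S * p.+1%:R^-1 <= e / 2.
  rewrite ler_pdivrMr// mulrC -ler_pdivrMr ?divr_gt0//; apply: ltW.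
  by apply: (lt_le_trans (truncnS_gt _)); rewrite ler_nat leqW// leq_maxr.
have [N [h1 h2]] := FQ m (size P) p s m0.
exists (iter N T (fun z => P.[F z])); first by exists N.
move=> z zr; have zp : cabs z <= p%:R by exact: le_trans zr rp.
rewrite (iter_diffop_poly N P Fe).
have mP : (m < size P)%N.
  by rewrite ltnNge; apply/negP => /leq_sizeP/(_ m (leqnn m))/eqP; rewrite (negbTE Pm).
(* [t i] is the deviation from the ideal behaviour: the target when [i = m], and 0 when [i > m]. For
   [i < m] the coefficient of [P] is 0, so [t i] may be anything. *)
pose t (i : 'I_(size P)) : C := iter N T (fun z => F z ^+ i) z - (if i == m :> nat then gauss_poly s z else 0).
have tP (i : 'I_(size P)) : cabs (P`_i * t i) <= cabs P`_i * p.+1%:R^-1.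
  rewrite cabsM; have [im|im|im] := ltngtP i m.
  - have -> : P`_i = 0 by apply/eqP; apply: contraTT im => /mmin; rewrite -leqNgt.
    by rewrite cabs0 !mul0r.
  - rewrite ler_wpM2l ?cabs_ge0// /t gtn_eqF// subr0; apply: h2 => //.
    by rewrite im /= ltnW.
  - by rewrite ler_wpM2l ?cabs_ge0// /t im eqxx; exact: h1.
have -> : \sum_(i < size P) P`_i * iter N T (fun z => F z ^+ i) z - g z =
   \sum_(i < size P) P`_i * t i + P`_m * (gauss_poly s z - (P`_m)^-1 * g z).
  have -> : \sum_(i < size P) P`_i * t i = \sum_(i < size P) P`_i * iter N T (fun z => F z ^+ i) z
      - P`_m * gauss_poly s z.
    rewrite /t; under [LHS]eq_bigr do rewrite mulrBr; rewrite sumrB; congr (_ - _).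
    rewrite (bigD1 (Ordinal mP))//= eqxx big1 ?addr0// => i im.
    by rewrite ifN ?mulr0//; apply: contraNneq im => im; apply/eqP/val_inj.
  by rewrite mulrBr mulrA divff// mul1r addrA subrK.
rewrite [e]splitr; apply: (le_trans (cabsD _ _)); apply: lerD; last first.
  by rewrite cabsM mulrC -ler_pdivlMr//; exact: sP.
apply: le_trans Sp; apply: (le_trans (cabs_sum _ _ _)).
by rewrite mulr_suml ler_sum.
Qed.

Lemma hypercyclic_algebra_diffop : 1 < cabs (phi 0) ->
  ~ (exists a k : C, forall z, phi z = k * cexp (a * z)) ->
  (exists p, forall k, (0 < k)%N -> cabs (phi (k%:R * p)) < 1) ->
  supports_hypercyclic_algebra T.
Proof.
move=> phi0 nexp ray; have [F Fe FQ] := exists_hc_condition phi0 nexp ray.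
exists [set h | exists2 P : {poly C}, P.[0] = 0 & h = fun z => P.[F z]]; split.
- split.
  + by move=> _ [P _ ->]; exact: entire_poly.
  + by exists 0; [rewrite horner0|apply/funext => z; rewrite horner0].
  + move=> _ _ [P P0 ->] [Q Q0 ->]; exists (P + Q).
      by rewrite hornerD P0 Q0 addr0.
    by apply/funext => z; rewrite hornerD.
  + move=> k _ [P P0 ->]; exists (k *: P); first by rewrite hornerZ P0 mulr0.
    by apply/funext => z; rewrite hornerZ.
  + move=> _ _ [P P0 ->] [Q Q0 ->]; exists (P * Q).
      by rewrite hornerM P0 mul0r.
    by apply/funext => z; rewrite hornerM.
- move=> E; have : [set h | exists2 P : {poly C}, P.[0] = 0 & h = fun z => P.[F z]] F.
    by exists 'X; [rewrite hornerX|apply/funext => z; rewrite hornerX].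
  (* If the algebra were zero, [F] would be 0; the condition with target the constant 1 and
     tolerance [1 / 2] would then give [1 <= 1 / 2] at the point 0. *)
  rewrite E => F0; have [N [h1 _]] := FQ 1%N 1%N 1%N [:: (1%Q, 0%Q)] isT.
  have z1 : cabs (0 : C) <= 1%:R by rewrite cabs0.
  have := h1 0 z1; rewrite F0.
  have -> : (fun z : C => (fun=> 0 : C) z ^+ 1) = (fun z => 0 * (fun=> 0) z).
    by apply/funext => z; rewrite expr1 mul0r.
  rewrite (@iter_diffopZ _ _ _ _ c0 phi_le N 0 _ (@entire_cst R 0)) mul0r sub0r cabsN.
  rewrite /gauss_poly /= big_ord1 /= expr0 mulr1 /gauss /= rmorph1 rmorph0 rc0 mulr0 addr0 rc1 cabs1.
  by lra.
- move=> _ [P P0 ->]; have [->|Pn0] := eqVneq P 0.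
    by right; apply/funext => z; rewrite horner0.
  by left; exact: hc_condition_poly.
Qed.

End HypercyclicAlgebra.

Transparent Cplx derive1 cabs cexp Int.

Theorem theorem1p1 (R : realType) (phi : Cplx R -> Cplx R)
  (phi_entire : entire phi)
  (phi_exp_type : exponential_type phi)
  (phi_nonconstant : ~ exists c : Cplx R, forall z, phi z = c)
  (phi_not_exp : ~ exists a c : Cplx R, forall z, phi z = c * cexp (a * z))
  (phi0 : 1 < cabs (phi 0))
  (phi_ray : exists w : Cplx R,
    (fun t : R => cabs (phi (t%:C * w))) @ +oo --> (0 : R)) :
  supports_hypercyclic_algebra (diffop phi).
Proof.
have [A [c [A0 c0 phi_le]]] := exp_type_coef_le phi_entire phi_exp_type.
apply: (hypercyclic_algebra_diffop phi_entire c0 phi_le phi0 phi_not_exp).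
have [w /cvgrPdist_lt/(_ 1 ltr01)[t [_ tP]]] := phi_ray.
(* [t0] is positive and larger than [t], so all its multiples [k t0] with [k >= 1] lie beyond [t] as
   well. *)
pose t0 := Num.max t 0 + 1.
have t01 : 1 <= t0 by rewrite lerDr le_max lexx orbT.
have tt0 : t < t0 by rewrite ltr_pwDr// le_max lexx.
exists (rc t0 * w) => k k0.
have := tP (k%:R * t0); rewrite sub0r normrN ger0_norm ?cabs_ge0//.
have -> : (k%:R * t0)%:C * w = k%:R * (rc t0 * w).
  by rewrite mulrA -rc_nat -rcM.
apply; apply: (lt_le_trans tt0).
by rewrite ler_peMl ?ler1n// (le_trans ler01).
Qed.
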